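(* Let $\lambda$ be a third-order Lagrangian on $W^3\subset J^3Y$. In a fibered chart $(V,\psi)$, $\psi=(x^i,y^\sigma)$, $V\subset W$, write $\lambda=\mathscr{L}\omega_0$ and put $$\Theta_\lambda=\mathscr{L}\omega_0+\left(\frac{\partial\mathscr{L}}{\partial y_j^\sigma}-d_p\frac{\partial\mathscr{L}}{\partial y_{pj}^\sigma}+d_pd_q\frac{\partial\mathscr{L}}{\partial y_{pqj}^\sigma}\right)\omega^\sigma\wedge\omega_j+\left(\frac{\partial\mathscr{L}}{\partial y_{kj}^\sigma}-d_p\frac{\partial\mathscr{L}}{\partial y_{kpj}^\sigma}\right)\omega_k^\sigma\wedge\omega_j+\frac{\partial\mathscr{L}}{\partial y_{klj}^\sigma}\,\omega_{kl}^\sigma\wedge\omega_j .$$ The following two conditions are equivalent: (a) $\Theta_\lambda$ is invariant under fibered chart transformations: for arbitrary two overlapping fibered charts $(V,\psi)$, $(\bar V,\bar\psi)$, the form $\bar\Theta_\lambda$ given by the same formula in the chart $(\bar V,\bar\psi)$ satisfies $(\bar\psi^{-1}\circ\psi)^*\bar\Theta_\lambda=\Theta_\lambda$, i.e. expressed through the coordinate transformation it coincides with $\Theta_\lambda$ on the overlap. (b) For arbitrary two overlapping fibered charts $(V,\psi)$, $\psi=(x^i,y^\sigma)$, and $(\bar V,\bar\psi)$, $\bar\psi=(\bar x^i,\bar y^\sigma)$, $$d_k\left(\left(\frac{\partial\mathscr{L}}{\partial y_{l_1l_2k}^\tau}\frac{\partial x^s}{\partial\bar x^p}-\frac{\partial\mathscr{L}}{\partial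 y_{l_1l_2s}^\tau}\frac{\partial x^k}{\partial\bar x^p}\right)\frac{\partial^2\bar x^p}{\partial x^{l_1}\partial x^{l_2}}\frac{\partial y^\tau}{\partial\bar y^\sigma}\right)=0$$ on the overlap, for all values of the free indices $s$ and $\sigma$.
   Context: $\pi:Y\to X$ is a smooth fibered manifold (surjective submersion) with $\dim X=n$; $J^rY$ is its $r$-th jet prolongation with projections $\pi^{r,s}:J^rY\to J^sY$ (with $J^0Y=Y$) and $\pi^r:J^rY\to X$. $W\subset Y$ is open and $W^r=(\pi^{r,0})^{-1}(W)$. A fibered chart $(V,\psi)$, $\psi=(x^i,y^\sigma)$, induces coordinates $(x^i,y^\sigma,y^\sigma_{j_1},\dots,y^\sigma_{j_1\dots j_r})$, $j_1\le\dots\le j_k$, on $V^r=(\pi^{r,0})^{-1}(V)$; $y^\sigma_{j_1\dots j_k}$ is understood symmetric in its lower indices. All fibered charts considered have domains in $W$; fibered chart transformations have the form $\bar x^k=\bar x^k(x^s)$, $\bar y^\sigma=\bar y^\sigma(x^s,y^\nu)$, prolonged to the jet coordinates. A Lagrangian of order $r$ is a $\pi^r$-horizontal $n$-form on $W^r$, in a chart $\lambda=\mathscr{L}\omega_0$ with $\mathscr{L}:V^r\to\mathbb{R}$. Notation: $\omega_0=dx^1\wedge\dots\wedge dx^n$, $\omega_j=i_{\partial/\partial x^j}\omega_0$ ($i$ is contraction), $\omega^\sigma_{j_1\dots j_k}=dy^\sigma_{j_1\dots j_k}-y^\sigma_{j_1\dots j_ks}dx^s$. The formal derivative is $d_i=\frac{\partial}{\partial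 x^i}+\sum_{k\ge0}\sum_{j_1\le\dots\le j_k}y^\sigma_{j_1\dots j_ki}\frac{\partial}{\partial y^\sigma_{j_1\dots j_k}}$ (ordinary partial derivatives), mapping functions on $V^r$ to functions on $V^{r+1}$. Repeated indices are summed over all values. The symbols $\frac{\partial\mathscr{L}}{\partial y^\sigma_{j_1\dots j_k}}$ in $\Theta_\lambda$ and in (b) denote symmetrized derivatives, defined for all index tuples: the ordinary partial derivative with respect to the coordinate $y^\sigma_{j_1\dots j_k}$ (indices sorted) divided by the number of distinct permutations of $(j_1,\dots,j_k)$. $\Theta_\lambda$ is a form on $V^5$. *)

(* Defs.v *)
From HB Require Import structures.
From mathcomp Require Import all_boot all_order all_algebra.
From mathcomp Require Import boolp classical_sets functions reals topology.
From mathcomp Require Import normedtype derive.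

Set Implicit Arguments.
Unset Strict Implicit.
Unset Printing Implicit Defensive.

Import Order.TTheory GRing.Theory Num.Theory.
Import numFieldNormedType.Exports.

Local Open Scope classical_set_scope.
Local Open Scope ring_scope.

Section Smooth.
Context {R : realType}.

Definition iter_derive (V W : normedModType R) (vs : seq V) (f : V -> W) : V -> W :=
  foldr (fun v (g : V -> W) => fun x => 'D_v g x) f vs.

(* Used only for open A. All iterated directional derivatives exist and are
   continuous, which in finite dimension is the usual notion of class C^oo. *)
Definition smooth_on (V W : normedModType R) (A : set V) (f : V -> W) : Prop :=
  forall (vs : seq V) (x : V), A x ->
    {for x, continuous (iter_derive vs f)} /\
    forall v : V, derivable (iter_derive vs f) x v.

Definition ebase (N : nat) (i : 'I_N) : 'rV[R]_N := delta_mx 0 i.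

End Smooth.

Section Manifold.
Context {R : realType}.

(* [cmap] is relevant on [cdom] only, and [cinv] on the image of [cdom] only. *)
Record chart (N : nat) (M : topologicalType) := Chart {
  cdom : set M;
  cmap : M -> 'rV[R]_N;
  cinv : 'rV[R]_N -> M }.

Definition crange (N : nat) (M : topologicalType) (c : chart N M) : set 'rV[R]_N :=
  cmap c @` cdom c.

Definition chart_valid (N : nat) (M : topologicalType) (c : chart N M) : Prop :=
  [/\ open (cdom c), open (crange c),
      {within cdom c, continuous (cmap c)},
      {within crange c, continuous (cinv c)} &
      forall y, cdom c y -> cinv c (cmap c y) = y].

Definition trans (N : nat) (M : topologicalType) (c c' : chart N M) :
  'rV[R]_N -> 'rV[R]_N := cmap c' \o cinv c.

Definition chart_compatible (N : nat) (M : topologicalType) (c c' : chart N M) : Prop :=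
  smooth_on (cmap c @` (cdom c `&` cdom c')) (trans c c') /\
  smooth_on (cmap c' @` (cdom c `&` cdom c')) (trans c' c).

Record manifold (N : nat) (M : topologicalType) := Manifold {
  atlas : set (chart N M);
  manifold_hausdorff : hausdorff_space M;
  manifold_countable : @second_countable M;
  atlas_valid : forall c, atlas c -> chart_valid c;
  atlas_cover : forall y, exists2 c, atlas c & cdom c y;
  atlas_compatible : forall c c', atlas c -> atlas c' -> chart_compatible c c';
  atlas_maximal : forall c, chart_valid c ->
    (forall c', atlas c' -> chart_compatible c c') -> atlas c }.

Definition smooth_map (N N' : nat) (M M' : topologicalType)
    (A : manifold N M) (A' : manifold N' M') (U : set M) (f : M -> M') : Prop :=
  {within U, continuous f} /\
  forall c c', atlas A c -> atlas A' c' ->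
    smooth_on (cmap c @` (U `&` cdom c `&` f @^-1` cdom c'))
              (cmap c' \o f \o cinv c).

Definition submersion (N N' : nat) (M M' : topologicalType)
    (A : manifold N M) (A' : manifold N' M') (f : M -> M') : Prop :=
  forall c c' y, atlas A c -> atlas A' c' -> cdom c y -> cdom c' (f y) ->
  forall w, exists v, 'D_v (cmap c' \o f \o cinv c) (cmap c y) = w.

End Manifold.

Arguments chart R N M : clear implicits.
Arguments manifold R N M : clear implicits.

Section JetCoordinates.
Context {R : realType} {n m : nat}.

Definition ord_le : rel 'I_n := fun i j => (i <= j)%N.

(* Sorted multi-indices j_1 <= ... <= j_k with k <= r. *)
Definition mindex (r : nat) := {J : r.-bseq 'I_n | sorted ord_le J}.

Definition mseq (r : nat) (J : mindex r) : seq 'I_n := val J.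

Definition jcoord (r : nat) := ('I_n + 'I_m * mindex r)%type.

(* The coordinate space of the r-th jet prolongation, with one real coordinate
   for each x^i and each y^sigma_J, J sorted of length at most r. *)
Definition jspace (r : nat) := 'rV[R]_#|{: jcoord r}|.

Definition xc (r : nat) (z : jspace r) (i : 'I_n) : R :=
  z 0 (enum_rank (inl i : jcoord r)).

(* y^sigma_J for an arbitrary tuple J, symmetric in J. The sum has exactly one
   term if J has length at most r, and is empty otherwise. *)
Definition yc (r : nat) (z : jspace r) (sigma : 'I_m) (J : seq 'I_n) : R :=
  \sum_(K : mindex r | mseq K == sort ord_le J)
    z 0 (enum_rank (inr (sigma, K) : jcoord r)).

Definition dx (r : nat) (i : 'I_n) : jspace r := ebase (enum_rank (inl i : jcoord r)).

Definition dy (r : nat) (sigma : 'I_m) (J : seq 'I_n) : jspace r :=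
  \sum_(K : mindex r | mseq K == sort ord_le J)
    ebase (enum_rank (inr (sigma, K) : jcoord r)).

(* The coordinate expression of pi^{r,s}, for s <= r. *)
Definition jproj (r s : nat) (z : jspace r) : jspace s :=
  \row_c match enum_val c with
         | inl i => xc z i
         | inr (sigma, K) => yc z sigma (mseq K)
         end.

(* The coordinates of pi^{r,0}: (x^i, y^sigma). *)
Definition jbase (r : nat) (z : jspace r) : 'rV[R]_(n + m) :=
  row_mx (\row_i xc z i) (\row_sigma yc z sigma [::]).

Definition pull (r s : nat) (F : jspace s -> R) : jspace r -> R :=
  F \o @jproj r s.

Definition pdx (r : nat) (i : 'I_n) (F : jspace r -> R) : jspace r -> R :=
  fun z => 'D_(dx r i) F z.

Definition pdy (r : nat) (sigma : 'I_m) (J : seq 'I_n) (F : jspace r -> R) :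
  jspace r -> R := fun z => 'D_(dy r sigma J) F z.

Definition sdy (r : nat) (sigma : 'I_m) (J : seq 'I_n) (F : jspace r -> R) :
  jspace r -> R := fun z => pdy sigma J F z / (size (permutations J))%:R.

Definition fd (r : nat) (i : 'I_n) (F : jspace r -> R) : jspace r.+1 -> R :=
  fun z => pdx i F (jproj r z) +
    \sum_(sigma : 'I_m) \sum_(J : mindex r)
      yc z sigma (rcons (mseq J) i) * pdy sigma (mseq J) F (jproj r z).

(* The value of a k-form at a point; vectors are tangent vectors of the
   coordinate space. *)
Definition covec (r k : nat) := ('I_k -> jspace r) -> R.

Definition multilinear (r k : nat) (a : covec r k) : Prop :=
  forall (v : 'I_k -> jspace r) (i : 'I_k) (t : R) (u w : jspace r),
    a [eta v with i |-> t *: u + w] =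
    t * a [eta v with i |-> u] + a [eta v with i |-> w].

Definition alternating (r k : nat) (a : covec r k) : Prop :=
  forall (v : 'I_k -> jspace r) (i j : 'I_k), i != j -> v i = v j -> a v = 0.

(* dx^1 /\ ... /\ dx^n *)
Definition omega0 (r : nat) : covec r n :=
  fun v => \det (\matrix_(i, j) xc (v j) i).

Definition first_ord (k : nat) (j : 'I_k) : 'I_k :=
  Ordinal (leq_ltn_trans (leq0n j) (ltn_ord j)).

(* omega_j is the contraction of omega0 by d/dx^j, inserted as first argument. *)
Definition omega1 (r : nat) (j : 'I_n) : covec r n.-1 :=
  fun v => omega0 (fun i => if unlift (first_ord j) i is Some i' then v i'
                            else dx r j).

(* The wedge product of a 1-form and a (k-1)-form; no factorial factor, which is
   the convention for which omega0 is the product of the dx^i. *)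
Definition wedge1 (r k : nat) (a : jspace r -> R) (b : covec r k.-1) : covec r k :=
  fun v => \sum_(i < k) (-1) ^+ i * a (v i) * b (fun i' => v (lift i i')).

(* omega^sigma_J at z, for J of length smaller than r. *)
Definition contact_form (r : nat) (sigma : 'I_m) (J : seq 'I_n) (z : jspace r) :
  jspace r -> R :=
  fun v => yc v sigma J - \sum_(s < n) yc z sigma (rcons J s) * xc v s.

Definition Theta (L : jspace 3 -> R) (z : jspace 5) : covec 5 n :=
  fun v =>
    pull L z * omega0 v
  + \sum_(sigma < m) \sum_(j < n)
      (pull (sdy sigma [:: j] L) z
       - \sum_(p < n) pull (fd p (sdy sigma [:: p; j] L)) z
       + \sum_(p < n) \sum_(q < n) fd p (fd q (sdy sigma [:: p; q; j] L)) z)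
      * wedge1 (contact_form sigma [::] z) (omega1 j) v
  + \sum_(sigma < m) \sum_(k < n) \sum_(j < n)
      (pull (sdy sigma [:: k; j] L) z
       - \sum_(p < n) pull (fd p (sdy sigma [:: k; p; j] L)) z)
      * wedge1 (contact_form sigma [:: k] z) (omega1 j) v
  + \sum_(sigma < m) \sum_(k < n) \sum_(l < n) \sum_(j < n)
      pull (sdy sigma [:: k; l; j] L) z
      * wedge1 (contact_form sigma [:: k; l] z) (omega1 j) v.

End JetCoordinates.

Arguments jspace R n m r : clear implicits.
Arguments covec R n m r k : clear implicits.

Section Fibered.
Context {R : realType} {n m : nat} {X Y : topologicalType}.
Variables (MX : manifold R n X) (MY : manifold R (n + m) Y) (pi : Y -> X).

Definition fibered_manifold : Prop :=
  [/\ smooth_map MY MX setT pi, set_surj setT setT pi & submersion MY MX pi].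

(* The chart (V, (x^i, y^sigma)) on Y together with its associated chart
   (pi(V), x^i) on X. *)
Record fchart := FChart {
  ftot : chart R (n + m) Y;
  fbase : chart R n X;
  ftot_atlas : atlas MY ftot;
  fbase_atlas : atlas MX fbase;
  fbase_dom : cdom fbase = pi @` cdom ftot;
  fchart_fibered : forall y, cdom ftot y ->
    lsubmx (cmap ftot y) = cmap fbase (pi y) }.

Definition fdom (c : fchart) : set Y := cdom (ftot c).

Definition local_section (x : X) (g : X -> Y) : Prop :=
  exists U : set X, [/\ open U, U x, smooth_map MX MY U g &
                        forall u, U u -> pi (g u) = u].

(* The partial derivative at x, of multi-index J, of the component y^sigma of
   the section g. *)
Definition section_deriv (c : fchart) (x : X) (g : X -> Y) (sigma : 'I_m)
    (J : seq 'I_n) : R :=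
  iter_derive [seq ebase j | j <- J]
    (fun u : 'rV[R]_n => cmap (ftot c) (g (cinv (fbase c) u)) 0 (rshift n sigma) : R)
    (cmap (fbase c) x).

Definition same_jet (r : nat) (x : X) (g h : X -> Y) : Prop :=
  g x = h x /\
  forall (c : fchart), fdom c (g x) ->
  forall (sigma : 'I_m) (J : seq 'I_n), (size J <= r)%N ->
    section_deriv c x g sigma J = section_deriv c x h sigma J.

(* A point of J^r Y, as the class of all pairs (x, g) representing it. *)
Record jet (r : nat) := Jet {
  jclass : set (X * (X -> Y));
  jet_rep : exists p : X * (X -> Y), local_section p.1 p.2 /\
    jclass = [set q | [/\ q.1 = p.1, local_section q.1 q.2 &
                          same_jet r p.1 p.2 q.2]] }.

Definition jrep (r : nat) (q : jet r) : X * (X -> Y) := sval (cid (jet_rep q)).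

(* pi^{r,0} *)
Definition jtarget (r : nat) (q : jet r) : Y := (jrep q).2 (jrep q).1.

(* V^r = (pi^{r,0})^{-1}(V) *)
Definition jpre (r : nat) (V : set Y) : set (jet r) := [set q | V (jtarget q)].

Definition jmap (r : nat) (c : fchart) (q : jet r) : jspace R n m r :=
  \row_a match enum_val a with
         | inl i => cmap (fbase c) (jrep q).1 0 i
         | inr (sigma, K) => section_deriv c (jrep q).1 (jrep q).2 sigma (mseq K)
         end.

Definition jrange (r : nat) (c : fchart) : set (jspace R n m r) :=
  @jmap r c @` jpre (fdom c).

Definition joverlap (r : nat) (c c' : fchart) : set (jspace R n m r) :=
  @jmap r c @` jpre (fdom c `&` fdom c').

(* The prolonged chart transformation from c to c', on [joverlap c c']. *)
Definition jtrans (r : nat) (c c' : fchart) (z : jspace R n m r) : jspace R n m r :=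
  xget 0 [set w | exists q : jet r,
    [/\ jpre (fdom c `&` fdom c') q, jmap c q = z & jmap c' q = w]].

Definition pullback (r k : nat) (Phi : jspace R n m r -> jspace R n m r)
    (a : jspace R n m r -> covec R n m r k) : jspace R n m r -> covec R n m r k :=
  fun z v => a (Phi z) (fun i => 'D_(v i) Phi z).

(* A smooth k-form on W^r, given by its expressions in all fibered charts with
   domain in W. *)
Record jform (W : set Y) (r k : nat) := JForm {
  jform_at : fchart -> jspace R n m r -> covec R n m r k;
  jform_multilinear : forall c, fdom c `<=` W -> forall z, jrange c z ->
    multilinear (jform_at c z);
  jform_alternating : forall c, fdom c `<=` W -> forall z, jrange c z ->
    alternating (jform_at c z);
  jform_smooth : forall c, fdom c `<=` W -> forall v,
    smooth_on (jrange c) (fun z => jform_at c z v : R);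
  jform_compatible : forall c c', fdom c `<=` W -> fdom c' `<=` W ->
    forall z, joverlap c c' z ->
    pullback (jtrans c c') (jform_at c') z = jform_at c z }.

(* A form is pi^r-horizontal if it vanishes whenever one of its arguments is
   pi^r-vertical. *)
Record lagrangian (W : set Y) (r : nat) := Lagrangian {
  lag_form :> jform W r n;
  lag_horizontal : forall c, fdom c `<=` W -> forall z, jrange c z ->
    forall (v : 'I_n -> jspace R n m r) (i : 'I_n),
    (forall k, xc (v i) k = 0) -> jform_at lag_form c z v = 0 }.

(* The function L with lambda = L omega0 in the chart c. *)
Definition lagL (W : set Y) (r : nat) (lam : lagrangian W r) (c : fchart) :
  jspace R n m r -> R := fun z => jform_at lam c z (fun i => dx r i).

Definition xtrans (c c' : fchart) : 'rV[R]_n -> 'rV[R]_n :=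
  trans (fbase c) (fbase c').

Definition ytrans (c c' : fchart) : 'rV[R]_(n + m) -> 'rV[R]_(n + m) :=
  trans (ftot c) (ftot c').

(* From here on c is the unbarred and c' the barred chart; at the point of
   coordinates u = (x, y) in the chart c: d^2 xbar^p / dx^{l1} dx^{l2}. *)
Definition d2xbar_dx (c c' : fchart) (p l1 l2 : 'I_n) (u : 'rV[R]_(n + m)) : R :=
  iter_derive [:: ebase l1; ebase l2] (fun x => xtrans c c' x 0 p : R) (lsubmx u).

(* d x^s / d xbar^p, evaluated at the barred coordinates of the point u. *)
Definition dx_dxbar (c c' : fchart) (s p : 'I_n) (u : 'rV[R]_(n + m)) : R :=
  'D_(ebase p) (fun x => xtrans c' c x 0 s : R) (xtrans c c' (lsubmx u)).

(* d y^tau / d ybar^sigma, evaluated at the barred coordinates of the point u. *)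
Definition dy_dybar (c c' : fchart) (tau sigma : 'I_m) (u : 'rV[R]_(n + m)) : R :=
  'D_(ebase (rshift n sigma)) (fun w => ytrans c' c w 0 (rshift n tau) : R)
    (ytrans c c' u).

Definition obstruction (c c' : fchart) (L : jspace R n m 3 -> R)
    (k s : 'I_n) (sigma : 'I_m) : jspace R n m 3 -> R :=
  fun z => \sum_(tau < m) \sum_(p < n) \sum_(l1 < n) \sum_(l2 < n)
    (sdy tau [:: l1; l2; k] L z * dx_dxbar c c' s p (jbase z)
     - sdy tau [:: l1; l2; s] L z * dx_dxbar c c' k p (jbase z))
    * d2xbar_dx c c' p l1 l2 (jbase z) * dy_dybar c c' tau sigma (jbase z).

End Fibered.

(* Main.v *)
Require Import Defs.
From HB Require Import structures.
From mathcomp Require Import all_boot all_order all_algebra.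
From mathcomp Require Import boolp classical_sets functions reals topology.
From mathcomp Require Import normedtype derive landau.
From mathcomp Require Import ring lra.
From mathcomp Require Import fingroup perm.
Set Implicit Arguments.
Unset Strict Implicit.
Unset Printing Implicit Defensive.
Import Order.TTheory GRing.Theory Num.Theory.
Import numFieldNormedType.Exports.
Local Open Scope classical_set_scope.
Local Open Scope ring_scope.

(** Say that a chart is free of third order if all derivatives of its Lagrange
    function L with respect to third-order coordinates vanish.  When n <= 1 both
    conditions of the theorem always hold, and when n >= 2 each of them is
    equivalent to the statement that every fibred chart in W is free of third
    order: the quantification over all charts is this strong because any chart
    can be sheared.

    If all charts are free of third order, the obstruction is identically zero,
    since it is linear in these derivatives; for n = 1 it vanishes because its
    two terms coincide.  To see that Theta is invariant, one evaluates it along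
    the jet of a section g, on tangent vectors written as horizontal lifts plus
    jets of variations xi of g ([Theta_along]).  What appears besides L omega_0
    is the momentum P^j(xi), the differential operator in xi for which the
    variation of L is d_j P^j(xi) + E xi ([first_variation]).  The variation of L
    is intrinsic up to the Jacobian determinant of the base transformation, and by
    the Piola identity ([piola], [nabla_div]) the momenta of the other chart,
    transported with that determinant and the inverse Jacobian, solve the same
    equation.  So the difference N of the two momenta is an operator whose
    divergence has order zero in xi.  Such an operator is zero as soon as its
    coefficients are totally symmetric ([divergence_order0], by testing on powers
    of a linear form).  For n <= 1 symmetry is automatic; without third-order
    derivatives N has order one, and the coefficients of its first-order part are
    symmetric because those of L are ([momentum_inv_dim1], [momentum_inv_order2]).
    This gives [Theta_invariant] for open subsets of coordinate spaces.  Charts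
    are brought into that form by showing that the range of a jet chart is the
    full preimage of the range of the chart ([jet_exists], with polynomial
    sections as representatives), that chart changes are the prolongations
    defined by iterated total derivatives ([jtransE]), and that L is multiplied by
    the Jacobian determinant ([lagL_law]).

    Conversely, let n >= 2, fix a chart and a point with base coordinates x0, a
    linear form l and a vector e with l(e) = 0 and e <> 0.  The map
    x |-> x + (l(x - x0)^d / d!) e is a diffeomorphism, and with unchanged fibre
    coordinates it gives another fibred chart on the same domain ([sheared]).
    Write C_k for the sum over l1, l2 of the symmetrized derivative of L with
    respect to y_(l1 l2 k), times the coefficients of l of index l1 and l2, and
    C(l) for the sum of the C_k times the coefficients of l.  For d = 3 the
    obstruction is l(x - x0) (C_k e^s - C_s e^k), so at x0 its total derivatives
    only see the linear factor, and their sum is C(l) e^s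
    ([third_free_of_obstruction]).  For d = 2 the Jacobian at x0 is the identity,
    and comparing momenta on variations with prescribed second-order jet shows
    that the coefficients of the first derivatives of xi, which are symmetric in
    both charts, differ by e^k C_j.
    So e^k C_j = e^j C_k, whence C(l) = 0 ([third_free_of_Theta]).  In both cases
    the cubic form C vanishes at every l, and polarization ([polarize3]) shows
    that the chart is free of third order. *)

(** * Directional derivatives along lines *)

Section Directional.
Context {R : realType} {V : normedModType R}.
Implicit Types (f : V -> R) (x v : V).

Lemma is_derive_line f x v (t : R) :
  derivable f (t *: v + x) v ->
  is_derive t (1 : R) (fun t => f (t *: v + x)) ('D_v f (t *: v + x)).
Proof.
move=> df.
have E : (fun h : R => h^-1 *: (((fun s : R => f (s *: v + x)) \o shift t) (h *: (1 : R))
        - f (t *: v + x))) =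
    (fun h : R => h^-1 *: ((f \o shift (t *: v + x)) (h *: v) - f (t *: v + x))).
  by apply: funext => h /=; rewrite [_ *: (1 : R)]mulr1 scalerDl addrA.
by apply: DeriveDef; rewrite ?/derivable ?/derive E.
Qed.

(** The mean value theorem on the segment between 0 and h; the bound on the norms
    covers both signs of h. *)
Lemma mvt_line f x v (h : R) :
  (forall t, `|t| <= `|h| -> derivable f (t *: v + x) v) ->
  exists2 t, `|t| <= `|h| & f (h *: v + x) - f x = h * 'D_v f (t *: v + x).
Proof.
move=> df; pose g t := f (t *: v + x).
have cg t : `|t| <= `|h| -> {for t, continuous g}.
  move=> th; apply: differentiable_continuous; apply/derivable1_diffP.
  by apply: ex_derive; apply: is_derive_line; exact: df.
have g0 : f x = g 0 by rewrite /g scale0r add0r.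
have [h0|h0] := leP 0 h.
  have inh t : t \in `[0, h]%R -> `|t| <= `|h|.
    by rewrite in_itv /= => /andP[t0 th]; rewrite !ger0_norm// (le_trans t0).
  have [||t ti E] := @MVT_segment R g (fun t => 'D_v f (t *: v + x)) 0 h h0.
  - move=> t ti; apply: is_derive_line; apply: df; apply: inh.
    by move: ti; rewrite !in_itv /= => /andP[/ltW -> /ltW ->].
  - apply: continuous_in_subspaceT => t /set_mem /= ti; exact/cg/inh.
  exists t; first exact: inh.
  by rewrite g0; move: E; rewrite subr0 mulrC.
have inh t : t \in `[h, 0]%R -> `|t| <= `|h|.
  rewrite in_itv /= => /andP[t0 th]; rewrite !ler0_norm// ?lerN2//.
  exact: ltW.
have [||t ti E] := @MVT_segment R g (fun t => 'D_v f (t *: v + x)) h 0 (ltW h0).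
- move=> t ti; apply: is_derive_line; apply: df; apply: inh.
  by move: ti; rewrite !in_itv /= => /andP[/ltW -> /ltW ->].
- apply: continuous_in_subspaceT => t /set_mem /= ti; exact/cg/inh.
exists t; first exact: inh.
by rewrite g0 -[LHS]opprB; move: E => ->; rewrite sub0r mulrN opprK mulrC.
Qed.

Lemma deriveZv f x v (c : R) : derivable f x v ->
  is_derive x (c *: v) f (c * 'D_v f x).
Proof.
move=> df.
have [->|c0] := eqVneq c 0; first by rewrite scale0r mul0r; exact: is_derive0.
have H : (fun h : R => h^-1 *: ((f \o shift x) (h *: (c *: v)) - f x)) =
    (fun h : R => c * ((fun k => k^-1 *: ((f \o shift x) (k *: v) - f x)) (h * c))).
  apply: funext => h /=; rewrite scalerA invfM /=; set d := f _ - _.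
  change (h^-1 * d = c * (h^-1 / c * d)).
  by rewrite mulrA [c * _]mulrCA divff// mulr1.
have C : (fun h : R => h^-1 *: ((f \o shift x) (h *: (c *: v)) - f x)) @ 0^'
    --> c * 'D_v f x.
  have K : (fun h : R => h * c) @ 0^' --> (0 : R)^'.
    move=> P [e /= e0 He]; exists (e / `|c|) => /=; first by rewrite divr_gt0 ?normr_gt0.
    move=> t /=; rewrite /ball_/= sub0r normrN ltr_pdivlMr ?normr_gt0// => te t0.
    apply: He => /=; last by rewrite mulf_neq0.
    by rewrite sub0r normrN normrM.
  by rewrite H; apply: cvgMl_tmp; exact: (cvg_comp _ _ K df).
by apply: DeriveDef; [apply/cvg_ex; exists (c * 'D_v f x)|exact/cvg_lim].
Qed.

(** Only the derivative along v has to exist near x and be continuous: moving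
    first along u and then along v, the mean value theorem controls the second step. *)
Lemma deriveDv f x u v : derivable f x u ->
  (\forall y \near x, derivable f y v) -> {for x, continuous ('D_v f)} ->
  is_derive x (u + v) f ('D_u f x + 'D_v f x).
Proof.
move=> du dv cv.
have C : (fun h : R => h^-1 *: ((f \o shift x) (h *: (u + v)) - f x)) @ 0^'
    --> 'D_u f x + 'D_v f x.
  have -> : (fun h : R => h^-1 *: ((f \o shift x) (h *: (u + v)) - f x)) =
      (fun h : R => h^-1 *: ((f \o shift x) (h *: u) - f x)) \+
      (fun h : R => h^-1 *: (f (h *: v + (h *: u + x)) - f (h *: u + x))).
    apply: funext => h /=; rewrite -[RHS]scalerDr; congr (_ *: _).
    by rewrite scalerDr [h *: v + (_ + _)]addrA [h *: v + _]addrC [RHS]addrC subrKA.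
  apply: cvgD; first exact: du.
  apply/cvgrPdist_le => e e0.
  move/cvgrPdist_le : cv => /(_ e e0) cv.
  have [r /= r0 Hr] := (@nbhs_ballP _ _ _ _).1 (filterI dv cv).
  have N0 : 0 < `|u| + `|v| + 1 by rewrite ltr_wpDl// addr_ge0.
  exists (r / (`|u| + `|v| + 1)) => /=; first by rewrite divr_gt0.
  move=> h /=; rewrite sub0r normrN ltr_pdivlMr// => hr h0.
  have inB t : `|t| <= `|h| -> ball x r (t *: v + (h *: u + x)).
    move=> th; rewrite -ball_normE /= addrA opprD addrCA subrr addr0 normrN.
    apply: le_lt_trans hr; apply: le_trans (ler_normD _ _) _.
    rewrite !normrZ !mulrDr mulr1 addrC -addrA lerD2l.
    by apply: (@le_trans _ _ (`|h| * `|v|)); [exact: ler_wpM2r|rewrite lerDl].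
  (* the increment along v, from a point displaced along u *)
  have [t th ->] : exists2 t, `|t| <= `|h| & f (h *: v + (h *: u + x)) - f (h *: u + x)
      = h * 'D_v f (t *: v + (h *: u + x)).
    by apply: mvt_line => t /inB/Hr[].
  rewrite [_ *: _]mulrA mulVf// mul1r.
  by have [_] := Hr _ (inB t th).
by apply: DeriveDef; [apply/cvg_ex; exists ('D_u f x + 'D_v f x)|exact/cvg_lim].
Qed.

End Directional.

(** * Continuous partial derivatives: total differentiability and Schwarz *)

Lemma linear_approx_differentiable (R : realType) (V W : normedModType R)
    (f : V -> W) x (L : {linear V -> W}) : continuous L ->
  (forall e, 0 < e -> \forall h \near 0, `|f (h + x) - f x - L h| <= e * `|h|) ->
  differentiable f x.
Proof.
move=> Lc H.
have E : f \o shift x = cst (f x) + L +o_ 0 id.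
  apply/eqaddoP => e e0; have := H e e0; apply: filterS => h.
  by rewrite -![(_ + _ : _ -> _) h]/(_ + _) -![(- _ : _ -> _) h]/(- _) /= opprD addrA.
by apply/diff_locallyP; rewrite (diff_unique Lc E).
Qed.

Lemma close_to_common (R : realFieldType) (a b p q e : R) :
  p = q -> `|b - p| <= e / 2 -> `|a - q| <= e / 2 -> `|a - b| <= e.
Proof.
move=> -> bq aq; rewrite (splitr e) -(subrKA q).
by apply: le_trans (ler_normD _ _) _; rewrite lerD// distrC.
Qed.

Section C1.
Context {R : realType} {N : nat}.
Implicit Types (f : 'rV[R]_N -> R) (x v : 'rV[R]_N) (A : set 'rV[R]_N).

Definition partials_cont A f := forall v y, A y ->
  derivable f y v /\ {for y, continuous ('D_v f)}.

(** Additivity and homogeneity in the direction, one coordinate at a time. *)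
Lemma derive_coord A f x v : open A -> partials_cont A f -> A x ->
  'D_v f x = \sum_i v 0 i * 'D_(ebase i) f x.
Proof.
move=> oA fA Ax; have Anear : \near x, A x by exact: open_nbhs_nbhs.
suff H : is_derive x v f (\sum_i v 0 i * 'D_(ebase i) f x) by exact: derive_val.
rewrite {1}[v]row_sum_delta.
apply: (big_ind2 (fun w d => is_derive x w f d)) => [|w1 d1 w2 d2 [w1d <-] [w2d <-]|i _].
- exact: is_derive0.
- apply: deriveDv; [exact: w1d| |exact: (fA w2 x Ax).2].
  by apply: (filterS _ Anear) => y Ay; exact: (fA w2 y Ay).1.
- by apply: deriveZv; exact: (fA (ebase i) x Ax).1.
Qed.

Lemma lin_coord_cont (c : 'I_N -> R) :
  continuous (fun v : 'rV[R]_N => \sum_i v 0 i * c i).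
Proof.
have -> : (fun v : 'rV[R]_N => \sum_i v 0 i * c i) =
    \sum_i (fun v : 'rV[R]_N => v 0 i * c i) by apply: funext => v; rewrite fct_sumE.
move=> v; apply: differentiable_continuous; apply: differentiable_sum => i.
by apply: differentiableM; [exact: differentiable_coord|exact: differentiable_cst].
Qed.

Lemma norm_coord x i : `|x 0 i| <= `|x|.
Proof.
rewrite [leRHS]/Num.Def.normr /= mx_normrE.
exact: (le_bigmax _ (fun ij : 'I_1 * 'I_N => `|x ij.1 ij.2|) (0, i)).
Qed.

(** Along the segment from x to x + h the mean value theorem replaces the increment
    by a derivative at an intermediate point, close to the one at x by continuity. *)
Lemma partials_differentiable A f x : open A -> partials_cont A f -> A x ->
  differentiable f x.
Proof.
move=> oA fA Ax.
pose L v := \sum_i v 0 i * 'D_(ebase i) f x.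
have Llin : linear L.
  move=> a u w; rewrite /L scaler_sumr -big_split /=; apply: eq_bigr => i _.
  by rewrite !mxE mulrDl -mulrA.
pose LM := GRing.isLinear.Build _ _ _ _ _ Llin.
pose LL : {linear 'rV[R]_N -> R} := HB.pack L LM.
have Lc : continuous LL by exact: lin_coord_cont.
apply: (linear_approx_differentiable Lc) => e e0.
  pose e' := e / N.+1%:R.
  have e'0 : 0 < e' by rewrite divr_gt0// ltr0n.
  have H : \forall y \near x, A y /\
      forall i, `|'D_(ebase i) f x - 'D_(ebase i) f y| <= e'.
    have h2 : \forall y \near x, forall i, `|'D_(ebase i) f x - 'D_(ebase i) f y| <= e'.
      apply: (filter_forall (nbhs_filter x)) => i; have [_ /cvgrPdist_le/(_ _ e'0)] := fA (ebase i) x Ax.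
      exact.
    exact: (filterI (open_nbhs_nbhs (conj oA Ax)) h2).
  have [r /= r0 Hr] := (@nbhs_ballP _ _ _ _).1 H.
  apply/nbhs_ballP; exists r => //= h; rewrite -ball_normE /= sub0r normrN => hr.
  have inB t : `|t| <= `|1 : R| -> ball x r (t *: h + x).
    rewrite normr1 -ball_normE /= opprD addrCA subrr addr0 normrN normrZ => t1.
    by apply: le_lt_trans hr; exact: ler_piMl.
  have [t t1] := @mvt_line _ _ f x h 1 (fun t t1 => (fA h _ (Hr _ (inB t t1)).1).1).
  rewrite scale1r mul1r => Eh.
  rewrite Eh /LL /= /L.
  rewrite (derive_coord _ oA fA (Hr _ (inB t t1)).1) -sumrB.
  apply: le_trans (ler_norm_sum _ _ _) _.
  apply: (@le_trans _ _ (\sum_(i < N) e' * `|h|)).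
    apply: ler_sum => i _; rewrite -mulrBr normrM mulrC; apply: ler_pM => //.
      by rewrite distrC; have [_] := Hr _ (inB t t1).
    exact: norm_coord.
  rewrite sumr_const card_ord -mulrnAl ler_wpM2r// -mulr_natr /e'.
  rewrite -mulrA ler_piMr//; first exact: ltW.
  by rewrite mulrC ler_pdivrMr ?ltr0n// mul1r ler_nat.
Qed.

Lemma derive_diff f x v : differentiable f x ->
  'D_v f x = \sum_i v 0 i * 'D_(ebase i) f x.
Proof.
move=> df; rewrite deriveE// {1}[v]row_sum_delta linear_sum /=.
by apply: eq_bigr => i _; rewrite linearZ /= deriveE.
Qed.

(** The second difference of f over a small parallelogram with sides along u and v is
    a mixed derivative at an intermediate point: apply the mean value theorem along u
    to the difference in the direction v, then along v to the derivative along u. *)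
Lemma second_difference A f x u v (h : R) : partials_cont A f -> partials_cont A ('D_u f) ->
  (forall s t, `|s| <= `|h| -> `|t| <= `|h| -> A (t *: v + (s *: u + x))) ->
  exists s t : R, [/\ `|s| <= `|h|, `|t| <= `|h| &
    f (h *: u + (h *: v + x)) - f (h *: v + x) - (f (h *: u + x) - f x) =
    h * (h * 'D_v ('D_u f) (t *: v + (s *: u + x)))].
Proof.
move=> fA fuA inA; pose g z := f (h *: v + z) - f z.
have z0 : `|0 : R| <= `|h| by rewrite normr0.
have gE s : `|s| <= `|h| -> is_derive (s *: u + x) u g
    ('D_u f (h *: v + (s *: u + x)) - 'D_u f (s *: u + x)).
  move=> sh.
  have d1 : derivable f (s *: u + x) u.
    by have [] := fA u (s *: u + x); first by have := inA s 0 sh z0; rewrite scale0r add0r.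
  have d2 : derivable f (h *: v + (s *: u + x)) u.
    by have [] := fA u _ (inA s h sh (lexx _)).
  have E : (fun k : R => k^-1 *: (((fun z => f (h *: v + z)) \o shift (s *: u + x)) (k *: u)
      - f (h *: v + (s *: u + x)))) =
      (fun k : R => k^-1 *: ((f \o shift (h *: v + (s *: u + x))) (k *: u)
        - f (h *: v + (s *: u + x)))).
    by apply: funext => k /=; rewrite addrCA.
  have i2 : is_derive (s *: u + x) u (fun z => f (h *: v + z))
      ('D_u f (h *: v + (s *: u + x))).
    by apply: DeriveDef; rewrite /derivable /derive E.
  exact: is_deriveB.
have [s sh E] := @mvt_line _ _ g x u h (fun s sh => @ex_derive _ _ _ _ _ _ _ (gE s sh)).
have [|t th Et] := @mvt_line _ _ ('D_u f) (s *: u + x) v h.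
  by move=> t th; have [] := fuA v _ (inA s t sh th).
exists s, t; split; [exact: sh|exact: th|].
rewrite -Et -(@derive_val _ _ _ _ _ _ _ (gE s sh)) -E /g [h *: v + (h *: u + x)]addrCA; ring.
Qed.

(** The second difference does not depend on the order of the two directions. *)
Lemma schwarz A f x u v : open A -> A x ->
  partials_cont A f -> partials_cont A ('D_u f) -> partials_cont A ('D_v f) ->
  'D_u ('D_v f) x = 'D_v ('D_u f) x.
Proof.
move=> oA Ax fA fuA fvA.
suff H e : 0 < e -> `|'D_u ('D_v f) x - 'D_v ('D_u f) x| <= e.
  apply/eqP; rewrite -subr_eq0 -normr_le0; apply/ler_addgt0Pl => e e0.
  by rewrite addr0; exact: H.
move=> e0.
have e2 : 0 < e / 2 by rewrite divr_gt0.
have H : \forall y \near x, [/\ A y,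
   `|'D_u ('D_v f) x - 'D_u ('D_v f) y| <= e / 2 &
   `|'D_v ('D_u f) x - 'D_v ('D_u f) y| <= e / 2].
  have h1 := open_nbhs_nbhs (conj oA Ax).
  have [_ /cvgrPdist_le/(_ _ e2) h2] := fvA u x Ax.
  have [_ /cvgrPdist_le/(_ _ e2) h3] := fuA v x Ax.
  by apply: (filterS _ (filterI h1 (filterI h2 h3))) => y [a [b c]]; exact: And3 a b c.
have [r /= r0 Hr] := (@nbhs_ballP _ _ _ _).1 H.
have N0 : 0 < `|u| + `|v| + 1 by rewrite ltr_wpDl// addr_ge0.
pose h := r / 2 / (`|u| + `|v| + 1).
have h0 : 0 < h by rewrite !divr_gt0.
have inB s t : `|s| <= `|h| -> `|t| <= `|h| -> ball x r (s *: u + (t *: v + x)).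
  move=> sh th; rewrite -ball_normE /= addrA opprD addrCA subrr addr0 normrN.
  apply: (@le_lt_trans _ _ (h * (`|u| + `|v| + 1))).
    apply: le_trans (ler_normD _ _) _; rewrite !normrZ -(gtr0_norm h0).
    rewrite !mulrDr mulr1 -[leLHS]addr0; apply: lerD => //.
    by apply: lerD; exact: ler_wpM2r.
  by rewrite divfK ?gt_eqF// ltr_pdivrMr// ltr_pMr// ltr1n.
have inB' s t : `|s| <= `|h| -> `|t| <= `|h| -> ball x r (t *: v + (s *: u + x)).
  by move=> sh th; rewrite addrCA; exact: inB.
have [s [t [sh th E1]]] := @second_difference A f x u v h fA fuA
  (fun s t sh th => let: And3 Ay _ _ := Hr _ (inB' s t sh th) in Ay).
have [t' [s' [th' sh' E2]]] := @second_difference A f x v u h fA fvA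
  (fun t s th sh => let: And3 Ay _ _ := Hr _ (inB s t sh th) in Ay).
have E3 : 'D_v ('D_u f) (t *: v + (s *: u + x)) = 'D_u ('D_v f) (s' *: u + (t' *: v + x)).
  have E12 : f (h *: u + (h *: v + x)) - f (h *: v + x) - (f (h *: u + x) - f x) =
      f (h *: v + (h *: u + x)) - f (h *: u + x) - (f (h *: v + x) - f x).
    by rewrite [h *: v + (h *: u + x)]addrCA; ring.
  exact: (mulfI (lt0r_neq0 h0) (mulfI (lt0r_neq0 h0) (etrans (esym E1) (etrans E12 E2)))).
have [_ _ Q1] := Hr _ (inB' s t sh th).
have [_ Q2 _] := Hr _ (inB s' t' sh' th').
exact: (close_to_common E3 Q1 Q2).
Qed.

End C1.

(** * Rules of differentiation *)

#[local] Opaque derive.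

Section DeriveRules.
Context {R : realType} {N : nat}.
Implicit Types (f g : 'rV[R]_N -> R) (x v : 'rV[R]_N).

Lemma D_cst (c : R) v x : 'D_v (fun _ : 'rV[R]_N => c) x = 0.
Proof. exact: derive_cst. Qed.

Lemma diff_add f g x : differentiable f x -> differentiable g x ->
  differentiable (fun y => f y + g y) x.
Proof. exact: differentiableD. Qed.

Lemma D_add f g v x : differentiable f x -> differentiable g x ->
  'D_v (fun y => f y + g y) x = 'D_v f x + 'D_v g x.
Proof. by move=> df dg; apply: deriveD; exact: diff_derivable. Qed.

Lemma diff_opp f x : differentiable f x -> differentiable (fun y => - f y) x.
Proof. exact: differentiableN. Qed.

Lemma D_opp f v x : differentiable f x -> 'D_v (fun y => - f y) x = - 'D_v f x.
Proof. by move=> df; apply: deriveN; exact: diff_derivable. Qed.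

Lemma diff_mul f g x : differentiable f x -> differentiable g x ->
  differentiable (fun y => f y * g y) x.
Proof. exact: differentiableM. Qed.

Lemma D_mul f g v x : differentiable f x -> differentiable g x ->
  'D_v (fun y => f y * g y) x = 'D_v f x * g x + f x * 'D_v g x.
Proof.
move=> df dg; have -> := @deriveM _ _ f g x v (diff_derivable df) (diff_derivable dg).
by rewrite addrC [X in X + _]mulrC.
Qed.

Lemma diff_sum (I : Type) (r : seq I) (P : pred I) (F : I -> 'rV[R]_N -> R) x :
  (forall i, P i -> differentiable (F i) x) ->
  differentiable (fun y => \sum_(i <- r | P i) F i y) x.
Proof.
move=> dF; have -> : (fun y => \sum_(i <- r | P i) F i y) = \sum_(i <- r | P i) F i.
  by rewrite fct_sumE.
elim/big_rec : _ => [|i g Pi dg]; first exact: differentiable_cst.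
by apply: differentiableD => //; exact: dF.
Qed.

Lemma D_sum (I : Type) (r : seq I) (P : pred I) (F : I -> 'rV[R]_N -> R) v x :
  (forall i, P i -> differentiable (F i) x) ->
  'D_v (fun y => \sum_(i <- r | P i) F i y) x = \sum_(i <- r | P i) 'D_v (F i) x.
Proof.
move=> dF; elim: r => [|i r IH].
  rewrite big_nil -[RHS](D_cst 0 v x); congr ('D_v _ x).
  by apply: funext => y; rewrite big_nil.
rewrite big_cons -IH; case: ifP => Pi; last first.
  by congr ('D_v _ x); apply: funext => y; rewrite big_cons Pi.
rewrite -D_add; [|exact: dF|exact: diff_sum].
by congr ('D_v _ x); apply: funext => y; rewrite big_cons Pi.
Qed.

Lemma diff_coord i x : differentiable (fun y : 'rV[R]_N => y 0 i) x.
Proof. exact: differentiable_coord. Qed.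

Lemma D_coord i v x : 'D_v (fun y : 'rV[R]_N => y 0 i) x = v 0 i.
Proof.
have := @derive_mx _ _ 1 N id x v (@derivable_id _ _ x v).
by move/matrixP/(_ 0 i); rewrite derive_id mxE => ->.
Qed.

Lemma diff_row M (g : 'rV[R]_N -> 'rV[R]_M) x :
  (forall i, differentiable (fun y => g y 0 i) x) -> differentiable g x.
Proof.
move=> dg; have -> : g = \sum_(i < M) (fun y => g y 0 i *: (ebase i : 'rV[R]_M)).
  apply: funext => y; rewrite fct_sumE; exact: row_sum_delta.
by apply: differentiable_sum => i; exact: differentiableZl.
Qed.

Lemma D_row M (g : 'rV[R]_N -> 'rV[R]_M) v x i :
  differentiable g x -> 'D_v g x 0 i = 'D_v (fun y => g y 0 i) x.
Proof. by move=> dg; rewrite derive_mx ?mxE//; exact: diff_derivable. Qed.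

Lemma diff_entry M (g : 'rV[R]_N -> 'rV[R]_M) x i :
  differentiable g x -> differentiable (fun y => g y 0 i) x.
Proof.
move=> dg; have dc : differentiable (fun z : 'rV[R]_M => z 0 i) (g x).
  exact: differentiable_coord.
exact: (differentiable_comp dg dc).
Qed.

Lemma D_comp M (W : normedModType R) (g : 'rV[R]_N -> 'rV[R]_M) (f : 'rV[R]_M -> W) v x :
  differentiable g x -> differentiable f (g x) ->
  'D_v (fun y => f (g y)) x = 'D_('D_v g x) f (g x).
Proof.
move=> dg df; rewrite deriveE; last exact: differentiable_comp.
rewrite (_ : (fun y => f (g y)) = f \o g)// diff_comp//= -!deriveE//.
Qed.

Lemma D_comp_sum M (g : 'rV[R]_N -> 'rV[R]_M) (f : 'rV[R]_M -> R) v x :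
  differentiable g x -> differentiable f (g x) ->
  'D_v (fun y => f (g y)) x = \sum_i 'D_v (fun y => g y 0 i) x * 'D_(ebase i) f (g x).
Proof.
move=> dg df; rewrite D_comp// derive_diff//; apply: eq_bigr => i _.
by rewrite D_row.
Qed.

Lemma D_eq_on (W : normedModType R) (A : set 'rV[R]_N) (f g : 'rV[R]_N -> W) v x : open A -> A x ->
  (forall y, A y -> f y = g y) -> 'D_v f x = 'D_v g x.
Proof.
move=> oA Ax fg; apply: near_eq_derive.
exact: (@filterS _ _ (nbhs_filter x) _ _ fg (open_nbhs_nbhs (conj oA Ax))).
Qed.

Lemma diff_eq_on (W : normedModType R) (A : set 'rV[R]_N) (f g : 'rV[R]_N -> W) x : open A -> A x ->
  (forall y, A y -> f y = g y) -> differentiable f x -> differentiable g x.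
Proof.
move=> oA Ax fg df; apply: (linear_approx_differentiable (diff_continuous df)) => e e0.
have /eqaddoP/(_ e e0) := diff_locally df.
have nA : \forall h \near (0 : 'rV[R]_N), A (h + x).
  have [r /= r0 Hr] := (@nbhs_ballP _ _ _ _).1 (open_nbhs_nbhs (conj oA Ax)).
  apply/nbhs_ballP; exists r => //= h; rewrite -ball_normE /= sub0r normrN => hr.
  by apply: Hr; rewrite -ball_normE /= opprD addrCA subrr addr0 normrN.
move=> H; apply: (filterS _ (filterI H nA)) => h [].
rewrite -![(_ + _ : _ -> _) h]/(_ + _) -![(- _ : _ -> _) h]/(- _) /= opprD addrA.
by move=> Hh Ah; rewrite -(fg _ Ah) -(fg _ Ax).
Qed.

End DeriveRules.

(** * Smooth functions on open sets *)

Section SmoothClass.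
Context {R : realType}.

(** Unlike [smooth_on], this class asks for total differentiability at each stage,
    which makes it stable under composition. *)
Fixpoint Ck (N k : nat) (A : set 'rV[R]_N) (f : 'rV[R]_N -> R) : Prop :=
  if k is k'.+1 then (forall x, A x -> differentiable f x) /\ forall v, Ck k' A ('D_v f)
  else forall x, A x -> {for x, continuous f}.

Definition sm (N : nat) (A : set 'rV[R]_N) (f : 'rV[R]_N -> R) := forall k, Ck k A f.

Definition smv (N M : nat) (A : set 'rV[R]_N) (g : 'rV[R]_N -> 'rV[R]_M) :=
  forall i, sm A (fun x => g x 0 i).

Lemma cont_eq_on N (W : normedModType R) (A : set 'rV[R]_N) (f g : 'rV[R]_N -> W) x :
  open A -> A x -> (forall y, A y -> f y = g y) ->
  {for x, continuous f} -> {for x, continuous g}.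
Proof.
move=> oA Ax fg; rewrite /prop_for /continuous_at -(fg _ Ax); apply: cvg_trans.
apply: (@near_eq_cvg _ _ _ (nbhs_filter x)).
exact: (@filterS _ _ (nbhs_filter x) _ _ fg (open_nbhs_nbhs (conj oA Ax))).
Qed.

Lemma cont_row N M (g : 'rV[R]_N -> 'rV[R]_M) x :
  (forall i, {for x, continuous (fun y => g y 0 i)}) -> {for x, continuous g}.
Proof.
move=> Hg; apply/(@cvgrPdist_le _ _ _ _ (nbhs_filter x)) => e e0.
have H : \forall y \near x, forall i, `|g x 0 i - g y 0 i| <= e.
  apply: (filter_forall (nbhs_filter x)) => i.
  by have /cvgrPdist_le/(_ _ e0) := Hg i.
apply: (@filterS _ _ (nbhs_filter x) _ _ _ H) => y Hy.
rewrite [leLHS]/Num.Def.normr/= mx_normrE (bigmax_le _ (ltW e0))//= => -[i j] _ /=.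
by rewrite ord1 !mxE; exact: Hy.
Qed.

Section Fixed.
Context {N : nat}.
Implicit Types (f g : 'rV[R]_N -> R) (A : set 'rV[R]_N).

Lemma Ck_cont k A f x : Ck k A f -> A x -> {for x, continuous f}.
Proof.
case: k => [|k] /=; first exact.
by move=> [df _] Ax; apply: differentiable_continuous; exact: df.
Qed.

Lemma CkS k A f : Ck k.+1 A f -> Ck k A f.
Proof.
elim: k f => [|k IH] f.
  by move=> H x Ax; exact: (Ck_cont H Ax).
by move=> [df Df]; split => // v; apply: IH; exact: Df.
Qed.

Lemma Ck_sub k A B f : (forall x, B x -> A x) -> Ck k A f -> Ck k B f.
Proof.
move=> BA; elim: k f => [|k IH] f /=; first by move=> H x /BA; exact: H.
move=> [df Df]; split; first by move=> x /BA; exact: df.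
by move=> v; apply: IH; exact: Df.
Qed.

Lemma Ck_ext k A f g : open A -> (forall x, A x -> f x = g x) -> Ck k A f -> Ck k A g.
Proof.
move=> oA; elim: k f g => [|k IH] f g fg /=.
  by move=> cf x Ax; exact: (cont_eq_on oA Ax fg (cf x Ax)).
move=> [df Df]; split; first by move=> x Ax; exact: (diff_eq_on oA Ax fg (df x Ax)).
move=> v; apply: (IH ('D_v f)); last exact: Df.
by move=> x Ax; exact: (D_eq_on v oA Ax fg).
Qed.

Lemma Ck_cst k A c : Ck k A (fun _ => c).
Proof.
elim: k c => [|k IH] c /=; first by move=> x _; exact: cst_continuous.
split; first by move=> x _; exact: differentiable_cst.
move=> v; rewrite (_ : 'D_v _ = fun=> 0); first exact: IH.
by apply: funext => x; exact: D_cst.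
Qed.

Lemma Ck_coord k A i : Ck k A (fun y => y 0 i).
Proof.
have d x : differentiable (fun y : 'rV[R]_N => y 0 i) x by exact: diff_coord.
case: k => [|k] /=; first by move=> x _; exact: differentiable_continuous.
split; first by move=> x _; exact: d.
move=> v; rewrite (_ : 'D_v _ = fun=> v 0 i); first exact: Ck_cst.
by apply: funext => x; exact: D_coord.
Qed.

Lemma Ck_add k A f g : open A -> Ck k A f -> Ck k A g -> Ck k A (fun y => f y + g y).
Proof.
move=> oA; elim: k f g => [|k IH] f g /=.
  by move=> cf cg x Ax; exact: (continuousD (cf x Ax) (cg x Ax)).
move=> [df Df] [dg Dg]; split.
  by move=> x Ax; apply: diff_add; [exact: df|exact: dg].
move=> v; apply: (Ck_ext oA _ (IH _ _ (Df v) (Dg v))) => x Ax.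
by rewrite D_add//; [exact: df|exact: dg].
Qed.

Lemma Ck_mul k A f g : open A -> Ck k A f -> Ck k A g -> Ck k A (fun y => f y * g y).
Proof.
move=> oA; elim: k f g => [|k IH] f g.
  by move=> cf cg x Ax; exact: (continuousM (cf x Ax) (cg x Ax)).
move=> Hf Hg; have [df Df] := Hf; have [dg Dg] := Hg; split.
  by move=> x Ax; apply: diff_mul; [exact: df|exact: dg].
move=> v; apply: (Ck_ext oA _ (Ck_add oA (IH _ _ (Df v) (CkS Hg)) (IH _ _ (CkS Hf) (Dg v)))) => x Ax.
by rewrite D_mul//; [exact: df|exact: dg].
Qed.

Lemma Ck_sum k A (I : Type) (r : seq I) (P : pred I) (F : I -> 'rV[R]_N -> R) : open A ->
  (forall i, P i -> Ck k A (F i)) -> Ck k A (fun y => \sum_(i <- r | P i) F i y).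
Proof.
move=> oA HF; elim: r => [|i r IH].
  by apply: (Ck_ext oA _ (Ck_cst k A 0)) => x _; rewrite big_nil.
case Pi : (P i).
  by apply: (Ck_ext oA _ (Ck_add oA (HF i Pi) IH)) => x _; rewrite big_cons Pi.
by apply: (Ck_ext oA _ IH) => x _; rewrite big_cons Pi.
Qed.

End Fixed.

Lemma Ck_diffv N M k A (g : 'rV[R]_N -> 'rV[R]_M) x : A x ->
  (forall i, Ck k.+1 A (fun x => g x 0 i)) -> differentiable g x.
Proof. by move=> Ax Hg; apply: diff_row => i; have [dg _] := Hg i; exact: dg. Qed.

Lemma Ck_comp N M k A B (g : 'rV[R]_N -> 'rV[R]_M) (f : 'rV[R]_M -> R) : open A ->
  (forall x, A x -> B (g x)) ->
  (forall i, Ck k A (fun x => g x 0 i)) -> Ck k B f -> Ck k A (fun x => f (g x)).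
Proof.
move=> oA gAB; elim: k f => [|k IH] f Hg Hf.
  move=> x Ax; have cg : {for x, continuous g} by apply: cont_row => i; exact: (Hg i x Ax).
  exact: (continuous_comp cg (Hf _ (gAB _ Ax))).
have dg x : A x -> differentiable g x by move=> Ax; exact: (Ck_diffv Ax Hg).
have [df Df] := Hf; split.
  by move=> x Ax; exact: (@differentiable_comp _ _ _ _ g f x (dg x Ax) (df _ (gAB _ Ax))).
move=> v.
have E x : A x -> \sum_i 'D_v (fun y => g y 0 i) x * 'D_(ebase i) f (g x) =
    'D_v (fun x => f (g x)) x.
  by move=> Ax; rewrite D_comp_sum//; [exact: dg|exact: (df _ (gAB _ Ax))].
apply: (Ck_ext oA E); apply: Ck_sum => // i _; apply: Ck_mul => //.
  by have [_] := Hg i; exact.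
exact: (IH ('D_(ebase i) f) (fun j => CkS (Hg j)) (Df _)).
Qed.

Section SmLemmas.
Context {N : nat}.
Implicit Types (f g : 'rV[R]_N -> R) (A : set 'rV[R]_N).

Lemma sm_diff A f x : sm A f -> A x -> differentiable f x.
Proof. by move=> /(_ 1%N)[df _]; exact: df. Qed.

Lemma sm_D A f v : sm A f -> sm A ('D_v f).
Proof. by move=> H k; have [_] := H k.+1; exact. Qed.

Lemma sm_sub A B f : (forall x, B x -> A x) -> sm A f -> sm B f.
Proof. by move=> BA H k; exact: Ck_sub (H k). Qed.

Lemma sm_ext A f g : open A -> (forall x, A x -> f x = g x) -> sm A f -> sm A g.
Proof. by move=> oA fg H k; exact: Ck_ext (H k). Qed.

Lemma sm_cst A c : sm A (fun _ => c).
Proof. by move=> k; exact: Ck_cst. Qed.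

Lemma sm_coord A i : sm A (fun y => y 0 i).
Proof. by move=> k; exact: Ck_coord. Qed.

Lemma sm_add A f g : open A -> sm A f -> sm A g -> sm A (fun y => f y + g y).
Proof. by move=> oA Hf Hg k; exact: Ck_add. Qed.

Lemma sm_mul A f g : open A -> sm A f -> sm A g -> sm A (fun y => f y * g y).
Proof. by move=> oA Hf Hg k; exact: Ck_mul. Qed.

Lemma sm_opp A f : open A -> sm A f -> sm A (fun y => - f y).
Proof.
move=> oA Hf; apply: (sm_ext oA _ (sm_mul oA (sm_cst A (-1)) Hf)) => x _.
by rewrite mulN1r.
Qed.

Lemma sm_sum A (I : Type) (r : seq I) (P : pred I) (F : I -> 'rV[R]_N -> R) : open A ->
  (forall i, P i -> sm A (F i)) -> sm A (fun y => \sum_(i <- r | P i) F i y).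
Proof. by move=> oA HF k; apply: Ck_sum => // i Pi; exact: HF. Qed.

Lemma sm_prod A (I : Type) (r : seq I) (P : pred I) (F : I -> 'rV[R]_N -> R) : open A ->
  (forall i, P i -> sm A (F i)) -> sm A (fun y => \prod_(i <- r | P i) F i y).
Proof.
move=> oA HF; elim: r => [|i r IH].
  by apply: (sm_ext oA _ (sm_cst A 1)) => x _; rewrite big_nil.
case Pi : (P i).
  by apply: (sm_ext oA _ (sm_mul oA (HF i Pi) IH)) => x _; rewrite big_cons Pi.
by apply: (sm_ext oA _ IH) => x _; rewrite big_cons Pi.
Qed.

Lemma sm_partials A f : sm A f -> partials_cont A f.
Proof.
move=> H v y Ay; split; first exact/diff_derivable/(sm_diff H).
exact: (Ck_cont (sm_D v H 0) Ay).
Qed.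

Lemma sm_schwarz A f u v x : open A -> A x -> sm A f ->
  'D_u ('D_v f) x = 'D_v ('D_u f) x.
Proof.
by move=> oA Ax H; apply: (schwarz oA Ax); apply: sm_partials => //; exact: sm_D.
Qed.

Lemma iter_derive_rcons (V W : normedModType R) (vs : seq V) v (f : V -> W) :
  iter_derive (rcons vs v) f = iter_derive vs ('D_v f).
Proof. by rewrite /iter_derive foldr_rcons. Qed.

Lemma sm_iter A f vs : sm A f -> sm A (iter_derive vs f).
Proof. by elim: vs => //= v vs IH /IH; exact: sm_D. Qed.

Lemma smooth_on_D A f v : smooth_on A f -> smooth_on A ('D_v f).
Proof. by move=> H vs x Ax; rewrite -iter_derive_rcons; exact: H. Qed.

(** A function in [smooth_on] has continuous partial derivatives of all orders, hence
    is totally differentiable at every stage. *)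
Lemma smooth_onP A f : open A -> smooth_on A f <-> sm A f.
Proof.
move=> oA; split=> [H k|H vs x Ax]; last first.
  split; first exact: (Ck_cont (sm_iter vs H 0) Ax).
  by move=> v; apply: diff_derivable; exact: (sm_diff (sm_iter vs H)).
elim: k f H => [|k IH] f H; first by move=> x Ax; exact: (H [::] x Ax).1.
split; last by move=> v; apply: IH; exact: smooth_on_D.
move=> x Ax; apply: (partials_differentiable oA _ Ax) => v y Ay.
by split; [exact: (H [::] y Ay).2|exact: (H [:: v] y Ay).1].
Qed.

Lemma sm_iter_eq_on A f g vs x : open A -> A x -> (forall y, A y -> f y = g y) ->
  iter_derive vs f x = iter_derive vs g x.
Proof.
move=> oA Ax fg; elim: vs x Ax => [|v vs IH] x Ax /=; first exact: fg.
exact: (D_eq_on _ oA Ax IH).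
Qed.

(** By induction, moving one entry to the front; each exchange is the Schwarz theorem. *)
Lemma sm_iter_perm A f vs ws x : open A -> A x -> sm A f -> perm_eq vs ws ->
  iter_derive vs f x = iter_derive ws f x.
Proof.
move=> oA Ax Hf; have cons_rem : forall (ws : seq 'rV[R]_N) v x, A x -> v \in ws ->
    iter_derive ws f x = iter_derive (v :: rem v ws) f x.
  elim=> // w ws' IH v {}x {}Ax; rewrite inE => /orP[/eqP->|vws].
    by rewrite /= eqxx.
  rewrite /=; case: eqVneq => [->//|wv] /=.
  rewrite (D_eq_on w oA Ax (fun y Ay => IH v y Ay vws)) /=.
  by rewrite (sm_schwarz _ _ oA Ax)//; exact: sm_iter.
elim: vs ws x Ax => [|v vs IH] ws x Ax.
  by rewrite perm_sym => /perm_nilP ->.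
move=> pvw; have vw : v \in ws by rewrite -(perm_mem pvw) mem_head.
rewrite (cons_rem ws v x Ax vw) /=; apply: (D_eq_on v oA Ax) => y Ay; apply: IH => //.
by rewrite -(perm_cons v); apply: (perm_trans pvw); exact: perm_to_rem.
Qed.

End SmLemmas.

Lemma sm_comp N M A B (g : 'rV[R]_N -> 'rV[R]_M) (f : 'rV[R]_M -> R) : open A ->
  (forall x, A x -> B (g x)) -> smv A g -> sm B f -> sm A (fun x => f (g x)).
Proof. by move=> oA AB Hg Hf k; apply: (Ck_comp oA AB) => // i; exact: Hg. Qed.

Lemma smv_diff N M A (g : 'rV[R]_N -> 'rV[R]_M) x : smv A g -> A x -> differentiable g x.
Proof. by move=> H Ax; apply: diff_row => i; exact: (sm_diff (H i) Ax). Qed.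

Lemma smv_cont N M A (g : 'rV[R]_N -> 'rV[R]_M) x : smv A g -> A x -> {for x, continuous g}.
Proof. by move=> H Ax; apply: differentiable_continuous; exact: (smv_diff H). Qed.

Lemma smooth_on_ev N M A (g : 'rV[R]_N -> 'rV[R]_M) i : open A ->
  smooth_on A g -> smooth_on A (fun x => g x 0 i).
Proof.
move=> oA H.
have E vs x : A x -> iter_derive vs (fun x => g x 0 i) x = iter_derive vs g x 0 i.
  elim: vs x => // v vs IH x Ax /=.
  rewrite (D_eq_on v oA Ax IH); have := derive_mx ((H vs x Ax).2 v).
  by move/matrixP/(_ 0 i); rewrite mxE => ->.
move=> vs x Ax; have [c d] := H vs x Ax; split.
  have : {for x, continuous (fun y => iter_derive vs g y 0 i)}.
    exact: (continuous_comp c (@coord_continuous _ _ _ 0 i _)).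
  by apply: (@cont_eq_on _ _ A) => // y Ay; rewrite E.
move=> v; have /derivable_mxP/(_ 0 i) := d v.
apply: near_eq_derivable.
exact: (@filterS _ _ (nbhs_filter x) _ _ (fun y Ay => esym (E vs y Ay)) (open_nbhs_nbhs (conj oA Ax))).
Qed.

Lemma iter_derive_row N M A (g : 'rV[R]_N -> 'rV[R]_M) vs x i : open A -> smv A g -> A x ->
  iter_derive vs g x 0 i = iter_derive vs (fun x => g x 0 i) x.
Proof.
move=> oA H; suff S : forall x, A x -> iter_derive vs g x =
    \row_i iter_derive vs (fun x => g x 0 i) x.
  by move=> Ax; rewrite S// mxE.
elim: vs => [|v vs IH] y Ay /=.
  by apply/rowP => j; rewrite mxE.
rewrite (D_eq_on v oA Ay IH); apply/rowP => j; rewrite D_row ?mxE.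
  by congr ('D_v _ y); apply: funext => z; rewrite mxE.
apply: diff_row => k; have := sm_diff (sm_iter vs (H k)) Ay.
by apply: (diff_eq_on oA Ay) => z _; rewrite mxE.
Qed.

(** Derivatives of a vector function exist in the norm iff they exist entrywise. *)
Lemma smooth_onvP N M A (g : 'rV[R]_N -> 'rV[R]_M) : open A -> smooth_on A g <-> smv A g.
Proof.
move=> oA; split=> [H i|H vs x Ax].
  by apply/(smooth_onP _ oA); exact: smooth_on_ev.
have d : differentiable (iter_derive vs g) x.
  apply: diff_row => i; have := sm_diff (sm_iter vs (H i)) Ax.
  by apply: (diff_eq_on oA Ax) => y Ay; rewrite (iter_derive_row _ _ oA H Ay).
by split; [exact: differentiable_continuous|move=> v; exact: diff_derivable].
Qed.

End SmoothClass.

(** * The first variation formula *)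

Section FirstVariation.
Context {R : realType} {n : nat} {T : Type}.
Variables (D : 'I_n -> (T -> R) -> T -> R).

(** The operator D is arbitrary, so that the same formulas serve for the partial
    derivatives and for the derivatives of another coordinate system. *)
Definition momentum (a1 : 'I_n -> T -> R) (a2 : 'I_n -> 'I_n -> T -> R)
    (a3 : 'I_n -> 'I_n -> 'I_n -> T -> R) (h : T -> R) (j : 'I_n) : T -> R := fun x =>
  (a1 j x - \sum_p D p (a2 p j) x + \sum_p \sum_q D p (D q (a3 p q j)) x) * h x
  + \sum_k (a2 k j x - \sum_p D p (a3 k p j) x) * D k h x
  + \sum_k \sum_l a3 k l j x * D k (D l h) x.

Definition linearization (a0 : T -> R) (a1 : 'I_n -> T -> R) (a2 : 'I_n -> 'I_n -> T -> R)
    (a3 : 'I_n -> 'I_n -> 'I_n -> T -> R) (h : T -> R) : T -> R := fun x =>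
  a0 x * h x + \sum_j a1 j x * D j h x + \sum_k \sum_j a2 k j x * D k (D j h) x
  + \sum_k \sum_l \sum_j a3 k l j x * D k (D l (D j h)) x.

Definition euler (a0 : T -> R) (a1 : 'I_n -> T -> R) (a2 : 'I_n -> 'I_n -> T -> R)
    (a3 : 'I_n -> 'I_n -> 'I_n -> T -> R) : T -> R := fun x =>
  a0 x - \sum_j (D j (a1 j) x - \sum_p D j (D p (a2 p j)) x
               + \sum_p \sum_q D j (D p (D q (a3 p q j))) x).

Variables (S : (T -> R) -> Prop) (x : T).
Hypothesis SD : forall j f, S f -> S (D j f).
Hypothesis S0 : S (fun _ => 0).
Hypothesis Sadd : forall f g, S f -> S g -> S (fun y => f y + g y).
Hypothesis Sopp : forall f, S f -> S (fun y => - f y).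
Hypothesis Smul : forall f g, S f -> S g -> S (fun y => f y * g y).
Hypothesis D0 : forall j, D j (fun _ => 0) x = 0.
Hypothesis Dadd : forall j f g, S f -> S g -> D j (fun y => f y + g y) x = D j f x + D j g x.
Hypothesis Dopp : forall j f, S f -> D j (fun y => - f y) x = - D j f x.
Hypothesis Dmul : forall j f g, S f -> S g ->
  D j (fun y => f y * g y) x = D j f x * g x + f x * D j g x.

Lemma Ssum (I : Type) (r : seq I) (F : I -> T -> R) :
  (forall i, S (F i)) -> S (fun y => \sum_(i <- r) F i y).
Proof.
move=> HF; elim: r => [|i r IH].
  by rewrite (_ : (fun _ => _) = fun=> 0)//; apply: funext => y; rewrite big_nil.
rewrite (_ : (fun _ => _) = fun y => F i y + \sum_(i <- r) F i y); first exact: Sadd.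
by apply: funext => y; rewrite big_cons.
Qed.

Lemma Dsum (I : Type) (r : seq I) (F : I -> T -> R) j :
  (forall i, S (F i)) -> D j (fun y => \sum_(i <- r) F i y) x = \sum_(i <- r) D j (F i) x.
Proof.
move=> HF; elim: r => [|i r IH].
  rewrite big_nil -[RHS](D0 j); congr (D j _ x).
  by apply: funext => y; rewrite big_nil.
rewrite big_cons -IH -Dadd//; last exact: Ssum.
by congr (D j _ x); apply: funext => y; rewrite big_cons.
Qed.

Lemma S_momentum a1 a2 a3 h j :
  (forall j, S (a1 j)) -> (forall k j, S (a2 k j)) ->
  (forall k l j, S (a3 k l j)) -> S h -> S (momentum a1 a2 a3 h j).
Proof.
move=> S1 S2 S3 Sh; apply: Sadd; first apply: Sadd.
- apply: Smul => //; apply: Sadd; first apply: Sadd => //.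
    by apply: Sopp; apply: Ssum => p; exact: SD.
  by apply: Ssum => p; apply: Ssum => q; do 2!apply: SD.
- apply: Ssum => k; apply: Smul; last exact: SD.
  by apply: Sadd => //; apply: Sopp; apply: Ssum => p; exact: SD.
- by apply: Ssum => k; apply: Ssum => l; apply: Smul => //; do 2!apply: SD.
Qed.

(** Integration by parts, moving every derivative from h to the coefficients; the
    symmetry of a2 and a3 is what matches the terms of [momentum]. *)
Lemma first_variation a0 a1 a2 a3 h :
  (forall j, S (a1 j)) -> (forall k j, S (a2 k j)) ->
  (forall k l j, S (a3 k l j)) -> S h ->
  (forall k j, a2 k j = a2 j k) ->
  (forall k l j, a3 k l j = a3 l k j) -> (forall k l j, a3 k l j = a3 k j l) ->
  linearization a0 a1 a2 a3 h x =
  \sum_j D j (momentum a1 a2 a3 h j) x + euler a0 a1 a2 a3 x * h x.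
Proof.
move=> S1 S2 S3 Sh sym2 sym3l sym3r.
(* the Leibniz rule, with terms grouped by the order of the derivative of h *)
have E j : D j (momentum a1 a2 a3 h j) x =
  (D j (a1 j) x - \sum_p D j (D p (a2 p j)) x
               + \sum_p \sum_q D j (D p (D q (a3 p q j))) x) * h x
  + (a1 j x - \sum_p D p (a2 p j) x + \sum_p \sum_q D p (D q (a3 p q j)) x) * D j h x
  + (\sum_k (D j (a2 k j) x * D k h x - (\sum_p D j (D p (a3 k p j)) x) * D k h x)
  + \sum_k (a2 k j x * D j (D k h) x - (\sum_p D p (a3 k p j) x) * D j (D k h) x))
  + (\sum_k \sum_l D j (a3 k l j) x * D k (D l h) x
  + \sum_k \sum_l a3 k l j x * D j (D k (D l h)) x).
  have Sc1 : S (fun x => a1 j x - \sum_p D p (a2 p j) x + \sum_p \sum_q D p (D q (a3 p q j)) x).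
    apply: Sadd; first apply: Sadd => //.
      by apply: Sopp; apply: Ssum => p; exact: SD.
    by apply: Ssum => p; apply: Ssum => q; do 2!apply: SD.
  have Sc2 k : S (fun x => a2 k j x - \sum_p D p (a3 k p j) x).
    by apply: Sadd => //; apply: Sopp; apply: Ssum => p; exact: SD.
  have St1 : S (fun x => (a1 j x - \sum_p D p (a2 p j) x + \sum_p \sum_q D p (D q (a3 p q j)) x) * h x).
    exact: Smul.
  have St2 k : S (fun x => (a2 k j x - \sum_p D p (a3 k p j) x) * D k h x).
    by apply: Smul => //; exact: SD.
  have St3 k l : S (fun x => a3 k l j x * D k (D l h) x).
    by apply: Smul => //; do 2!apply: SD.
  rewrite /momentum Dadd; first last.
  - by apply: Ssum => k; exact: Ssum.
  - by apply: Sadd => //; exact: Ssum.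
  rewrite Dadd//; last exact: Ssum.
  rewrite Dmul// Dsum// Dsum; last by move=> k; exact: Ssum.
  congr (_ + _ + _).
  - congr (_ * _ + _ * _); rewrite Dadd; first last.
    + by apply: Ssum => p; apply: Ssum => q; do 2!apply: SD.
    + by apply: Sadd => //; apply: Sopp; apply: Ssum => p; exact: SD.
    rewrite Dadd//; last by apply: Sopp; apply: Ssum => p; exact: SD.
    rewrite Dopp; last by apply: Ssum => p; exact: SD.
    rewrite Dsum; last by move=> p; exact: SD.
    congr (_ + _); rewrite Dsum; last by move=> p; apply: Ssum => q; do 2!apply: SD.
    by apply: eq_bigr => p _; rewrite Dsum// => q; do 2!apply: SD.
  - rewrite -big_split /=; apply: eq_bigr => k _.
    rewrite Dmul//; last exact: SD.
    rewrite -!mulrBl; congr (_ * _ + _ * _).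
    rewrite Dadd//; last by apply: Sopp; apply: Ssum => p; exact: SD.
    rewrite Dopp; last by apply: Ssum => p; exact: SD.
    by rewrite Dsum// => p; exact: SD.
  - rewrite -big_split /=; apply: eq_bigr => k _; rewrite Dsum//.
    rewrite -big_split /=; apply: eq_bigr => l _; rewrite Dmul//.
    by do 2!apply: SD.
rewrite (eq_bigr _ (fun j _ => E j)) !big_split /= /euler mulrBl.
rewrite -big_distrl /=.
set X0 := (\sum_(i < n) _) * h x.
have rev k l j : a3 k l j = a3 j l k by rewrite sym3l sym3r sym3l.
(* The terms of first and second order telescope after renaming indices. *)
have H1 : \sum_(j < n) (a1 j x - \sum_p D p (a2 p j) x + \sum_p \sum_q D p (D q (a3 p q j)) x) * D j h x
  = \sum_j a1 j x * D j h x - \sum_j \sum_k D j (a2 k j) x * D k h x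
  + \sum_j \sum_k (\sum_p D j (D p (a3 k p j)) x) * D k h x.
  rewrite [in X in _ = _ - X + _]exchange_big [in X in _ = _ + X]exchange_big /=.
  rewrite -sumrB -big_split /=; apply: eq_bigr => j _.
  rewrite mulrDl mulrBl; congr (_ - _ + _).
    by rewrite big_distrl /=; apply: eq_bigr => p _; rewrite sym2.
  rewrite big_distrl /=; apply: eq_bigr => p _; congr (_ * _).
  by apply: eq_bigr => q _; rewrite rev.
have H2 : \sum_(j < n) \sum_k (a2 k j x * D j (D k h) x - (\sum_p D p (a3 k p j) x) * D j (D k h) x)
  = \sum_k \sum_j a2 k j x * D k (D j h) x - \sum_j \sum_k \sum_l D j (a3 k l j) x * D k (D l h) x.
  have -> : \sum_j \sum_k \sum_l D j (a3 k l j) x * D k (D l h) x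
     = \sum_k \sum_l (\sum_j D j (a3 k l j) x) * D k (D l h) x.
    rewrite exchange_big /=; apply: eq_bigr => k _; rewrite exchange_big /=.
    by apply: eq_bigr => l _; rewrite big_distrl.
  rewrite -sumrB; apply: eq_bigr => j _; rewrite -sumrB; apply: eq_bigr => k _.
  congr (_ * _ - _ * _); first by rewrite sym2.
  by apply: eq_bigr => p _; rewrite sym3r sym3l.
have H3 : \sum_(j < n) \sum_k \sum_l a3 k l j x * D j (D k (D l h)) x
  = \sum_k \sum_l \sum_j a3 k l j x * D k (D l (D j h)) x.
  apply: eq_bigr => j _; apply: eq_bigr => k _; apply: eq_bigr => l _.
  by rewrite sym3r sym3l.
have H4 : \sum_(j < n) \sum_k (D j (a2 k j) x * D k h x - (\sum_p D j (D p (a3 k p j)) x) * D k h x)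
  = \sum_j \sum_k D j (a2 k j) x * D k h x - \sum_j \sum_k (\sum_p D j (D p (a3 k p j)) x) * D k h x.
  by rewrite -sumrB; apply: eq_bigr => j _; rewrite -sumrB.
rewrite H1 H2 H3 H4 /linearization; ring.
Qed.

End FirstVariation.

(** * Polarization and operators whose divergence has order zero *)

Section Polarization.
Context {R : realType} {n : nat}.

Lemma sum_delta (i : 'I_n) (F : 'I_n -> R) : \sum_j F j * (j == i)%:R = F i.
Proof.
rewrite (bigD1 i)//= eqxx mulr1 big1 ?addr0// => j /negPf ->; exact: mulr0.
Qed.

Lemma polarize2 (Q : 'I_n -> 'I_n -> R) : (forall i j, Q i j = Q j i) ->
  (forall l : 'I_n -> R, \sum_i \sum_j Q i j * l i * l j = 0) -> forall i j, Q i j = 0.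
Proof.
move=> sym H.
pose B u v := \sum_i \sum_j Q i j * u i * v j.
have Bs u v : B u v = B v u.
  rewrite /B exchange_big; apply: eq_bigr => i _; apply: eq_bigr => j _.
  by rewrite sym; ring.
have BD u v w : B (fun i => u i + v i) w = B u w + B v w.
  rewrite /B -big_split; apply: eq_bigr => i _; rewrite -big_split.
  by apply: eq_bigr => j _ /=; ring.
have B0 u v : B u v = 0.
  have HB w : B w w = 0 by exact: H.
  have := HB (fun i => u i + v i); rewrite BD (Bs u) (Bs v) !BD !HB (Bs v u); lra.
move=> i j; have := B0 (fun k => (k == i)%:R) (fun k => (k == j)%:R).
rewrite /B (eq_bigr (fun k => Q k j * (k == i)%:R)) ?sum_delta// => k _.
by rewrite (sum_delta j (fun q => Q k q * (k == i)%:R)).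
Qed.

(** Replacing l by u + v gives B(u,u,v) + B(u,v,v) = 0, and doubling v in it
    separates the two terms, which have degrees 1 and 2 in v. *)
Lemma polarize3 (C : 'I_n -> 'I_n -> 'I_n -> R) :
  (forall i j k, C i j k = C j i k) -> (forall i j k, C i j k = C i k j) ->
  (forall l : 'I_n -> R, \sum_i \sum_j \sum_k C i j k * l i * l j * l k = 0) ->
  forall i j k, C i j k = 0.
Proof.
move=> sl sr H.
pose B u v w := \sum_i \sum_j \sum_k C i j k * u i * v j * w k.
have B1 u v w : B u v w = B v u w.
  rewrite /B exchange_big; apply: eq_bigr => i _; apply: eq_bigr => j _.
  by apply: eq_bigr => k _; rewrite sl; ring.
have B2 u v w : B u v w = B u w v.
  rewrite /B; apply: eq_bigr => i _; rewrite exchange_big; apply: eq_bigr => j _.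
  by apply: eq_bigr => k _; rewrite sr; ring.
have BD u u' v w : B (fun i => u i + u' i) v w = B u v w + B u' v w.
  rewrite /B -big_split; apply: eq_bigr => i _; rewrite -big_split.
  apply: eq_bigr => j _ /=; rewrite -big_split.
  by apply: eq_bigr => k _ /=; ring.
have BD2 u v v' w : B u (fun i => v i + v' i) w = B u v w + B u v' w.
  by rewrite B1 BD B1 (B1 v').
have BD3 u v w w' : B u v (fun i => w i + w' i) = B u v w + B u v w'.
  by rewrite B2 BD2 B2 (B2 _ w').
have B0 u : B u u u = 0 by exact: H.
have Bs u v : B u u v + B u v v = 0.
  have := B0 (fun i => u i + v i); rewrite !(BD, BD2, BD3) !B0.
  by rewrite (B1 v u u) (B2 u v u) (B1 v u v) (B2 v v u) (B1 v u v); lra.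
have Buvv u v : B u v v = 0.
  by have := Bs u v; have := Bs u (fun i => v i + v i); rewrite !(BD2, BD3); lra.
have Bz u v w : B u v w = 0.
  by have := Buvv u (fun i => v i + w i); rewrite !(BD2, BD3) !Buvv (B2 u w v); lra.
move=> i j k.
have := Bz (fun a => (a == i)%:R) (fun a => (a == j)%:R) (fun a => (a == k)%:R).
rewrite /B (eq_bigr (fun a => C a j k * (a == i)%:R)) ?sum_delta// => a _.
rewrite (eq_bigr (fun b => C a b k * (a == i)%:R * (b == j)%:R)); last first.
  by move=> b _; rewrite sum_delta.
by rewrite (sum_delta j (fun b => C a b k * (a == i)%:R)).
Qed.

End Polarization.

Section LinearPowers.
Context {R : realType} {n : nat}.
Variables (l : 'I_n -> R) (x1 : 'rV[R]_n).

Definition linf (x : 'rV[R]_n) : R := \sum_i l i * (x 0 i - x1 0 i).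

(** The divided power linf^d / d!, for which differentiation produces no numerical factors. *)
Fixpoint dpow (d : nat) : 'rV[R]_n -> R :=
  if d is d'.+1 then fun x => dpow d' x * linf x * d%:R^-1 else fun=> 1.

Lemma linf_base : linf x1 = 0.
Proof. by rewrite /linf big1// => i _; rewrite subrr mulr0. Qed.

Lemma sm_linf A : open A -> sm A linf.
Proof.
move=> oA; apply: sm_sum => // i _; apply: sm_mul => //; first exact: sm_cst.
by apply: sm_add => //; [exact: sm_coord|exact: sm_cst].
Qed.

Lemma D_linf v x : 'D_v linf x = \sum_i l i * v 0 i.
Proof.
rewrite /linf D_sum; last first.
  move=> i _; apply: diff_mul; first exact: differentiable_cst.
  by apply: diff_add; [exact: diff_coord|exact: differentiable_cst].
apply: eq_bigr => i _; rewrite D_mul; first last.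
- by apply: diff_add; [exact: diff_coord|exact: differentiable_cst].
- exact: differentiable_cst.
rewrite D_add; [|exact: diff_coord|exact: differentiable_cst].
by rewrite !D_cst D_coord mul0r add0r addr0.
Qed.

Lemma D_linf_base k x : 'D_(ebase k) linf x = l k.
Proof.
rewrite D_linf (eq_bigr (fun i => l i * (i == k)%:R)) ?sum_delta// => i _.
by rewrite mxE eqxx.
Qed.

Lemma sm_dpow A d : open A -> sm A (dpow d).
Proof.
move=> oA; elim: d => [|d IH] /=; first exact: sm_cst.
by apply: sm_mul => //; [apply: sm_mul => //; exact: sm_linf|exact: sm_cst].
Qed.

Lemma D_dpow d v x : 'D_v (dpow d.+1) x = 'D_v linf x * dpow d x.
Proof.
have dl y : differentiable linf y by exact: (sm_diff (sm_linf openT)).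
have dd e y : differentiable (dpow e) y by exact: (sm_diff (sm_dpow e openT)).
elim: d x => [|d IH] x.
  rewrite /= (_ : (fun _ => _) = linf) ?mulr1//.
  by apply: funext => y; rewrite mul1r invr1 mulr1.
have dc : differentiable (fun _ : 'rV[R]_n => (d.+2%:R^-1 : R)) x by exact: differentiable_cst.
have E : dpow d.+2 = fun y => dpow d.+1 y * linf y * d.+2%:R^-1 by [].
rewrite E.
rewrite (D_mul _ (diff_mul (dd d.+1 x) (dl x)) dc).
rewrite D_cst mulr0 addr0 (D_mul _ (dd d.+1 x) (dl x)) IH /=.
have : d.+1%:R != 0 :> R by rewrite pnatr_eq0.
have : d.+2%:R != 0 :> R by rewrite pnatr_eq0.
have -> : d.+2%:R = d.+1%:R + 1 :> R by rewrite -natr1.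
by move: (d.+1%:R : R) => a h1 h2; field; rewrite h1 h2.
Qed.

Lemma dpow_base d : dpow d.+1 x1 = 0.
Proof. by rewrite /= linf_base mulr0 mul0r. Qed.

End LinearPowers.

Section Uniqueness.
Context {R : realType} {n : nat}.
Variables (U : set 'rV[R]_n) (oU : open U).

(** At the base point of the linear form only its first power has a nonzero derivative. *)
Lemma D_vanishing (c : 'rV[R]_n -> R) l x1 d j : sm U c -> U x1 ->
  'D_(ebase j) (fun y => c y * dpow l x1 d.+1 y) x1 = c x1 * l j * (d == 0%N)%:R.
Proof.
move=> Sc Ux; rewrite D_mul; [|exact: (sm_diff Sc)|exact: (sm_diff (sm_dpow _ _ _ oU))].
rewrite dpow_base mulr0 add0r D_dpow D_linf_base mulrA; congr (_ * _).
by case: d => [//|d]; rewrite dpow_base.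
Qed.

(** Testing on the d-th divided power of a linear form based at x, with d = 3, 2, 1 in
    turn, only the coefficients of order d - 1 survive, contracted with d copies of
    the form, and the right-hand side is zero.  The divergence only sees the
    symmetric part of the coefficients, which is why symmetry is assumed. *)
Lemma divergence_order0 (n2 : 'I_n -> 'I_n -> 'I_n -> 'rV[R]_n -> R)
    (n1 : 'I_n -> 'I_n -> 'rV[R]_n -> R) (n0 : 'I_n -> 'rV[R]_n -> R) (e : 'rV[R]_n -> R) :
  (forall j k l, sm U (n2 j k l)) -> (forall j k, sm U (n1 j k)) -> (forall j, sm U (n0 j)) ->
  (forall x, U x -> forall i j k, n2 i j k x = n2 j i k x) ->
  (forall x, U x -> forall i j k, n2 i j k x = n2 i k j x) ->
  (forall x, U x -> forall i j, n1 i j x = n1 j i x) ->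
  (forall h, sm setT h -> forall x, U x ->
    \sum_j 'D_(ebase j) (fun y => \sum_k \sum_l n2 j k l y * 'D_(ebase k) ('D_(ebase l) h) y
      + \sum_k n1 j k y * 'D_(ebase k) h y + n0 j y * h y) x = e x * h x) ->
  forall x, U x -> [/\ forall j k l, n2 j k l x = 0, forall j k, n1 j k x = 0
                     & forall j, n0 j x = 0].
Proof.
move=> S2 S1 S0 sl sr s1 H.
have Sd (l : 'I_n -> R) (x1 : 'rV[R]_n) d : sm U (dpow l x1 d) by exact: sm_dpow.
have Df (l : 'I_n -> R) (x1 : 'rV[R]_n) d k : 'D_(ebase k) (dpow l x1 d.+1) = fun x => l k * dpow l x1 d x.
  by apply: funext => x; rewrite D_dpow D_linf_base.
have Df2 (l : 'I_n -> R) (x1 : 'rV[R]_n) d k q x :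
    'D_(ebase k) ('D_(ebase q) (dpow l x1 d.+2)) x = l q * l k * dpow l x1 d x.
  rewrite (Df l x1 d.+1 q).
  have dc : differentiable (fun _ : 'rV[R]_n => l q) x by exact: differentiable_cst.
  have dl y : differentiable (dpow l x1 d.+1) y by exact: (sm_diff (sm_dpow _ _ _ openT)).
  by rewrite (D_mul (ebase k) dc (dl x)) D_cst mul0r add0r D_dpow D_linf_base mulrA.
have smul c (l : 'I_n -> R) (x1 : 'rV[R]_n) d : sm U c -> sm U (fun y => c y * dpow l x1 d y).
  by move=> Sc; exact: sm_mul.
have dmul c (l : 'I_n -> R) (x1 : 'rV[R]_n) d x : sm U c -> U x -> differentiable (fun y => c y * dpow l x1 d y) x.
  by move=> Sc; apply: sm_diff; exact: smul.
have Sl c (a : R) : sm U c -> sm U (fun y => c y * a).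
  by move=> Sc; apply: sm_mul => //; exact: sm_cst.
have N2 x : U x -> forall j k l, n2 j k l x = 0.
  move=> Ux; apply: polarize3; [exact: sl|exact: sr|] => l.
  have := H (dpow l x 3) (sm_dpow _ _ _ openT) x Ux.
  rewrite dpow_base mulr0 => Z; rewrite -[RHS]Z; apply: eq_bigr => j _.
  have -> : (fun y => \sum_k \sum_q n2 j k q y * 'D_(ebase k) ('D_(ebase q) (dpow l x 3)) y
      + \sum_k n1 j k y * 'D_(ebase k) (dpow l x 3) y + n0 j y * dpow l x 3 y) =
    (fun y => \sum_k \sum_q (n2 j k q y * (l q * l k)) * dpow l x 1 y
      + \sum_k (n1 j k y * l k) * dpow l x 2 y + n0 j y * dpow l x 3 y).
    apply: funext => y; congr (_ + _ + _).
      by apply: eq_bigr => k _; apply: eq_bigr => q _; rewrite Df2 mulrA.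
    by apply: eq_bigr => k _; rewrite D_dpow D_linf_base mulrA.
  rewrite D_add; first last.
  - exact: dmul.
  - apply: diff_add; apply: diff_sum => k _; last by apply: dmul => //; exact: Sl.
    by apply: diff_sum => q _; apply: dmul => //; exact: Sl.
  rewrite D_vanishing// mulr0 addr0 D_add; first last.
  - by apply: diff_sum => k _; apply: dmul => //; exact: Sl.
  - by apply: diff_sum => k _; apply: diff_sum => q _; apply: dmul => //; exact: Sl.
  rewrite D_sum; last by move=> k _; apply: diff_sum => q _; apply: dmul => //; exact: Sl.
  rewrite D_sum; last by move=> k _; apply: dmul => //; exact: Sl.
  rewrite [X in _ = _ + X]big1 ?addr0; last first.
    by move=> k _; rewrite D_vanishing ?mulr0//; exact: Sl.
  apply: eq_bigr => k _; rewrite D_sum; last by move=> q _; apply: dmul => //; exact: Sl.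
  by apply: eq_bigr => q _; rewrite D_vanishing ?mulr1//=; [ring|exact: Sl].
have H1 h : sm setT h -> forall x, U x -> \sum_j 'D_(ebase j) (fun y =>
    \sum_k n1 j k y * 'D_(ebase k) h y + n0 j y * h y) x = e x * h x.
  move=> Sh x Ux; rewrite -H//; apply: eq_bigr => j _; apply: (D_eq_on _ oU Ux) => y Uy.
  rewrite [X in _ = X + _ + _]big1 ?add0r// => k _; rewrite big1// => q _.
  by rewrite N2// mul0r.
have N1 x : U x -> forall j k, n1 j k x = 0.
  move=> Ux; apply: polarize2; [exact: s1|] => l.
  have := H1 (dpow l x 2) (sm_dpow _ _ _ openT) x Ux.
  rewrite dpow_base mulr0 => Z; rewrite -[RHS]Z; apply: eq_bigr => j _.
  have -> : (fun y => \sum_k n1 j k y * 'D_(ebase k) (dpow l x 2) y + n0 j y * dpow l x 2 y) =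
    (fun y => \sum_k (n1 j k y * l k) * dpow l x 1 y + n0 j y * dpow l x 2 y).
    by apply: funext => y; congr (_ + _); apply: eq_bigr => k _; rewrite D_dpow D_linf_base mulrA.
  rewrite D_add; first last.
  - exact: dmul.
  - by apply: diff_sum => k _; apply: dmul => //; exact: Sl.
  rewrite D_vanishing// mulr0 addr0 D_sum; last by move=> k _; apply: dmul => //; exact: Sl.
  by apply: eq_bigr => k _; rewrite D_vanishing ?mulr1//=; [ring|exact: Sl].
have H0 h : sm setT h -> forall x, U x -> \sum_j 'D_(ebase j) (fun y => n0 j y * h y) x = e x * h x.
  move=> Sh x Ux; rewrite -H1//; apply: eq_bigr => j _; apply: (D_eq_on _ oU Ux) => y Uy.
  by rewrite [X in _ = X + _]big1 ?add0r// => k _; rewrite N1// mul0r.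
move=> x Ux; split; [exact: N2|exact: N1|] => i.
have := H0 (dpow (fun j => (j == i)%:R) x 1) (sm_dpow _ _ _ openT) x Ux.
rewrite dpow_base mulr0 => Z; rewrite -[RHS]Z -(sum_delta i (fun j => n0 j x)).
by apply: eq_bigr => j _; rewrite D_vanishing ?mulr1.
Qed.

End Uniqueness.

(** * Changes of base coordinates and the Piola identity *)

Section DetDerive.
Context {R : realType} {N : nat}.

Lemma diff_prod (I : Type) (r : seq I) (F : I -> 'rV[R]_N -> R) x :
  (forall i, differentiable (F i) x) -> differentiable (fun y => \prod_(i <- r) F i y) x.
Proof.
move=> dF; elim: r => [|i r IH].
  rewrite (_ : (fun _ => _) = fun=> 1); first exact: differentiable_cst.
  by apply: funext => y; rewrite big_nil.
rewrite (_ : (fun _ => _) = fun y => F i y * \prod_(i <- r) F i y).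
  exact: (diff_mul (dF i) IH).
by apply: funext => y; rewrite big_cons.
Qed.

Lemma D_prod (I : eqType) (r : seq I) (F : I -> 'rV[R]_N -> R) v x : uniq r ->
  (forall i, differentiable (F i) x) ->
  'D_v (fun y => \prod_(i <- r) F i y) x =
  \sum_(i <- r) 'D_v (F i) x * \prod_(j <- r | j != i) F j x.
Proof.
move=> ur dF; elim: r ur => [_|i r IH /= /andP[ir ur]].
  rewrite big_nil -[RHS](D_cst 1 v x); congr ('D_v _ x).
  by apply: funext => y; rewrite big_nil.
rewrite (_ : (fun y => _) = fun y => F i y * \prod_(i <- r) F i y); last first.
  by apply: funext => y; rewrite big_cons.
rewrite (D_mul v (dF i) (diff_prod r dF)) (IH ur) big_cons; congr (_ * _ + _).
  rewrite big_cons eqxx /= [RHS]big_seq_cond [LHS]big_seq; apply: eq_bigl => j.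
  by case jr : (j \in r) => //=; apply/esym; apply: contraNneq ir => <-; rewrite jr.
rewrite big_distrr big_seq [RHS]big_seq; apply: eq_bigr => k kr /=.
have ik : i != k by apply: contraNneq ir => ->.
by rewrite big_cons ik mulrCA.
Qed.

(** The Leibniz formula differentiates one row at a time; expand along that row. *)
Lemma D_det k (M : 'I_k -> 'I_k -> 'rV[R]_N -> R) v x :
  (forall i j, differentiable (M i j) x) ->
  'D_v (fun y => \det (\matrix_(i, j) M i j y)) x =
  \sum_i \sum_j 'D_v (M i j) x * cofactor (\matrix_(i, j) M i j x) i j.
Proof.
move=> dM.
have dp (s : 'S_k) : differentiable (fun y => \prod_(i <- index_enum 'I_k) M i (s i) y) x.
  by apply: diff_prod => i.
have dsp (s : 'S_k) : differentiable
    (fun y => (-1) ^+ s * \prod_(i <- index_enum 'I_k) M i (s i) y) x.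
  by apply: diff_mul => //; exact: differentiable_cst.
have -> : (fun y => \det (\matrix_(i, j) M i j y)) =
    fun y => \sum_(s : 'S_k) (-1) ^+ s * \prod_(i <- index_enum 'I_k) M i (s i) y.
  apply: funext => y; rewrite /determinant; apply: eq_bigr => s _; congr (_ * _).
  by apply: eq_bigr => i _; rewrite mxE.
rewrite D_sum//.
pose A i : 'M[R]_k := \matrix_(a, b) if a == i then 'D_v (M i b) x else M a b x.
transitivity (\sum_i \det (A i)); last first.
  apply: eq_bigr => i _; rewrite (expand_det_row _ i); apply: eq_bigr => j _.
  rewrite mxE eqxx; congr (_ * _); rewrite /cofactor; congr (_ * \det _).
  by apply/matrixP => a b; rewrite !mxE eq_sym (negPf (neq_lift _ _)).
rewrite exchange_big /=; apply: eq_bigr => s _.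
have dc : differentiable (fun _ : 'rV[R]_N => ((-1) ^+ s : R)) x by exact: differentiable_cst.
rewrite (D_mul v dc (dp s)) D_cst mul0r add0r D_prod//; last exact: index_enum_uniq.
rewrite big_distrr /=; apply: eq_bigr => i _; congr (_ * _).
rewrite [RHS](bigD1 i)//= mxE eqxx; congr (_ * _); apply: eq_bigr => j /negPf ji.
by rewrite mxE ji.
Qed.

Lemma sm_det k (M : 'I_k -> 'I_k -> 'rV[R]_N -> R) A : open A ->
  (forall i j, sm A (M i j)) -> sm A (fun y => \det (\matrix_(i, j) M i j y)).
Proof.
move=> oA SM.
apply: (@sm_ext _ _ A (fun y => \sum_(s : 'S_k) (-1) ^+ s * \prod_i M i (s i) y)) => //.
  move=> x _; rewrite /determinant; apply: eq_bigr => s _; congr (_ * _).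
  by apply: eq_bigr => i _; rewrite mxE.
apply: sm_sum => // s _; apply: sm_mul => //; first exact: sm_cst.
exact: sm_prod.
Qed.

End DetDerive.

Section BaseChange.
Context {R : realType} {n : nat}.
Variables (U U' : set 'rV[R]_n) (phi phi' : 'rV[R]_n -> 'rV[R]_n).
Hypotheses (oU : open U) (oU' : open U') (Sphi : smv U phi) (Sphi' : smv U' phi').
Hypotheses (phiU : forall x, U x -> U' (phi x)) (phiK : forall x, U x -> phi' (phi x) = x).

Definition jac (a p : 'I_n) : 'rV[R]_n -> R := 'D_(ebase p) (fun y => phi y 0 a).
Definition jaci (p a : 'I_n) : 'rV[R]_n -> R :=
  fun x => 'D_(ebase a) (fun y => phi' y 0 p) (phi x).
Definition jacdet (x : 'rV[R]_n) : R := \det (\matrix_(a, p) jac a p x).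
(** In the coordinates x of the source, the partial derivative along the a-th
    coordinate of the target; [jaci] is the inverse Jacobian pulled back to the source. *)
Definition nabla (a : 'I_n) (f : 'rV[R]_n -> R) : 'rV[R]_n -> R :=
  fun x => \sum_p jaci p a x * 'D_(ebase p) f x.

Lemma sm_jac a p : sm U (jac a p). Proof. exact: sm_D. Qed.

Lemma sm_jaci p a : sm U (jaci p a).
Proof. exact: (sm_comp oU phiU Sphi (sm_D (ebase a) (Sphi' p))). Qed.

Lemma sm_jacdet : sm U jacdet. Proof. by apply: sm_det => // i j; exact: sm_jac. Qed.

Lemma sm_nabla a f : sm U f -> sm U (nabla a f).
Proof.
move=> Sf; apply: sm_sum => // p _; apply: sm_mul => //; first exact: sm_jaci.
exact: sm_D.
Qed.

Lemma jaciK x p q : U x -> \sum_a jaci p a x * jac a q x = (p == q)%:R.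
Proof.
move=> Ux; have := D_eq_on (ebase q) oU Ux (fun y Uy => congr1 (fun w : 'rV_n => w 0 p) (phiK Uy)).
rewrite D_coord mxE eqxx /= => <-.
have dphi := smv_diff Sphi Ux.
have dphi' := sm_diff (Sphi' p) (phiU Ux).
rewrite (D_comp_sum (ebase q) dphi dphi'); apply: eq_bigr => a _.
by rewrite mulrC.
Qed.

Lemma jacKi x a b : U x -> \sum_p jac a p x * jaci p b x = (a == b)%:R.
Proof.
move=> Ux; pose Jm := \matrix_(a, p) jac a p x; pose Ji := \matrix_(p, a) jaci p a x.
have /mulmx1C/matrixP/(_ a b) : Ji *m Jm = 1%:M.
  apply/matrixP => p q; rewrite !mxE -(jaciK p q Ux); apply: eq_bigr => c _.
  by rewrite !mxE.
by rewrite !mxE => <-; apply: eq_bigr => c _; rewrite !mxE.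
Qed.

Lemma jac_cofactor x a p : U x ->
  cofactor (\matrix_(a, p) jac a p x) a p = jacdet x * jaci p a x.
Proof.
move=> Ux; pose Jm := \matrix_(a, p) jac a p x; pose Ji := \matrix_(p, a) jaci p a x.
have JiJ : Ji *m Jm = 1%:M.
  apply/matrixP => i q; rewrite !mxE -(jaciK i q Ux); apply: eq_bigr => c _.
  by rewrite !mxE.
have /matrixP/(_ p a) : \adj Jm = jacdet x *: Ji.
  by rewrite -[LHS]mul1mx -JiJ -mulmxA mul_mx_adj mul_mx_scalar.
by rewrite !mxE.
Qed.

(** Differentiate the identity between the Jacobian matrix and its inverse. *)
Lemma D_jaci r p b x : U x ->
  'D_(ebase r) (jaci p b) x = - \sum_q \sum_a jaci p a x * 'D_(ebase r) (jac a q) x * jaci q b x.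
Proof.
move=> Ux.
have H q : \sum_a 'D_(ebase r) (jaci p a) x * jac a q x =
    - \sum_a jaci p a x * 'D_(ebase r) (jac a q) x.
  have := D_eq_on (ebase r) oU Ux (fun y Uy => jaciK p q Uy).
  rewrite D_cst D_sum; last first.
    by move=> a _; exact: (diff_mul (sm_diff (sm_jaci p a) Ux) (sm_diff (sm_jac a q) Ux)).
  rewrite (eq_bigr (fun a => 'D_(ebase r) (jaci p a) x * jac a q x
      + jaci p a x * 'D_(ebase r) (jac a q) x)); last first.
    by move=> a _; rewrite (D_mul _ (sm_diff (sm_jaci p a) Ux) (sm_diff (sm_jac a q) Ux)).
  by rewrite big_split /= => /eqP; rewrite addr_eq0 => /eqP.
rewrite -(sum_delta b (fun a => 'D_(ebase r) (jaci p a) x)) -sumrN.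
rewrite (eq_bigr (fun a => \sum_q 'D_(ebase r) (jaci p a) x * jac a q x * jaci q b x)); last first.
  by move=> a _; rewrite -(jacKi a b Ux) big_distrr; apply: eq_bigr => q _ /=; rewrite mulrA.
rewrite exchange_big; apply: eq_bigr => q _ /=.
by rewrite -big_distrl /= H mulNr big_distrl.
Qed.

(** The derivative of the determinant gives a trace, that of the inverse matrix gives
    minus a product; both involve the second derivatives of phi, and they cancel by
    the symmetry of these. *)
Lemma piola b x : U x -> \sum_p 'D_(ebase p) (fun y => jacdet y * jaci p b y) x = 0.
Proof.
move=> Ux.
have DJ p : 'D_(ebase p) jacdet x =
    jacdet x * \sum_a \sum_q 'D_(ebase p) (jac a q) x * jaci q a x.
  rewrite D_det; last by move=> a q; exact: (sm_diff (sm_jac a q) Ux).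
  rewrite big_distrr; apply: eq_bigr => a _; rewrite big_distrr; apply: eq_bigr => q _ /=.
  by rewrite jac_cofactor// mulrCA.
have S p a q : 'D_(ebase p) (jac a q) x = 'D_(ebase q) (jac a p) x.
  exact: (sm_schwarz _ _ oU Ux (Sphi a)).
rewrite (eq_bigr (fun p => jacdet x * (\sum_a \sum_q
   ('D_(ebase p) (jac a q) x * jaci q a x * jaci p b x
    - jaci p a x * 'D_(ebase p) (jac a q) x * jaci q b x)))); last first.
  move=> p _; rewrite (D_mul _ (sm_diff sm_jacdet Ux) (sm_diff (sm_jaci p b) Ux)) DJ D_jaci//.
  rewrite -mulrA -mulrDr; congr (_ * _); rewrite [X in - X]exchange_big -sumrN big_distrl -big_split.
  apply: eq_bigr => a _ /=; rewrite -sumrN big_distrl -big_split.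
  by apply: eq_bigr => q _.
rewrite -big_distrr /= exchange_big /= big1 ?mulr0// => a _.
rewrite (eq_bigr (fun p => \sum_q 'D_(ebase p) (jac a q) x * jaci q a x * jaci p b x
   - \sum_q jaci p a x * 'D_(ebase p) (jac a q) x * jaci q b x)); last first.
  by move=> p _; rewrite sumrB.
rewrite sumrB; apply/eqP; rewrite subr_eq0; apply/eqP; rewrite [RHS]exchange_big.
apply: eq_bigr => p _; apply: eq_bigr => q _; rewrite (S q a p).
by rewrite [jaci q a x * _]mulrC.
Qed.

(** The divergence in the target coordinates, computed in the source: the terms where
    the Jacobian factors are differentiated cancel by the Piola identity. *)
Lemma nabla_div (s : 'I_n -> 'rV[R]_n -> R) x : (forall b, sm U (s b)) -> U x ->
  \sum_p 'D_(ebase p) (fun y => jacdet y * \sum_b jaci p b y * s b y) x =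
  jacdet x * \sum_b nabla b (s b) x.
Proof.
move=> Ss Ux.
have Sdj p b : sm U (fun y => jacdet y * jaci p b y).
  exact: (sm_mul oU sm_jacdet (sm_jaci p b)).
rewrite (eq_bigr (fun p => \sum_b ('D_(ebase p) (fun y => jacdet y * jaci p b y) x * s b x
   + jacdet x * jaci p b x * 'D_(ebase p) (s b) x))); last first.
  move=> p _.
  have -> : (fun y => jacdet y * \sum_b jaci p b y * s b y) =
      fun y => \sum_b (jacdet y * jaci p b y) * s b y.
    by apply: funext => y; rewrite big_distrr; apply: eq_bigr => b _ /=; rewrite mulrA.
  rewrite D_sum; last first.
    by move=> b _; exact: (diff_mul (sm_diff (Sdj p b) Ux) (sm_diff (Ss b) Ux)).
  by apply: eq_bigr => b _; rewrite (D_mul _ (sm_diff (Sdj p b) Ux) (sm_diff (Ss b) Ux)).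
rewrite exchange_big big_distrr; apply: eq_bigr => b _ /=; rewrite big_split /= -big_distrl /=.
rewrite piola// mul0r add0r /nabla big_distrr; apply: eq_bigr => p _ /=.
by rewrite mulrA.
Qed.

Lemma nabla_comp (G : 'rV[R]_n -> R) a x : U x -> differentiable G (phi x) ->
  nabla a (fun y => G (phi y)) x = 'D_(ebase a) G (phi x).
Proof.
move=> Ux dG; have dphi := smv_diff Sphi Ux.
rewrite /nabla (eq_bigr (fun p => \sum_b (jac b p x * jaci p a x) * 'D_(ebase b) G (phi x))).
  rewrite exchange_big (eq_bigr (fun b => 'D_(ebase b) G (phi x) * (b == a)%:R)) ?sum_delta//.
  by move=> b _; rewrite -big_distrl /= jacKi// mulrC.
move=> p _; rewrite (D_comp_sum _ dphi dG) big_distrr; apply: eq_bigr => b _ /=.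
by rewrite mulrCA mulrA.
Qed.

Lemma nabla_cst a c x : nabla a (fun _ => c) x = 0.
Proof. by rewrite /nabla big1// => p _; rewrite D_cst mulr0. Qed.

Lemma nabla_add a f g x : U x -> sm U f -> sm U g ->
  nabla a (fun y => f y + g y) x = nabla a f x + nabla a g x.
Proof.
move=> Ux Sf Sg; rewrite -big_split; apply: eq_bigr => p _ /=.
by rewrite (D_add _ (sm_diff Sf Ux) (sm_diff Sg Ux)) mulrDr.
Qed.

Lemma nabla_opp a f x : U x -> sm U f -> nabla a (fun y => - f y) x = - nabla a f x.
Proof.
move=> Ux Sf; rewrite -sumrN; apply: eq_bigr => p _ /=.
by rewrite (D_opp _ (sm_diff Sf Ux)) mulrN.
Qed.

Lemma nabla_mul a f g x : U x -> sm U f -> sm U g ->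
  nabla a (fun y => f y * g y) x = nabla a f x * g x + f x * nabla a g x.
Proof.
move=> Ux Sf Sg; rewrite big_distrl big_distrr -big_split; apply: eq_bigr => p _ /=.
by rewrite (D_mul _ (sm_diff Sf Ux) (sm_diff Sg Ux)); ring.
Qed.

Lemma nabla_eq_on a f g x : U x -> (forall y, U y -> f y = g y) -> nabla a f x = nabla a g x.
Proof.
by move=> Ux fg; apply: eq_bigr => p _; rewrite (D_eq_on _ oU Ux fg).
Qed.

End BaseChange.

(** * Invariance of the momenta under changes of base coordinates *)

Section Operators.
Context {R : realType} {n : nat}.
Variables (U : set 'rV[R]_n) (oU : open U).
Local Notation fn := ('rV[R]_n -> R).

(** In dimension one the coefficients of the difference of momenta are symmetric
    whatever they are, so only their existence matters. *)
Definition op2 (T : fn -> fn) : Prop := exists (c2 : 'I_n -> 'I_n -> fn) (c1 : 'I_n -> fn) (c0 : fn),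
  [/\ forall k l, sm U (c2 k l), forall k, sm U (c1 k), sm U c0 &
   forall h, sm U h -> forall x, U x -> T h x =
     \sum_k \sum_l c2 k l x * 'D_(ebase k) ('D_(ebase l) h) x
     + \sum_k c1 k x * 'D_(ebase k) h x + c0 x * h x].

Lemma op2_ext T T' : (forall h, sm U h -> forall x, U x -> T h x = T' h x) -> op2 T -> op2 T'.
Proof.
move=> E [c2 [c1 [c0 [h2 h1 h0 H]]]]; exists c2, c1, c0; split => // h Sh x Ux.
by rewrite -(E _ Sh _ Ux) H.
Qed.

Lemma op2_0 : op2 (fun _ _ => 0).
Proof.
exists (fun _ _ _ => 0), (fun _ _ => 0), (fun _ => 0); split; [by move=> *; exact: sm_cst|by move=> *; exact: sm_cst|exact: sm_cst|move=> h _ x _].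
rewrite mul0r addr0 [X in X + _]big1; last by move=> k _; rewrite big1// => l _; rewrite mul0r.
by rewrite add0r big1// => k _; rewrite mul0r.
Qed.

Lemma op2_add T T' : op2 T -> op2 T' -> op2 (fun h x => T h x + T' h x).
Proof.
move=> [c2 [c1 [c0 [h2 h1 h0 H]]]] [d2 [d1 [d0 [k2 k1 k0 K]]]].
exists (fun k l x => c2 k l x + d2 k l x), (fun k x => c1 k x + d1 k x), (fun x => c0 x + d0 x).
split; [by move=> k l; exact: sm_add|by move=> k; exact: sm_add|exact: sm_add|].
move=> h Sh x Ux; rewrite H// K// mulrDl; apply/esym.
rewrite [X in X + _ + _](_ : _ = \sum_k \sum_l c2 k l x * 'D_(ebase k) ('D_(ebase l) h) x
   + \sum_k \sum_l d2 k l x * 'D_(ebase k) ('D_(ebase l) h) x); last first.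
  rewrite -big_split; apply: eq_bigr => k _ /=; rewrite -big_split.
  by apply: eq_bigr => l _ /=; rewrite mulrDl.
rewrite [X in _ + X + _](_ : _ = \sum_k c1 k x * 'D_(ebase k) h x
   + \sum_k d1 k x * 'D_(ebase k) h x); first by ring.
by rewrite -big_split; apply: eq_bigr => k _ /=; rewrite mulrDl.
Qed.

Lemma op2_mul f T : sm U f -> op2 T -> op2 (fun h x => f x * T h x).
Proof.
move=> Sf [c2 [c1 [c0 [h2 h1 h0 H]]]].
exists (fun k l x => f x * c2 k l x), (fun k x => f x * c1 k x), (fun x => f x * c0 x).
split; [by move=> k l; exact: sm_mul|by move=> k; exact: sm_mul|exact: sm_mul|].
move=> h Sh x Ux; rewrite H// !mulrDr !big_distrr mulrA; congr (_ + _ + _).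
  by apply: eq_bigr => k _; rewrite big_distrr; apply: eq_bigr => l _ /=; rewrite mulrA.
by apply: eq_bigr => k _ /=; rewrite mulrA.
Qed.

Lemma op2_sum (I : Type) (r : seq I) (T : I -> fn -> fn) : (forall i, op2 (T i)) ->
  op2 (fun h x => \sum_(i <- r) T i h x).
Proof.
move=> HT; elim: r => [|i r IH].
  by apply: (op2_ext _ op2_0) => h _ x _; rewrite big_nil.
by apply: (op2_ext _ (op2_add (HT i) IH)) => h _ x _; rewrite big_cons.
Qed.

Lemma op2_id : op2 (fun h => h).
Proof.
exists (fun _ _ _ => 0), (fun _ _ => 0), (fun _ => 1); split; [by move=> *; exact: sm_cst|by move=> *; exact: sm_cst|exact: sm_cst|move=> h _ x _].
rewrite mul1r [X in X + _ + _]big1; last by move=> k _; rewrite big1// => l _; rewrite mul0r.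
by rewrite add0r big1 ?add0r// => k _; rewrite mul0r.
Qed.

Lemma op2_D k : op2 (fun h => 'D_(ebase k) h).
Proof.
exists (fun _ _ _ => 0), (fun i _ => (i == k)%:R), (fun _ => 0); split; [by move=> *; exact: sm_cst|by move=> *; exact: sm_cst|exact: sm_cst|move=> h _ x _].
rewrite mul0r addr0 [X in X + _]big1 ?add0r; last first.
  by move=> i _; rewrite big1// => l _; rewrite mul0r.
rewrite (eq_bigr (fun i => 'D_(ebase i) h x * (i == k)%:R)) ?sum_delta// => i _.
by rewrite mulrC.
Qed.

Lemma op2_DD k l : op2 (fun h => 'D_(ebase k) ('D_(ebase l) h)).
Proof.
exists (fun i j _ => (i == k)%:R * (j == l)%:R), (fun _ _ => 0), (fun _ => 0).
split; [by move=> *; exact: sm_cst|by move=> *; exact: sm_cst|exact: sm_cst|move=> h _ x _].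
rewrite mul0r addr0 [X in _ + X]big1 ?addr0; last by move=> i _; rewrite mul0r.
rewrite (eq_bigr (fun i => (\sum_j 'D_(ebase i) ('D_(ebase j) h) x * (j == l)%:R) * (i == k)%:R)).
  by rewrite sum_delta sum_delta.
by move=> i _; rewrite big_distrl; apply: eq_bigr => j _ /=; ring.
Qed.

Lemma sm_momentum (D : 'I_n -> fn -> fn) a1 a2 a3 h j :
  (forall k f, sm U f -> sm U (D k f)) ->
  (forall j, sm U (a1 j)) -> (forall k j, sm U (a2 k j)) ->
  (forall k l j, sm U (a3 k l j)) -> sm U h -> sm U (momentum D a1 a2 a3 h j).
Proof.
move=> HD; apply: (@S_momentum R n _ D (sm U)) => //.
- exact: sm_cst.
- by move=> f g; exact: sm_add.
- by move=> f; exact: sm_opp.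
- by move=> f g; exact: sm_mul.
Qed.

End Operators.

Section MomentumInvariance.
Context {R : realType} {n m : nat}.
Variables (U U' : set 'rV[R]_n) (phi phi' : 'rV[R]_n -> 'rV[R]_n).
Hypotheses (oU : open U) (oU' : open U') (Sphi : smv U phi) (Sphi' : smv U' phi').
Hypotheses (phiU : forall x, U x -> U' (phi x)) (phiK : forall x, U x -> phi' (phi x) = x).
Local Notation fn := ('rV[R]_n -> R).
Local Notation nab := (nabla phi phi').
Local Notation ji := (jaci phi phi').
Local Notation jd := (jacdet phi).
Local Notation par := (fun (k : 'I_n) (f : fn) => 'D_(ebase k) f).

Let Sji p a : sm U (ji p a). Proof. exact: (sm_jaci oU Sphi Sphi' phiU). Qed.
Let Snab a f : sm U f -> sm U (nab a f). Proof. exact: (sm_nabla oU Sphi Sphi' phiU). Qed.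
Let Sjd : sm U jd. Proof. exact: (sm_jacdet oU Sphi). Qed.

Lemma op2_nabla (B : fn) a : sm U B -> op2 U (fun h => nab a (fun y => B y * h y)).
Proof.
move=> SB; apply: (op2_ext (T := fun h x => \sum_p ji p a x *
   ('D_(ebase p) B x * h x + B x * 'D_(ebase p) h x))).
  move=> h Sh x Ux; apply: eq_bigr => p _.
  by rewrite (D_mul _ (sm_diff SB Ux) (sm_diff Sh Ux)).
apply: op2_sum => // p; apply: op2_mul => //; apply: op2_add => //.
  by apply: op2_mul => //; [exact: sm_D|exact: op2_id].
by apply: op2_mul => //; exact: op2_D.
Qed.

Lemma op2_nabla2 (B : fn) a c : sm U B -> op2 U (fun h => nab a (nab c (fun y => B y * h y))).
Proof.
move=> SB; apply: (op2_ext (T := fun h x => \sum_p ji p a x * \sum_q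
   ('D_(ebase p) (ji q c) x * ('D_(ebase q) B x * h x + B x * 'D_(ebase q) h x)
   + ji q c x * ('D_(ebase p) ('D_(ebase q) B) x * h x + 'D_(ebase q) B x * 'D_(ebase p) h x
     + ('D_(ebase p) B x * 'D_(ebase q) h x + B x * 'D_(ebase p) ('D_(ebase q) h) x))))).
  move=> h Sh x Ux; apply/esym; apply: eq_bigr => p _; congr (_ * _).
  have SDB q : sm U ('D_(ebase q) B) by exact: sm_D.
  have SDh q : sm U ('D_(ebase q) h) by exact: sm_D.
  have S1 q : sm U (fun y => 'D_(ebase q) B y * h y) by exact: sm_mul.
  have S2 q : sm U (fun y => B y * 'D_(ebase q) h y) by exact: sm_mul.
  have S3 q : sm U (fun y => 'D_(ebase q) B y * h y + B y * 'D_(ebase q) h y) by exact: sm_add.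
  have S4 q : sm U (fun y => ji q c y * ('D_(ebase q) B y * h y + B y * 'D_(ebase q) h y)).
    exact: sm_mul.
  rewrite (@D_eq_on _ _ _ U _ (fun y => \sum_q ji q c y *
      ('D_(ebase q) B y * h y + B y * 'D_(ebase q) h y)) _ _ oU Ux); last first.
    move=> y Uy; rewrite /nabla; apply: eq_bigr => q _.
    by rewrite (D_mul _ (sm_diff SB Uy) (sm_diff Sh Uy)).
  rewrite D_sum; last by move=> q _; exact: (sm_diff (S4 q) Ux).
  apply: eq_bigr => q _.
  rewrite (D_mul _ (sm_diff (Sji q c) Ux) (sm_diff (S3 q) Ux)).
  rewrite (D_add _ (sm_diff (S1 q) Ux) (sm_diff (S2 q) Ux)).
  rewrite (D_mul _ (sm_diff (SDB q) Ux) (sm_diff Sh Ux)).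
  by rewrite (D_mul _ (sm_diff SB Ux) (sm_diff (SDh q) Ux)).
apply: op2_sum => // p; apply: op2_mul => //; apply: op2_sum => // q.
have SDB r : sm U ('D_(ebase r) B) by exact: sm_D.
have SDDB : sm U ('D_(ebase p) ('D_(ebase q) B)) by exact: sm_D.
have O r : op2 U (fun h x => 'D_(ebase r) B x * h x) := op2_mul oU (SDB r) (op2_id U).
have O' r : op2 U (fun h x => B x * 'D_(ebase r) h x) := op2_mul oU SB (op2_D U r).
have O1 := op2_mul oU (sm_D (ebase p) (Sji q c)) (op2_add oU (O q) (O' q)).
have O2 := op2_add oU (op2_mul oU SDDB (op2_id U)) (op2_mul oU (SDB q) (op2_D U p)).
have O3 := op2_add oU (op2_mul oU (SDB p) (op2_D U q)) (op2_mul oU SB (op2_DD U p q)).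
exact: (op2_add oU O1 (op2_mul oU (Sji q c) (op2_add oU O2 O3))).
Qed.

Variables (a0 : 'I_m -> fn) (a1 : 'I_m -> 'I_n -> fn) (a2 : 'I_m -> 'I_n -> 'I_n -> fn)
  (a3 : 'I_m -> 'I_n -> 'I_n -> 'I_n -> fn).
Variables (b0 : 'I_m -> fn) (b1 : 'I_m -> 'I_n -> fn) (b2 : 'I_m -> 'I_n -> 'I_n -> fn)
  (b3 : 'I_m -> 'I_n -> 'I_n -> 'I_n -> fn).
Variable (B : 'I_m -> 'I_m -> fn).
Hypotheses (Sa1 : forall s j, sm U (a1 s j)) (Sa2 : forall s k j, sm U (a2 s k j))
  (Sa3 : forall s k l j, sm U (a3 s k l j)).
Hypotheses (Sb1 : forall s j, sm U (b1 s j)) (Sb2 : forall s k j, sm U (b2 s k j))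
  (Sb3 : forall s k l j, sm U (b3 s k l j)).
Hypothesis (SB : forall t s, sm U (B t s)).
Hypotheses (a2C : forall s k j, a2 s k j = a2 s j k)
  (a3l : forall s k l j, a3 s k l j = a3 s l k j) (a3r : forall s k l j, a3 s k l j = a3 s k j l).
Hypotheses (b2C : forall s k j, b2 s k j = b2 s j k)
  (b3l : forall s k l j, b3 s k l j = b3 s l k j) (b3r : forall s k l j, b3 s k l j = b3 s k j l).
Hypothesis (lin_eq : forall s h, sm U h -> forall x, U x ->
  linearization par (a0 s) (a1 s) (a2 s) (a3 s) h x =
  jd x * \sum_t linearization nab (b0 t) (b1 t) (b2 t) (b3 t) (fun y => B t s y * h y) x).

Let P s h j : fn := momentum par (a1 s) (a2 s) (a3 s) h j.
Let Sg s h b : fn := fun x => \sum_t momentum nab (b1 t) (b2 t) (b3 t) (fun y => B t s y * h y) b x.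
Let Q s h j : fn := fun x => jd x * \sum_b ji j b x * Sg s h b x.

Let SBh t s h : sm U h -> sm U (fun y => B t s y * h y).
Proof. exact: (sm_mul oU (SB t s)). Qed.

Let SP s h j : sm U h -> sm U (P s h j).
Proof.
move=> Sh; have H k f : sm U f -> sm U (par k f) by exact: sm_D.
exact: (sm_momentum oU j H (Sa1 s) (Sa2 s) (Sa3 s) Sh).
Qed.

Let Smom t s h b : sm U h ->
  sm U (momentum nab (b1 t) (b2 t) (b3 t) (fun y => B t s y * h y) b).
Proof.
move=> Sh.
exact: (sm_momentum oU b Snab (Sb1 t) (Sb2 t) (Sb3 t) (SBh t s Sh)).
Qed.

Let SSg s h b : sm U h -> sm U (Sg s h b).
Proof. by move=> Sh; apply: sm_sum; [exact: oU|move=> t _; exact: Smom]. Qed.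

Let SQ s h j : sm U h -> sm U (Q s h j).
Proof.
move=> Sh; apply: (sm_mul oU Sjd); apply: (sm_sum _ oU) => b _.
exact: (sm_mul oU (Sji j b) (SSg s b Sh)).
Qed.

Let err s : fn := fun x => jd x * (\sum_t euler nab (b0 t) (b1 t) (b2 t) (b3 t) x * B t s x)
  - euler par (a0 s) (a1 s) (a2 s) (a3 s) x.

(** [first_variation] in both coordinate systems: P is the momentum in the source,
    Q that of the target carried over, and [lin_eq] equates the variations. *)
Let divPQ s h x : sm U h -> U x ->
  \sum_j 'D_(ebase j) (fun y => P s h j y - Q s h j y) x = err s x * h x.
Proof.
move=> Sh Ux.
have E1 : linearization par (a0 s) (a1 s) (a2 s) (a3 s) h x =
    \sum_j 'D_(ebase j) (P s h j) x + euler par (a0 s) (a1 s) (a2 s) (a3 s) x * h x.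
  apply: (@first_variation R n _ par (sm U) x);
    [ | | | | | | | | | exact: Sa1|exact: Sa2|exact: Sa3|exact: Sh|exact: a2C|exact: a3l|exact: a3r].
  - by move=> k f; exact: sm_D.
  - exact: sm_cst.
  - by move=> f g; exact: sm_add.
  - by move=> f; exact: sm_opp.
  - by move=> f g; exact: sm_mul.
  - by move=> j; exact: D_cst.
  - by move=> j f g Sf Sg'; exact: (D_add _ (sm_diff Sf Ux) (sm_diff Sg' Ux)).
  - by move=> j f Sf; exact: (D_opp _ (sm_diff Sf Ux)).
  - by move=> j f g Sf Sg'; exact: (D_mul _ (sm_diff Sf Ux) (sm_diff Sg' Ux)).
have E2 t : linearization nab (b0 t) (b1 t) (b2 t) (b3 t) (fun y => B t s y * h y) x =
    \sum_b nab b (momentum nab (b1 t) (b2 t) (b3 t) (fun y => B t s y * h y) b) x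
    + euler nab (b0 t) (b1 t) (b2 t) (b3 t) x * (B t s x * h x).
  apply: (@first_variation R n _ nab (sm U) x);
    [ | | | | | | | | | exact: Sb1|exact: Sb2|exact: Sb3|exact: SBh|exact: b2C|exact: b3l|exact: b3r].
  - exact: Snab.
  - exact: sm_cst.
  - by move=> f g; exact: sm_add.
  - by move=> f; exact: sm_opp.
  - by move=> f g; exact: sm_mul.
  - by move=> j; exact: nabla_cst.
  - by move=> j f g; exact: nabla_add.
  - by move=> j f; exact: nabla_opp.
  - by move=> j f g; exact: nabla_mul.
have dP j : differentiable (P s h j) x := sm_diff (SP s j Sh) Ux.
have dQ j : differentiable (Q s h j) x := sm_diff (SQ s j Sh) Ux.
rewrite (eq_bigr (fun j => 'D_(ebase j) (P s h j) x - 'D_(ebase j) (Q s h j) x)); last first.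
  by move=> j _; rewrite (D_add _ (dP j) (diff_opp (dQ j))) (D_opp _ (dQ j)).
rewrite sumrB (nabla_div oU Sphi Sphi' phiU phiK (fun b => SSg s b Sh) Ux).
have -> : \sum_j 'D_(ebase j) (P s h j) x =
    jd x * (\sum_t linearization nab (b0 t) (b1 t) (b2 t) (b3 t) (fun y => B t s y * h y) x)
    - euler par (a0 s) (a1 s) (a2 s) (a3 s) x * h x.
  by rewrite -(lin_eq s Sh Ux) E1 addrK.
rewrite (eq_bigr _ (fun t _ => E2 t)) big_split /= mulrDr /err.
have -> : \sum_t euler nab (b0 t) (b1 t) (b2 t) (b3 t) x * (B t s x * h x) =
    (\sum_t euler nab (b0 t) (b1 t) (b2 t) (b3 t) x * B t s x) * h x.
  by rewrite big_distrl; apply: eq_bigr => t _ /=; rewrite mulrA.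
have -> : \sum_t \sum_b nab b (momentum nab (b1 t) (b2 t) (b3 t) (fun y => B t s y * h y) b) x =
    \sum_b nab b (Sg s h b) x.
  rewrite exchange_big; apply: eq_bigr => b _ /=; rewrite /nabla exchange_big /=.
  apply: eq_bigr => p _; rewrite -big_distrr /=; congr (_ * _).
  by rewrite D_sum// => t _; exact: (sm_diff (Smom t s b Sh) Ux).
ring.
Qed.

Let Smc1 s j : sm U (fun x => a1 s j x - \sum_p par p (a2 s p j) x
    + \sum_p \sum_q par p (par q (a3 s p q j)) x).
Proof.
apply: (sm_add oU); [apply: (sm_add oU (Sa1 s j)); apply: (sm_opp oU)|];
  apply: (sm_sum _ oU) => p _; first exact: sm_D.
by apply: (sm_sum _ oU) => q _; do 2!apply: sm_D.
Qed.

Let Smc2 s k j : sm U (fun x => a2 s k j x - \sum_p par p (a3 s k p j) x).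
Proof.
apply: (sm_add oU (Sa2 s k j)); apply: (sm_opp oU); apply: (sm_sum _ oU) => p _.
exact: sm_D.
Qed.

Let Snc1 t b : sm U (fun x => b1 t b x - \sum_p nab p (b2 t p b) x
    + \sum_p \sum_q nab p (nab q (b3 t p q b)) x).
Proof.
apply: (sm_add oU); [apply: (sm_add oU (Sb1 t b)); apply: (sm_opp oU)|];
  apply: (sm_sum _ oU) => p _; first exact/Snab/Sb2.
by apply: (sm_sum _ oU) => q _; apply: Snab; apply: Snab; exact: Sb3.
Qed.

Let Snc2 t k b : sm U (fun x => b2 t k b x - \sum_p nab p (b3 t k p b) x).
Proof.
apply: (sm_add oU (Sb2 t k b)); apply: (sm_opp oU); apply: (sm_sum _ oU) => p _.
exact/Snab/Sb3.
Qed.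

Let op2P s j : op2 U (fun h => P s h j).
Proof.
rewrite /P /momentum; apply: (op2_add oU); [apply: (op2_add oU)|].
- exact: (op2_mul oU (Smc1 s j) (op2_id U)).
- by apply: (op2_sum oU) => k; exact: (op2_mul oU (Smc2 s k j) (op2_D U k)).
- apply: (op2_sum oU) => k; apply: (op2_sum oU) => l.
  exact: (op2_mul oU (Sa3 s k l j) (op2_DD U k l)).
Qed.

Let op2Q s j : op2 U (fun h => Q s h j).
Proof.
apply: (op2_mul oU Sjd); apply: (op2_sum oU) => b; apply: (op2_mul oU (Sji j b)).
apply: (op2_sum oU) => t; rewrite /momentum; apply: (op2_add oU); [apply: (op2_add oU)|].
- exact: (op2_mul oU (Snc1 t b) (op2_mul oU (SB t s) (op2_id U))).
- by apply: (op2_sum oU) => k; exact: (op2_mul oU (Snc2 t k b) (op2_nabla k (SB t s))).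
- apply: (op2_sum oU) => k; apply: (op2_sum oU) => l.
  exact: (op2_mul oU (Sb3 t k l b) (op2_nabla2 k l (SB t s))).
Qed.

(** Any coefficients are totally symmetric when there is a single index, so
    [divergence_order0] applies to the difference as it stands. *)
Lemma momentum_inv_dim1 s h j x : (forall i k : 'I_n, i = k) -> sm setT h -> U x ->
  P s h j x = Q s h j x.
Proof.
move=> one Sh Ux.
have [c2 [c1 [c0 [S2 S1 S0 H]]]] :=
  op2_add oU (op2P s j) (op2_mul oU (sm_cst U (-1)) (op2Q s j)).
have SU g : sm setT g -> sm U g by apply: sm_sub.
have [] := @divergence_order0 R n U oU (fun _ => c2) (fun _ => c1) (fun _ => c0) (err s)
  (fun _ => S2) (fun _ => S1) (fun _ => S0) _ _ _ _ x Ux.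
- by move=> y _ i k l; congr (c2 _ _ _); exact: one.
- by move=> y _ i k l; congr (c2 _ _ _); exact: one.
- by move=> y _ i k; congr (c1 _ _); exact: one.
- move=> g Sg' y Uy; rewrite -(divPQ s (SU _ Sg') Uy); apply: eq_bigr => i _.
  apply: (D_eq_on _ oU Uy) => w Uw; rewrite -(H _ (SU _ Sg') _ Uw).
  by rewrite (one i j) mulN1r.
move=> Z2 Z1 Z0; apply/eqP; rewrite -subr_eq0 -mulN1r; apply/eqP.
rewrite (H _ (SU _ Sh) _ Ux) Z0// mul0r addr0 !big1 ?addr0// => k _.
  by rewrite Z1// mul0r.
by rewrite big1// => l _; rewrite Z2// mul0r.
Qed.

(** With a3 = b3 = 0 the difference of momenta has order one; its first-order
    coefficient is computed and seen to be symmetric because a2 and b2 are. *)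
Lemma momentum_inv_order2 s h j x : (forall s k l j y, U y -> a3 s k l j y = 0) ->
  (forall s k l j y, U y -> b3 s k l j y = 0) -> sm setT h -> U x ->
  P s h j x = Q s h j x.
Proof.
move=> a30 b30 Sh Ux.
have SU g : sm setT g -> sm U g by apply: sm_sub.
have D3 t k l i p y : U y -> par p (a3 t k l i) y = 0.
  by move=> Uy; rewrite /= (D_eq_on _ oU Uy (a30 t k l i)) D_cst.
have D33 t k l i p q y : U y -> par q (par p (a3 t k l i)) y = 0.
  by move=> Uy; rewrite /= (D_eq_on _ oU Uy (D3 t k l i p)) D_cst.
have N3 t k l i p y : U y -> nab p (b3 t k l i) y = 0.
  by move=> Uy; rewrite (nabla_eq_on phi phi' oU p Uy (b30 t k l i)) nabla_cst.
have N33 t k l i p q y : U y -> nab q (nab p (b3 t k l i)) y = 0.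
  by move=> Uy; rewrite (nabla_eq_on phi phi' oU q Uy (N3 t k l i p)) nabla_cst.
(* the first-order and zeroth-order coefficients of the difference of momenta *)
pose c1 i k y := a2 s k i y - jd y * \sum_b ji i b y * \sum_t \sum_c b2 t c b y * (ji k c y * B t s y).
pose c0 i y := (a1 s i y - \sum_p par p (a2 s p i) y)
  - jd y * \sum_b ji i b y * \sum_t ((b1 t b y - \sum_p nab p (b2 t p b) y) * B t s y
     + \sum_c b2 t c b y * nab c (B t s) y).
have EP g i y : U y -> P s g i y =
    (a1 s i y - \sum_p par p (a2 s p i) y) * g y + \sum_k a2 s k i y * par k g y.
  move=> Uy; rewrite /P /momentum [X in _ + X]big1 ?addr0; last first.
    by move=> k _; rewrite big1// => l _; rewrite a30// mul0r.
  congr (_ * _ + _).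
    rewrite [X in _ + X]big1 ?addr0// => p _; rewrite big1// => q _; exact: D33.
  apply: eq_bigr => k _; congr (_ * _); rewrite big1 ?subr0// => p _; exact: D3.
have EQ g i y : sm U g -> U y -> Q s g i y =
    jd y * \sum_b ji i b y * \sum_t ((b1 t b y - \sum_p nab p (b2 t p b) y) * (B t s y * g y)
     + \sum_c b2 t c b y * (nab c (B t s) y * g y + B t s y * \sum_k ji k c y * par k g y)).
  move=> Sg' Uy; rewrite /Q; congr (_ * _); apply: eq_bigr => b _; congr (_ * _).
  apply: eq_bigr => t _; rewrite /momentum [X in _ + X]big1 ?addr0; last first.
    by move=> k _; rewrite big1// => l _; rewrite b30// mul0r.
  congr (_ * _ + _).
    rewrite [X in _ + X]big1 ?addr0// => p _; rewrite big1// => q _; exact: N33.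
  apply: eq_bigr => k _; rewrite (nabla_mul phi phi' k Uy (SB t s) Sg').
  by congr (_ * _); rewrite big1 ?subr0// => p _; exact: N3.
have E g i y : sm U g -> U y -> P s g i y - Q s g i y =
    \sum_k \sum_l 0 * 'D_(ebase k) ('D_(ebase l) g) y + \sum_k c1 i k y * 'D_(ebase k) g y + c0 i y * g y.
  move=> Sg' Uy; rewrite EP// EQ//.
  rewrite [X in _ = X + _ + _]big1 ?add0r; last first.
    by move=> k _; rewrite big1// => l _; rewrite mul0r.
  rewrite /c1 /c0 mulrBl.
  rewrite [X in _ = X + _](eq_bigr (fun k => a2 s k i y * par k g y
     - jd y * (\sum_b ji i b y * \sum_t \sum_c b2 t c b y * (ji k c y * B t s y)) * par k g y)); last first.
    by move=> k _; rewrite mulrBl.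
  rewrite sumrB.
  have -> : \sum_k jd y * (\sum_b ji i b y * \sum_t \sum_c b2 t c b y * (ji k c y * B t s y)) * par k g y
     = jd y * \sum_b ji i b y * \sum_t \sum_c b2 t c b y * (B t s y * \sum_k ji k c y * par k g y).
    rewrite (eq_bigr (fun k => jd y * \sum_b ji i b y * \sum_t \sum_c
         b2 t c b y * (B t s y * (ji k c y * par k g y)))); last first.
      move=> k _; rewrite -mulrA; congr (_ * _); rewrite big_distrl; apply: eq_bigr => b _ /=.
      rewrite -mulrA; congr (_ * _); rewrite big_distrl; apply: eq_bigr => t _ /=.
      by rewrite big_distrl; apply: eq_bigr => c _ /=; ring.
    rewrite -big_distrr /=; congr (_ * _); rewrite exchange_big; apply: eq_bigr => b _ /=.
    rewrite -big_distrr /=; congr (_ * _); rewrite exchange_big; apply: eq_bigr => t _ /=.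
    rewrite exchange_big; apply: eq_bigr => c _ /=.
    by rewrite -big_distrr /=; congr (_ * _); rewrite -big_distrr.
  have -> : jd y * (\sum_b ji i b y * \sum_t ((b1 t b y - \sum_p nab p (b2 t p b) y) * (B t s y * g y)
     + \sum_c b2 t c b y * (nab c (B t s) y * g y + B t s y * \sum_k ji k c y * par k g y))) =
    jd y * (\sum_b ji i b y * \sum_t ((b1 t b y - \sum_p nab p (b2 t p b) y) * B t s y
     + \sum_c b2 t c b y * nab c (B t s) y)) * g y
    + jd y * \sum_b ji i b y * \sum_t \sum_c b2 t c b y * (B t s y * \sum_k ji k c y * par k g y).
    rewrite -[X in _ = X + _]mulrA -mulrDr; congr (_ * _); rewrite big_distrl -big_split.
    apply: eq_bigr => b _ /=; rewrite -[X in _ = X + _]mulrA -mulrDr; congr (_ * _).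
    rewrite big_distrl -big_split; apply: eq_bigr => t _ /=.
    rewrite [X in _ = X + _]mulrDl [X in _ = _ + X + _]big_distrl -addrA -big_split mulrA.
    congr (_ + _).
    by apply: eq_bigr => c _ /=; ring.
  ring.
have Sc1 i k : sm U (c1 i k).
  apply: (sm_add oU (Sa2 s k i)); apply: (sm_opp oU); apply: (sm_mul oU Sjd).
  apply: (sm_sum _ oU) => b _; apply: (sm_mul oU (Sji i b)); apply: (sm_sum _ oU) => t _.
  apply: (sm_sum _ oU) => c _; apply: (sm_mul oU (Sb2 t c b)).
  exact: (sm_mul oU (Sji k c) (SB t s)).
have Sc0 i : sm U (c0 i).
  apply: (sm_add oU); first apply: (sm_add oU (Sa1 s i)).
    by apply: (sm_opp oU); apply: (sm_sum _ oU) => p _; exact: sm_D.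
  apply: (sm_opp oU); apply: (sm_mul oU Sjd); apply: (sm_sum _ oU) => b _.
  apply: (sm_mul oU (Sji i b)); apply: (sm_sum _ oU) => t _; apply: (sm_add oU).
    apply: (sm_mul oU _ (SB t s)); apply: (sm_add oU (Sb1 t b)); apply: (sm_opp oU).
    by apply: (sm_sum _ oU) => p _; exact/Snab/Sb2.
  by apply: (sm_sum _ oU) => c _; apply: (sm_mul oU (Sb2 t c b)); exact/Snab/SB.
have [] := @divergence_order0 R n U oU (fun _ _ _ _ => 0) c1 c0 (err s)
  (fun _ _ _ => sm_cst U 0) Sc1 Sc0 _ _ _ _ x Ux => //.
- move=> y _ i k; rewrite /c1 a2C; congr (_ - _ * _).
  rewrite (eq_bigr (fun b => \sum_t \sum_c b2 t c b y * (ji k c y * (ji i b y * B t s y)))); last first.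
    move=> b _; rewrite big_distrr; apply: eq_bigr => t _ /=; rewrite big_distrr.
    by apply: eq_bigr => c _ /=; ring.
  rewrite [RHS](eq_bigr (fun b => \sum_t \sum_c b2 t c b y * (ji k b y * (ji i c y * B t s y)))); last first.
    move=> b _; rewrite big_distrr; apply: eq_bigr => t _ /=; rewrite big_distrr.
    by apply: eq_bigr => c _ /=; ring.
  rewrite exchange_big [RHS]exchange_big; apply: eq_bigr => t _ /=.
  rewrite exchange_big; apply: eq_bigr => c _; apply: eq_bigr => b _ /=.
  by rewrite b2C.
- move=> g Sg' y Uy; rewrite -(divPQ s (SU _ Sg') Uy); apply: eq_bigr => i _.
  by apply: (D_eq_on _ oU Uy) => w Uw; rewrite (E _ _ _ (SU _ Sg') Uw).
move=> _ Z1 Z0; apply/eqP; rewrite -subr_eq0; apply/eqP.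
rewrite (E _ _ _ (SU _ Sh) Ux) Z0 mul0r addr0 !big1 ?addr0// => k _.
  by rewrite Z1 mul0r.
by rewrite big1// => l _; rewrite mul0r.
Qed.

End MomentumInvariance.

(** * Coordinates of jet spaces *)

Section JetCoordinates.
Context {R : realType} {n m : nat}.
Local Notation jsp r := (jspace R n m r).
Local Notation sortJ := (sort (@ord_le n)).

Lemma ord_le_total : total (@ord_le n). Proof. by move=> i j; exact: leq_total. Qed.
Lemma ord_le_trans : transitive (@ord_le n). Proof. by move=> i j k; exact: leq_trans. Qed.
Lemma ord_le_anti : antisymmetric (@ord_le n).
Proof. by move=> i j ij; apply: val_inj; exact: anti_leq. Qed.

Lemma mseq_inj r : injective (@mseq n r).
Proof. by move=> J K JK; apply: val_inj; apply: val_inj. Qed.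

Lemma size_mseq r (K : @mindex n r) : (size (mseq K) <= r)%N.
Proof. exact: size_bseq. Qed.

Lemma sort_mseq r (K : @mindex n r) : sortJ (mseq K) = mseq K.
Proof. by apply: sorted_sort; [exact: ord_le_trans|exact: (valP K)]. Qed.

Lemma sortJ_idem J : sortJ (sortJ J) = sortJ J.
Proof. by apply: sorted_sort; [exact: ord_le_trans|apply: sort_sorted; exact: ord_le_total]. Qed.

Lemma sortJ_perm J J' : perm_eq J J' -> sortJ J = sortJ J'.
Proof.
by move=> JJ'; apply/perm_sortP => //; [exact: ord_le_total|exact: ord_le_trans|exact: ord_le_anti].
Qed.

Lemma mindex_of r J : (size J <= r)%N -> exists K : @mindex n r, mseq K = sortJ J.
Proof.
move=> sJ; have sK : (size (sortJ J) <= r)%N by rewrite size_sort.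
have oK : sorted (@ord_le n) (Bseq sK) by apply: sort_sorted; exact: ord_le_total.
by exists (exist _ (Bseq sK) oK).
Qed.

Lemma yc_mseq r (z : jsp r) s K : yc z s (mseq K) = z 0 (enum_rank (inr (s, K) : @jcoord n m r)).
Proof.
rewrite /yc (big_pred1 K)// => K'; rewrite sort_mseq /=.
by apply/eqP/eqP => [/mseq_inj|->].
Qed.

Lemma yc_sort r (z : jsp r) s J : yc z s (sortJ J) = yc z s J.
Proof. by rewrite /yc sortJ_idem. Qed.

Lemma jspaceP r (z z' : jsp r) : (forall i, xc z i = xc z' i) ->
  (forall s K, yc z s (mseq (K : @mindex n r)) = yc z' s (mseq K)) -> z = z'.
Proof.
move=> hx hy; apply/rowP => c; rewrite -(enum_valK c).
by case: (enum_val c) => [i|[s K]]; [exact: hx|have := hy s K; rewrite !yc_mseq].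
Qed.

Lemma dy_mseq r s K : dy r s (mseq K) = ebase (enum_rank (inr (s, K) : @jcoord n m r)) :> jsp r.
Proof.
rewrite /dy (big_pred1 K)// => K'; rewrite sort_mseq /=.
by apply/eqP/eqP => [/mseq_inj|->].
Qed.

Lemma sum_jcoord r (F : 'I_#|{: @jcoord n m r}| -> R) :
  \sum_c F c = \sum_i F (enum_rank (inl i : @jcoord n m r))
     + \sum_s \sum_K F (enum_rank (inr (s, K) : @jcoord n m r)).
Proof.
rewrite (reindex (@enum_rank {: @jcoord n m r}))/=; last by apply: onW_bij; exact: enum_rank_bij.
by rewrite big_sumType /= pair_bigA; congr (_ + _); apply: eq_bigr => -[s K].
Qed.

Lemma D_jet r (F : jsp r -> R) v z : differentiable F z ->
  'D_v F z = \sum_i xc v i * pdx i F z + \sum_s \sum_(K : @mindex n r) yc v s (mseq K) * pdy s (mseq K) F z.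
Proof.
move=> dF; rewrite derive_diff// sum_jcoord; congr (_ + _).
apply: eq_bigr => s _; apply: eq_bigr => K _.
by rewrite yc_mseq /pdy dy_mseq.
Qed.

Lemma xcD r (u v : jsp r) i : xc (u + v) i = xc u i + xc v i.
Proof. by rewrite /xc mxE. Qed.
Lemma xcZ r a (u : jsp r) i : xc (a *: u) i = a * xc u i.
Proof. by rewrite /xc mxE. Qed.
Lemma ycD r (u v : jsp r) s J : yc (u + v) s J = yc u s J + yc v s J.
Proof. by rewrite /yc -big_split; apply: eq_bigr => K _; rewrite mxE. Qed.
Lemma ycZ r a (u : jsp r) s J : yc (a *: u) s J = a * yc u s J.
Proof. by rewrite /yc big_distrr; apply: eq_bigr => K _; rewrite mxE. Qed.
Lemma xc_sum r (I : Type) (l : seq I) (u : I -> jsp r) i : xc (\sum_(k <- l) u k) i = \sum_(k <- l) xc (u k) i.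
Proof. by rewrite /xc summxE. Qed.
Lemma yc_sum r (I : Type) (l : seq I) (u : I -> jsp r) s J :
  yc (\sum_(k <- l) u k) s J = \sum_(k <- l) yc (u k) s J.
Proof. by rewrite /yc exchange_big; apply: eq_bigr => K _; rewrite summxE. Qed.
Lemma xcN r (u : jsp r) i : xc (- u) i = - xc u i.
Proof. by rewrite /xc mxE. Qed.

Lemma xc_dx r i j : xc (dx r i : jsp r) j = (j == i)%:R.
Proof.
rewrite /xc /dx /ebase mxE eqxx /=; congr (_%:R); congr nat_of_bool.
by apply/eqP/eqP => [/enum_rank_inj []|->].
Qed.

Definition jmk r (fx : 'I_n -> R) (fy : 'I_m -> seq 'I_n -> R) : jsp r :=
  \row_a match enum_val a with
         | inl i => fx i
         | inr (s, K) => fy s (mseq K)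
         end.

Lemma xc_jmk r fx fy i : xc (jmk r fx fy) i = fx i.
Proof. by rewrite /xc mxE enum_rankK. Qed.

Lemma yc_jmk_mseq r fx fy s (K : @mindex n r) : yc (jmk r fx fy) s (mseq K) = fy s (mseq K).
Proof. by rewrite yc_mseq mxE enum_rankK. Qed.

(** Only the values of fy at sorted indices enter [jmk], hence the sort. *)
Lemma yc_jmk r fx fy s J : (size J <= r)%N -> yc (jmk r fx fy) s J = fy s (sortJ J).
Proof. by move=> /mindex_of[K E]; rewrite -yc_sort -E yc_jmk_mseq. Qed.

Lemma jprojE r t (z : jsp r) : jproj t z = jmk t (xc z) (yc z).
Proof. by []. Qed.

Lemma xc_jproj r t (z : jsp r) i : xc (jproj t z) i = xc z i.
Proof. exact: xc_jmk. Qed.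

Lemma yc_jproj r t (z : jsp r) s J : (size J <= t)%N -> yc (jproj t z) s J = yc z s J.
Proof. by move=> Jt; rewrite jprojE yc_jmk// yc_sort. Qed.

Lemma jproj_jproj r t u (z : jsp r) : (u <= t)%N -> jproj u (jproj t z) = jproj u z.
Proof.
move=> ut; apply: jspaceP => [i|s K]; first by rewrite !xc_jproj.
have sK := size_mseq K.
by rewrite !yc_jproj// (leq_trans sK ut).
Qed.

Lemma jproj_id r (z : jsp r) : jproj r z = z.
Proof.
by apply: jspaceP => [i|s K]; [rewrite xc_jproj|rewrite yc_jproj// size_mseq].
Qed.

Lemma jbase_jproj r t (z : jsp r) : jbase (jproj t z) = jbase z.
Proof.
rewrite /jbase; congr row_mx; apply/rowP => i; rewrite !mxE.
  exact: xc_jproj.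
exact: yc_jproj.
Qed.

Lemma sm_xc r A i : sm A (fun z : jsp r => xc z i).
Proof. exact: sm_coord. Qed.

Lemma sm_yc r A s J : open A -> sm A (fun z : jsp r => yc z s J).
Proof. by move=> oA; apply: (sm_sum _ oA) => K _; exact: sm_coord. Qed.

Lemma smv_jmk r N (A : set 'rV[R]_N) (fx : 'I_n -> 'rV[R]_N -> R)
   (fy : 'I_m -> seq 'I_n -> 'rV[R]_N -> R) : open A ->
  (forall i, sm A (fx i)) -> (forall s J, (size J <= r)%N -> sm A (fy s J)) ->
  smv A (fun x => jmk r (fx ^~ x) (fun s J => fy s J x)).
Proof.
move=> oA Sx Sy c; have [[i E]|[[s K] E]] : {i | enum_val c = inl i} + {sK | enum_val c = inr sK}.
- by case: (enum_val c) => [i|sK]; [left; exists i|right; exists sK].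
- by apply: (sm_ext oA _ (Sx i)) => x _; rewrite mxE E.
- by apply: (sm_ext oA _ (Sy s (mseq K) (size_mseq K))) => x _; rewrite mxE E.
Qed.

Lemma smv_jproj r t A : open A -> smv A (@jproj R n m r t).
Proof.
move=> oA; exact: (@smv_jmk t _ A (fun i z => xc z i) (fun s J z => yc z s J) oA
  (fun i => sm_xc A i) (fun s J _ => sm_yc s J oA)).
Qed.

Lemma D_jproj r t (v z : jsp r) : 'D_v (@jproj R n m r t) z = jproj t v.
Proof.
have d := smv_diff (@smv_jproj r t setT openT) (I : setT z).
apply: jspaceP => [i|s K].
  by rewrite /xc D_row// -[RHS]/(xc _ i) xc_jproj /xc -(D_coord _ v z);
     congr ('D_v _ z); apply: funext => y; exact: xc_jproj.
rewrite yc_mseq D_row//.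
rewrite (_ : (fun y => _) = fun y : jsp r => yc y s (mseq K)); last first.
  by apply: funext => y; rewrite -yc_mseq yc_jproj ?size_mseq.
rewrite yc_jproj ?size_mseq// /yc D_sum; last by move=> L _; exact: diff_coord.
by apply: eq_bigr => L _; exact: D_coord.
Qed.

Lemma open_jproj r t (A : set (jsp t)) : open A -> open [set z : jsp r | A (jproj t z)].
Proof.
move=> oA; apply: (@open_comp _ _ (@jproj R n m r t)) => // z _.
exact: (smv_cont (@smv_jproj r t setT openT) (I : setT z)).
Qed.

Lemma smv_jbase r A : open A -> smv A (@jbase R n m r).
Proof.
move=> oA c; rewrite -(splitK c); case: (fintype.split c) => [i|s] /=.
  by apply: (sm_ext oA _ (sm_xc A i)) => z _; rewrite row_mxEl mxE.
by apply: (sm_ext oA _ (sm_yc s [::] oA)) => z _; rewrite row_mxEr mxE.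
Qed.

Lemma open_jbase r (O : set 'rV[R]_(n + m)) : open O -> open [set z : jsp r | O (jbase z)].
Proof.
move=> oO; apply: (@open_comp _ _ (@jbase R n m r)) => // z _.
exact: (smv_cont (@smv_jbase r setT openT) (I : setT z)).
Qed.

End JetCoordinates.

(** * Jets of sections and total derivatives *)

Lemma sum_add_congr (V : zmodType) (I : finType) (A B B' : I -> V) :
  \sum_i B i = \sum_i B' i -> \sum_i (A i + B i) = \sum_i (A i + B' i).
Proof. by move=> E; rewrite !big_split /= E. Qed.

Section JetsOfSections.
Context {R : realType} {n m : nat}.
Local Notation jsp r := (jspace R n m r).
Local Notation sortJ := (sort (@ord_le n)).
Local Notation fn := ('rV[R]_n -> R).

Definition ddr (J : seq 'I_n) (h : fn) : fn := iter_derive [seq ebase j | j <- J] h.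

Definition jet_at r (g : 'I_m -> fn) (x : 'rV[R]_n) : jsp r :=
  jmk r (fun i => x 0 i) (fun s J => ddr J (g s) x).

(** Jets of variations are tangent vectors that are vertical over the base. *)
Definition vjet r (xi : 'I_m -> fn) (x : 'rV[R]_n) : jsp r :=
  jmk r (fun _ => 0) (fun s J => ddr J (xi s) x).

Definition graph (g : 'I_m -> fn) (x : 'rV[R]_n) : 'rV[R]_(n + m) :=
  row_mx x (\row_s g s x).

(** The horizontal lift of the p-th coordinate vector; total derivatives are derivatives
    along it ([fdE]), and it is tangent to jets of sections ([D_jet_htot]). *)
Definition htot r (p : 'I_n) (z : jsp r.+1) : jsp r :=
  jmk r (fun i => (i == p)%:R) (fun s J => yc z s (rcons J p)).

(** The linear part of the affine map [htot]. *)
Definition hlin r (p : 'I_n) (z : jsp r.+1) : jsp r :=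
  jmk r (fun _ => 0) (fun s J => yc z s (rcons J p)).

Lemma sm_ddr U J h : sm U h -> sm U (ddr J h).
Proof. exact: sm_iter. Qed.

Lemma ddr_perm U J J' h x : open U -> U x -> sm U h -> perm_eq J J' -> ddr J h x = ddr J' h x.
Proof. by move=> oU Ux Sh JJ'; apply: (sm_iter_perm oU Ux Sh); exact: perm_map. Qed.

Lemma ddr_sort U J h x : open U -> U x -> sm U h -> ddr (sortJ J) h x = ddr J h x.
Proof. by move=> oU Ux Sh; apply: (ddr_perm oU Ux Sh); rewrite perm_sort. Qed.

Lemma ddr_eq_on U J h h' x : open U -> U x -> (forall y, U y -> h y = h' y) ->
  ddr J h x = ddr J h' x.
Proof. exact: sm_iter_eq_on. Qed.

Lemma fdE r p (F : jsp r -> R) (z : jsp r.+1) : differentiable F (jproj r z) ->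
  fd p F z = 'D_(htot p z) F (jproj r z).
Proof.
move=> dF; rewrite D_jet// /fd; congr (_ + _).
  rewrite (eq_bigr (fun i => pdx i F (jproj r z) * (i == p)%:R)) ?sum_delta// => i _.
  by rewrite xc_jmk mulrC.
by apply: eq_bigr => s _; apply: eq_bigr => K _; rewrite yc_jmk_mseq.
Qed.

Lemma sm_fd r p (F : jsp r -> R) A : open A -> sm A F ->
  sm [set z : jsp r.+1 | A (jproj r z)] (fd p F).
Proof.
move=> oA SF; have oA' := open_jproj (r := r.+1) oA.
have Sc v : sm [set z : jsp r.+1 | A (jproj r z)] (fun z => 'D_v F (jproj r z)).
  exact: (@sm_comp R _ _ _ A (@jproj R n m r.+1 r) ('D_v F) oA' (fun _ h => h)
    (@smv_jproj R n m r.+1 r _ oA') (sm_D v SF)).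
apply: (sm_add oA'); first exact: Sc.
apply: (sm_sum _ oA') => s _; apply: (sm_sum _ oA') => K _; apply: (sm_mul oA'); last exact: Sc.
exact: sm_yc.
Qed.

Lemma vjet0 r x : vjet r (fun (_ : 'I_m) (_ : 'rV[R]_n) => 0) x = 0.
Proof.
have Z K : ddr K (fun _ : 'rV[R]_n => 0 : R) = fun _ => 0.
  by elim: K => // k K; rewrite /ddr /= => ->; apply: funext => y; exact: D_cst.
apply: jspaceP => [i|s K]; first by rewrite xc_jmk /xc mxE.
by rewrite yc_jmk_mseq Z yc_mseq mxE.
Qed.

Section OverU.
Variables (U : set 'rV[R]_n) (oU : open U) (g : 'I_m -> fn) (Sg : forall s, sm U (g s)).

Lemma yc_jet r s J x : U x -> (size J <= r)%N -> yc (jet_at r g x) s J = ddr J (g s) x.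
Proof. by move=> Ux sJ; rewrite yc_jmk// (ddr_sort _ oU Ux). Qed.

Lemma yc_vjet r s J x : U x -> (size J <= r)%N -> yc (vjet r g x) s J = ddr J (g s) x.
Proof. by move=> Ux sJ; rewrite yc_jmk// (ddr_sort _ oU Ux). Qed.

Lemma smv_jet r : smv U (jet_at r g).
Proof.
exact: (@smv_jmk R n m r _ U (fun i x => x 0 i) (fun s J x => ddr J (g s) x) oU
  (fun i => sm_coord U i) (fun s J _ => sm_ddr J (Sg s))).
Qed.

Lemma smv_vjet r : smv U (vjet r g).
Proof.
exact: (@smv_jmk R n m r _ U (fun i x => 0) (fun s J x => ddr J (g s) x) oU
  (fun i => sm_cst U 0) (fun s J _ => sm_ddr J (Sg s))).
Qed.

Lemma D_yc_along r N (c : 'rV[R]_N -> jsp r) v x s J : differentiable c x ->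
  'D_v (fun y => yc (c y) s J) x = yc ('D_v c x) s J.
Proof.
move=> dc; rewrite /yc D_sum; last by move=> K _; exact: diff_entry.
by apply: eq_bigr => K _; rewrite D_row.
Qed.

Lemma D_xc_along r N (c : 'rV[R]_N -> jsp r) v x i : differentiable c x ->
  'D_v (fun y => xc (c y) i) x = xc ('D_v c x) i.
Proof. by move=> dc; rewrite /xc D_row. Qed.

Lemma D_jet_htot r p x : U x -> 'D_(ebase p) (jet_at r g) x = htot p (jet_at r.+1 g x).
Proof.
move=> Ux; have d := smv_diff (@smv_jet r) Ux; apply: jspaceP => [i|s K].
  rewrite -D_xc_along// xc_jmk (_ : (fun y => _) = fun y : 'rV[R]_n => y 0 i).
    by rewrite D_coord mxE eqxx.
  by apply: funext => y; exact: xc_jmk.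
rewrite -D_yc_along// yc_jmk_mseq (_ : (fun y => _) = ddr (mseq K) (g s)).
  rewrite yc_jet ?size_rcons ?ltnS ?size_mseq//.
  rewrite -[LHS]/(ddr (p :: mseq K) (g s) x); apply: (ddr_perm oU Ux (Sg s)).
  by rewrite perm_sym perm_rcons.
by apply: funext => y; exact: yc_jmk_mseq.
Qed.

Lemma D_vjet_hlin r p x : U x -> 'D_(ebase p) (vjet r g) x = hlin p (vjet r.+1 g x).
Proof.
move=> Ux; have d := smv_diff (@smv_vjet r) Ux; apply: jspaceP => [i|s K].
  rewrite -D_xc_along// xc_jmk (_ : (fun y => _) = fun y : 'rV[R]_n => 0).
    by rewrite D_cst.
  by apply: funext => y; exact: xc_jmk.
rewrite -D_yc_along// yc_jmk_mseq (_ : (fun y => _) = ddr (mseq K) (g s)).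
  rewrite yc_vjet ?size_rcons ?ltnS ?size_mseq//.
  rewrite -[LHS]/(ddr (p :: mseq K) (g s) x); apply: (ddr_perm oU Ux (Sg s)).
  by rewrite perm_sym perm_rcons.
by apply: funext => y; exact: yc_jmk_mseq.
Qed.

Lemma jproj_jet r t x : (t <= r)%N -> U x -> jproj t (jet_at r g x) = jet_at t g x.
Proof.
move=> tr Ux; apply: jspaceP => [i|s K]; first by rewrite xc_jproj !xc_jmk.
have sK := size_mseq K.
by rewrite yc_jproj// yc_jet ?(leq_trans sK tr)// yc_jet.
Qed.

Lemma jproj_vjet r t x : (t <= r)%N -> U x -> jproj t (vjet r g x) = vjet t g x.
Proof.
move=> tr Ux; apply: jspaceP => [i|s K]; first by rewrite xc_jproj !xc_jmk.
have sK := size_mseq K.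
by rewrite yc_jproj// yc_vjet ?(leq_trans sK tr)// yc_vjet.
Qed.

Lemma jbase_jet r x : jbase (jet_at r g x) = graph g x.
Proof.
rewrite /jbase /graph; congr row_mx; apply/rowP => i; rewrite mxE.
  exact: xc_jmk.
by rewrite mxE yc_jmk.
Qed.

(** Total derivatives are designed for this: along jets of sections they are partial
    derivatives. *)
Lemma fd_jet r p (F : jsp r -> R) x : U x -> differentiable F (jet_at r g x) ->
  fd p F (jet_at r.+1 g x) = 'D_(ebase p) (fun y => F (jet_at r g y)) x.
Proof.
move=> Ux dF; have d := smv_diff (@smv_jet r) Ux.
have E := jproj_jet (leqnSn r) Ux.
rewrite fdE E; last exact: dF.
by rewrite (D_comp _ d dF) (D_jet_htot _ _ Ux).
Qed.

End OverU.

(** The first variation of F at the section g, in the direction xi. *)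
Definition delta r (F : jsp r -> R) (g xi : 'I_m -> fn) : fn :=
  fun x => 'D_(vjet r xi x) F (jet_at r g x).

Lemma D_bilin_sym N (A : set 'rV[R]_N) (F : 'rV[R]_N -> R) (u v z : 'rV[R]_N) : open A -> A z -> sm A F ->
  \sum_c u 0 c * 'D_v ('D_(ebase c) F) z = \sum_c v 0 c * 'D_u ('D_(ebase c) F) z.
Proof.
move=> oA Az SF.
have E (w : 'rV[R]_N) c : 'D_w ('D_(ebase c) F) z = \sum_d w 0 d * 'D_(ebase d) ('D_(ebase c) F) z.
  exact: derive_diff (sm_diff (sm_D _ SF) Az).
have H (w w' : 'rV[R]_N) : \sum_c w 0 c * 'D_w' ('D_(ebase c) F) z =
    \sum_c \sum_d w 0 c * (w' 0 d * 'D_(ebase d) ('D_(ebase c) F) z).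
  by apply: eq_bigr => c _; rewrite -mulr_sumr -(E w' c).
refine (etrans (H u v) (etrans _ (esym (H v u)))).
rewrite exchange_big; apply: eq_bigr => c _; apply: eq_bigr => d _ /=.
by rewrite (sm_schwarz _ _ oA Az SF); ring.
Qed.

Lemma smv_htot r p : smv setT (@htot r p).
Proof.
exact: (@smv_jmk R n m r _ setT (fun i _ => (i == p)%:R) (fun s J z => yc z s (rcons J p)) openT
    (fun i => sm_cst setT _) (fun s J _ => sm_yc s _ openT)).
Qed.

Lemma D_htot r p (v z : jsp r.+1) : 'D_v (@htot r p) z = hlin p v.
Proof.
have dH : differentiable (@htot r p) z := smv_diff (@smv_htot r p) (I : setT z).
have did : differentiable (fun y : jsp r.+1 => y) z by exact: ex_diff.
apply: jspaceP => [i|s K].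
  rewrite -(D_xc_along _ _ dH) xc_jmk.
  have -> : (fun y : jsp r.+1 => xc (htot p y) i) = fun _ => (i == p)%:R.
    by apply: funext => y; exact: xc_jmk.
  exact: D_cst.
rewrite -(D_yc_along _ _ _ dH) yc_jmk_mseq.
have -> : (fun y : jsp r.+1 => yc (htot p y) s (mseq K)) = fun y => yc y s (rcons (mseq K) p).
  by apply: funext => y; exact: yc_jmk_mseq.
by rewrite (D_yc_along _ _ _ did) (derive_id z v).
Qed.

(** Variations commute with total derivatives: both sides expand into the same terms,
    except that the Hessian of F has its two arguments exchanged. *)
Lemma delta_fd r p (F : jsp r -> R) A U g xi x : open A -> sm A F -> open U -> U x ->
  (forall s, sm U (g s)) -> (forall s, sm U (xi s)) -> (forall y, U y -> A (jet_at r g y)) ->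
  delta (fd p F) g xi x = 'D_(ebase p) (delta F g xi) x.
Proof.
move=> oA SF oU Ux Sg Sxi AU.
have oA' := open_jproj (r := r.+1) oA.
have Az : A (jproj r (jet_at r.+1 g x)) by rewrite (jproj_jet oU Sg _ Ux) ?leqnSn//; exact: AU.
have dj := smv_diff (smv_jet oU Sg (r:=r)) Ux.
have dv := smv_diff (smv_vjet oU Sxi (r:=r)) Ux.
have SDF c := sm_D (ebase c) SF.
have Ljp : differentiable (@jproj R n m r.+1 r) (jet_at r.+1 g x).
  exact: (smv_diff (@smv_jproj R n m r.+1 r setT openT) (I : setT _)).
have dH : differentiable (@htot r p) (jet_at r.+1 g x).
  exact: (smv_diff (@smv_htot r p) (I : setT _)).
have -> : delta (fd p F) g xi x =
    'D_(vjet r.+1 xi x) (fun z => \sum_c htot p z 0 c * 'D_(ebase c) F (jproj r z)) (jet_at r.+1 g x).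
  apply: (D_eq_on _ oA' Az) => z Az'; rewrite fdE; last exact: (sm_diff SF Az').
  exact: derive_diff (sm_diff SF Az').
have dDF c : differentiable (fun z => 'D_(ebase c) F (jproj r z)) (jet_at r.+1 g x).
  exact: (differentiable_comp Ljp (sm_diff (SDF c) Az)).
rewrite D_sum; last by move=> c _; exact: (diff_mul (diff_entry _ dH) (dDF c)).
have -> : 'D_(ebase p) (delta F g xi) x =
    'D_(ebase p) (fun y => \sum_c vjet r xi y 0 c * 'D_(ebase c) F (jet_at r g y)) x.
  apply: (D_eq_on _ oU Ux) => y Uy; rewrite /delta.
  exact: derive_diff (sm_diff SF (AU _ Uy)).
have dDF' c : differentiable (fun y => 'D_(ebase c) F (jet_at r g y)) x.
  exact: (differentiable_comp dj (sm_diff (SDF c) (AU _ Ux))).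
rewrite D_sum; last by move=> c _; exact: (diff_mul (diff_entry _ dv) (dDF' c)).
transitivity (\sum_c (hlin p (vjet r.+1 xi x) 0 c * 'D_(ebase c) F (jet_at r g x)
   + htot p (jet_at r.+1 g x) 0 c * 'D_(vjet r xi x) ('D_(ebase c) F) (jet_at r g x))).
  apply: eq_bigr => c _; rewrite (D_mul _ (diff_entry _ dH) (dDF c)).
  rewrite (D_comp _ Ljp (sm_diff (SDF c) Az)) D_jproj.
  rewrite (jproj_jet oU Sg (leqnSn r) Ux) (jproj_vjet oU Sxi (leqnSn r) Ux).
  by rewrite -(D_row _ _ dH) D_htot.
transitivity (\sum_c (hlin p (vjet r.+1 xi x) 0 c * 'D_(ebase c) F (jet_at r g x)
   + vjet r xi x 0 c * 'D_(htot p (jet_at r.+1 g x)) ('D_(ebase c) F) (jet_at r g x))); last first.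
  apply/esym; apply: eq_bigr => c _; rewrite (D_mul _ (diff_entry _ dv) (dDF' c)) -(D_row _ _ dv).
  rewrite (D_vjet_hlin oU Sxi _ _ Ux) (D_comp _ dj (sm_diff (SDF c) (AU _ Ux))).
  by rewrite (D_jet_htot oU Sg _ _ Ux).
apply: sum_add_congr; exact: (D_bilin_sym _ _ oA (AU _ Ux) SF).
Qed.

End JetsOfSections.

(** * Prolongation of fibred transformations *)

Section Nabs.
Context {R : realType} {n : nat}.
Variables (U U' : set 'rV[R]_n) (phi phi' : 'rV[R]_n -> 'rV[R]_n).
Hypotheses (oU : open U) (Sphi : smv U phi) (Sphi' : smv U' phi').
Hypotheses (phiU : forall x, U x -> U' (phi x)) (phiK : forall x, U x -> phi' (phi x) = x).

Definition iter_nabla (K : seq 'I_n) (f : 'rV[R]_n -> R) := foldr (nabla phi phi') f K.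

Lemma iter_nabla_eq_on K f g x : U x -> (forall y, U y -> f y = g y) -> iter_nabla K f x = iter_nabla K g x.
Proof.
move=> Ux fg; elim: K x Ux => [|a K IH] x Ux /=; first exact: fg.
exact: (nabla_eq_on phi phi' oU a Ux IH).
Qed.

(** The chain rule, iterated. *)
Lemma ddr_iter_nabla K (G : 'rV[R]_n -> R) x : U x -> sm U' G ->
  ddr K G (phi x) = iter_nabla K (fun y => G (phi y)) x.
Proof.
move=> Ux SG; elim: K x Ux => [//|a K IH] x Ux /=.
rewrite -(nabla_eq_on phi phi' oU a Ux IH).
rewrite (nabla_comp oU Sphi Sphi' phiU phiK a Ux)//.
exact: (sm_diff (sm_ddr K SG) (phiU Ux)).
Qed.

End Nabs.

Section Prolongation.
Context {R : realType} {n m : nat}.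
Local Notation jsp r := (jspace R n m r).
Local Notation fn := ('rV[R]_n -> R).
Variables (O : set 'rV[R]_(n + m)) (X X' : set 'rV[R]_n) (phi phi' : 'rV[R]_n -> 'rV[R]_n).
Variable (psi : 'I_m -> 'rV[R]_(n + m) -> R).
Hypotheses (oO : open O) (oX : open X) (Sphi : smv X phi) (Sphi' : smv X' phi').
Hypotheses (phiX : forall x, X x -> X' (phi x)) (phiK : forall x, X x -> phi' (phi x) = x).
Hypotheses (Spsi : forall t, sm O (psi t)) (OX : forall u, O u -> X (lsubmx u)).

(** By recursion on the index, the barred coordinate of index a :: K is the derivative
    along the a-th barred base coordinate of the barred coordinate of index K, that
    is, the inverse Jacobian applied to its total derivatives.  The order of the
    jet space is the length of the index. *)
Fixpoint prol (K : seq 'I_n) (t : 'I_m) : jsp (size K) -> R :=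
  match K return jsp (size K) -> R with
  | [::] => fun z => psi t (jbase z)
  | a :: K' => fun z => \sum_p jaci phi phi' p a (lsubmx (jbase z)) * fd p (@prol K' t) z
  end.

Let Sji p a : sm X (jaci phi phi' p a). Proof. exact: (sm_jaci oX Sphi Sphi' phiX). Qed.

Lemma smv_lsubmx_jbase r A : open A -> smv A (fun z : jsp r => lsubmx (jbase z)).
Proof.
move=> oA i; apply: (sm_ext oA _ (sm_xc A i)) => z _.
by rewrite /jbase row_mxKl mxE.
Qed.

Lemma D_lsubmx_jbase r (v z : jsp r) :
  'D_v (fun z : jsp r => lsubmx (jbase z)) z = \row_i xc v i.
Proof.
have dl : differentiable (fun z : jsp r => lsubmx (jbase z)) z.
  exact: (smv_diff (@smv_lsubmx_jbase r _ openT) (I : setT _)).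
apply/rowP => i; rewrite (D_row _ _ dl).
have -> : (fun z : jsp r => lsubmx (jbase z) 0 i) = fun z => xc z i.
  by apply: funext => y; rewrite row_mxKl mxE.
rewrite (@D_xc_along _ _ _ _ _ id); last exact: ex_diff.
by rewrite derive_id mxE.
Qed.

Lemma D_base_vertical r (w z : jsp r) : (forall i, xc w i = 0) ->
  'D_w (fun z : jsp r => lsubmx (jbase z)) z = 0.
Proof. by move=> w0; rewrite D_lsubmx_jbase; apply/rowP => i; rewrite !mxE w0. Qed.

Lemma sm_prol K t : sm [set z | O (jbase z)] (@prol K t).
Proof.
elim: K => [|a K IH].
  have Sb : smv [set z : jsp 0 | O (jbase z)] (@jbase R n m 0).
    by apply: smv_jbase; exact: open_jbase.
  exact: (@sm_comp R _ _ [set z : jsp 0 | O (jbase z)] O (@jbase R n m 0) (psi t)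
    (open_jbase oO) (fun _ h => h) Sb (Spsi t)).
have oA : open [set z : jsp (size K).+1 | O (jbase z)] by exact: open_jbase.
apply: (sm_sum _ oA) => p _; apply: (sm_mul oA).
  apply: (@sm_comp R _ _ _ X _ (jaci phi phi' p a) oA _ (@smv_lsubmx_jbase _ _ oA) (Sji p a)).
  by move=> z /= Oz; exact: OX.
have := sm_fd p (open_jbase (r := size K) oO) IH; apply: sm_sub => z /=.
by rewrite jbase_jproj.
Qed.

Section Along.
Variables (U : set 'rV[R]_n) (oU : open U) (g : 'I_m -> fn) (Sg : forall s, sm U (g s)).
Hypothesis gO : forall x, U x -> O (graph g x).

Let UX x : U x -> X x.
Proof. by move=> /gO/OX; rewrite /graph row_mxKl. Qed.

Let gO' r x : U x -> O (jbase (jet_at r g x)).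
Proof. by move=> Ux; rewrite jbase_jet; exact: gO. Qed.

(** Along the jet of a section the total derivatives in [prol] become partial ones. *)
Lemma prol_jet K t x : U x ->
  prol t (jet_at (size K) g x) = iter_nabla phi phi' K (fun y => psi t (graph g y)) x.
Proof.
elim: K x => [|a K IH] x Ux; first by rewrite /= jbase_jet.
rewrite [LHS]/= jbase_jet /graph row_mxKl /iter_nabla /= /nabla; apply: eq_bigr => p _.
rewrite (fd_jet oU Sg _ Ux); last exact: (sm_diff (@sm_prol K t) (gO' _ Ux)).
by congr (_ * _); exact: (D_eq_on _ oU Ux IH).
Qed.

Variables (xi : 'I_m -> fn) (Sxi : forall s, sm U (xi s)).

(** The Jacobian of the barred fibre coordinates with respect to y, along the section. *)
Definition fibjac (t s : 'I_m) : fn := fun x => 'D_(ebase (rshift n s)) (psi t) (graph g x).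

Lemma smv_graph : smv U (graph g).
Proof.
move=> c; rewrite -(splitK c); case: (fintype.split c) => [i|s] /=.
  by apply: (sm_ext oU _ (sm_coord U i)) => x _; rewrite /graph row_mxEl.
by apply: (sm_ext oU _ (Sg s)) => x _; rewrite /graph row_mxEr mxE.
Qed.

Lemma sm_fibjac t s : sm U (fibjac t s).
Proof. exact: (sm_comp oU gO smv_graph (sm_D _ (Spsi t))). Qed.

Lemma D_jbase r (v z : jsp r) : 'D_v (@jbase R n m r) z = jbase v.
Proof.
have d : differentiable (@jbase R n m r) z.
  exact: (smv_diff (@smv_jbase R n m r setT openT) (I : setT z)).
have did : differentiable (fun y : jsp r => y) z by exact: ex_diff.
apply/rowP => c; rewrite (D_row _ _ d) -(splitK c); case: (fintype.split c) => [i|s] /=.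
  have -> : (fun y : jsp r => jbase y 0 (lshift m i)) = fun y => xc y i.
    by apply: funext => y; rewrite row_mxEl mxE.
  by rewrite (D_xc_along _ _ did) (derive_id z v) row_mxEl mxE.
have -> : (fun y : jsp r => jbase y 0 (rshift n s)) = fun y => yc y s [::].
  by apply: funext => y; rewrite row_mxEr mxE.
by rewrite (D_yc_along _ _ _ did) (derive_id z v) row_mxEr mxE.
Qed.

(** Base coordinates are not varied, so the variation passes through the inverse
    Jacobians, and it commutes with total derivatives by [delta_fd]. *)
Lemma delta_prol K t x : U x ->
  delta (@prol K t) g xi x = iter_nabla phi phi' K (fun y => \sum_s fibjac t s y * xi s y) x.
Proof.
have dB r z : differentiable (@jbase R n m r) z.
  exact: (smv_diff (@smv_jbase R n m r setT openT) (I : setT z)).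
elim: K x => [|a K IH] x Ux.
  have dp : differentiable (psi t) (jbase (jet_at 0 g x)).
    exact: (sm_diff (Spsi t) (gO' _ Ux)).
  rewrite /delta [LHS](D_comp _ (dB _ _) dp) D_jbase.
  rewrite derive_diff// big_split_ord /= big1 ?add0r; last first.
    by move=> i _; rewrite row_mxEl mxE xc_jmk mul0r.
  by apply: eq_bigr => s _; rewrite row_mxEr mxE yc_jmk// jbase_jet mulrC.
have Az := gO' (size K).+1 Ux.
have oA : open [set z : jsp (size K).+1 | O (jbase z)] by exact: open_jbase.
have Sfd p : sm [set z : jsp (size K).+1 | O (jbase z)] (fd p (@prol K t)).
  have := sm_fd p (open_jbase (r := size K) oO) (@sm_prol K t); apply: sm_sub => z /=.
  by rewrite jbase_jproj.
have Sj p : sm [set z : jsp (size K).+1 | O (jbase z)] (fun z => jaci phi phi' p a (lsubmx (jbase z))).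
  apply: (@sm_comp R _ _ _ X _ (jaci phi phi' p a) oA _ (@smv_lsubmx_jbase _ _ oA) (Sji p a)).
  by move=> z /= Oz; exact: OX.
have dl : differentiable (fun z : jsp (size K).+1 => lsubmx (jbase z)) (jet_at (size K).+1 g x).
  exact: (smv_diff (@smv_lsubmx_jbase _ _ openT) (I : setT _)).
have E0 p : 'D_(vjet (size K).+1 xi x) (fun z => jaci phi phi' p a (lsubmx (jbase z)))
    (jet_at (size K).+1 g x) = 0.
  have dj : differentiable (jaci phi phi' p a) (lsubmx (jbase (jet_at (size K).+1 g x))).
    exact: (sm_diff (Sji p a) (OX Az)).
  by rewrite (D_comp _ dl dj) D_base_vertical ?derive0// => i; exact: xc_jmk.
rewrite /delta [LHS]D_sum; last first.
  by move=> p _; exact: (diff_mul (sm_diff (Sj p) Az) (sm_diff (Sfd p) Az)).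
rewrite /iter_nabla /= /nabla; apply: eq_bigr => p _.
rewrite (D_mul _ (sm_diff (Sj p) Az) (sm_diff (Sfd p) Az)) E0 mul0r add0r.
rewrite jbase_jet /graph row_mxKl; congr (_ * _).
rewrite -[LHS]/(delta (fd p (@prol K t)) g xi x).
rewrite (delta_fd _ (open_jbase oO) (@sm_prol K t) oU Ux Sg Sxi); last by move=> y; exact: gO'.
exact: (D_eq_on _ oU Ux IH).
Qed.

End Along.

End Prolongation.

(** * Symmetrized derivatives and the linearized Lagrangian *)

Section TupleSums.
Context {R : realType} {n : nat}.
Local Notation sortJ := (sort (@ord_le n)).

Lemma permutations_size_eq (s t : seq 'I_n) : perm_eq s t ->
  size (permutations s) = size (permutations t).
Proof.
move=> st; apply/perm_size; apply: uniq_perm; rewrite ?permutations_uniq// => u.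
by rewrite !mem_permutations; apply/idP/idP => /perm_trans->//; rewrite perm_sym.
Qed.

Lemma perm_sortJ (s t : seq 'I_n) : (sortJ s == sortJ t) = perm_eq s t.
Proof.
by apply/eqP/idP => [|/sortJ_perm//]; move/perm_sortP; apply;
  [exact: ord_le_total|exact: ord_le_trans|exact: ord_le_anti].
Qed.

(** This is the number by which [sdy] divides. *)
Lemma card_sort_fiber r (K : @mindex n r) k : size (mseq K) = k ->
  #|[pred J : k.-tuple 'I_n | sortJ J == mseq K]| = size (permutations (mseq K)).
Proof.
move=> sK; rewrite cardE -(size_map val); apply/perm_size; apply: uniq_perm.
- by rewrite map_inj_uniq ?enum_uniq//; exact: val_inj.
- exact: permutations_uniq.
move=> u; rewrite mem_permutations -perm_sortJ sort_mseq.
apply/mapP/eqP => [[J]|E].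
  by rewrite mem_enum inE => /eqP <- ->.
have su : size u == k by rewrite -sK -E size_sort.
by exists (Tuple su); rewrite ?mem_enum ?inE//= E.
Qed.

(** A sum over sorted indices becomes a sum over all tuples when each term is divided
    by the number of rearrangements of its index. *)
Lemma sum_sorted_tuples r k (T : seq 'I_n -> R) : (k <= r)%N ->
  (forall s t, perm_eq s t -> T s = T t) ->
  \sum_(K : @mindex n r | size (mseq K) == k) T (mseq K) =
  \sum_(J : k.-tuple 'I_n) T J / (size (permutations J))%:R.
Proof.
move=> kr sT.
transitivity (\sum_(K : @mindex n r | size (mseq K) == k)
   \sum_(J : k.-tuple 'I_n | sortJ J == mseq K) T J / (size (permutations J))%:R).
  apply: eq_bigr => K /eqP sK.
  rewrite (eq_bigr (fun _ => T (mseq K) / (size (permutations (mseq K)))%:R)); last first.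
    move=> J /eqP E; have p : perm_eq J (mseq K) by rewrite -perm_sortJ sort_mseq E.
    by rewrite (sT _ _ p) (permutations_size_eq p).
  rewrite sumr_const card_sort_fiber// -[RHS]mulr_natr mulfVK//.
  rewrite pnatr_eq0 -lt0n -has_predT; apply/hasP; exists (mseq K) => //.
  by rewrite mem_permutations.
rewrite (exchange_big_dep predT)//=; apply: eq_bigr => J _.
have [|K0 E0] := @mindex_of n r J; first by rewrite size_tuple.
rewrite (big_pred1 K0)// => K /=; apply/andP/eqP => [[_ /eqP E]|->].
  by apply: mseq_inj; rewrite -E.
by rewrite E0 size_sort size_tuple !eqxx.
Qed.

Lemma sum_tuple0 (F : seq 'I_n -> R) : \sum_(J : 0.-tuple 'I_n) F J = F [::].
Proof.
rewrite (big_pred1 [tuple]) // => J; apply/esym/eqP; apply: val_inj => /=.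
by apply/eqP; rewrite -size_eq0 size_tuple.
Qed.

Lemma sum_tupleS k (F : seq 'I_n -> R) :
  \sum_(J : k.+1.-tuple 'I_n) F J = \sum_i \sum_(J : k.-tuple 'I_n) F (i :: J).
Proof.
rewrite pair_bigA /= (reindex (fun p : 'I_n * k.-tuple 'I_n => [tuple of p.1 :: p.2])) //=.
exists (fun J : k.+1.-tuple 'I_n => (thead J, [tuple of behead J])) => [[i J]|J] _ /=.
  by congr pair; apply: val_inj.
by rewrite [RHS]tuple_eta.
Qed.

Lemma sum_mindex3 (T : seq 'I_n -> R) : (forall s t, perm_eq s t -> T s = T t) ->
  \sum_(K : @mindex n 3) T (mseq K) =
  T [::] + \sum_i T [:: i] + \sum_i \sum_j T [:: i; j] / (size (permutations [:: i; j]))%:R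
  + \sum_i \sum_j \sum_k T [:: i; j; k] / (size (permutations [:: i; j; k]))%:R.
Proof.
move=> sT.
pose F J := T J / (size (permutations J))%:R.
transitivity (\sum_(k < 4) \sum_(K : @mindex n 3 | size (mseq K) == k) T (mseq K)).
  rewrite (exchange_big_dep predT)//=; apply: eq_bigr => K _.
  have sK : (size (mseq K) < 4)%N by rewrite ltnS size_mseq.
  by rewrite (big_pred1 (Ordinal sK)).
have E k : (k <= 3)%N -> \sum_(K : @mindex n 3 | size (mseq K) == k) T (mseq K)
   = \sum_(J : k.-tuple 'I_n) F J by move=> k3; exact: sum_sorted_tuples.
rewrite !big_ord_recr big_ord0 /= add0r !E// sum_tuple0 sum_tupleS.
rewrite {1}/F /= divr1; congr (_ + _ + _ + _).
- by apply: eq_bigr => i _; rewrite (sum_tuple0 (fun J => F (i :: J))) /F /= divr1.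
- rewrite sum_tupleS; apply: eq_bigr => i _.
  rewrite (sum_tupleS _ (fun J => F (i :: J))); apply: eq_bigr => j _.
  by rewrite (sum_tuple0 (fun J => F [:: i, j & J])).
- rewrite sum_tupleS; apply: eq_bigr => i _.
  rewrite (sum_tupleS _ (fun J => F (i :: J))); apply: eq_bigr => j _.
  rewrite (sum_tupleS _ (fun J => F [:: i, j & J])); apply: eq_bigr => k _.
  by rewrite (sum_tuple0 (fun J => F [:: i, j, k & J])).
Qed.

End TupleSums.

Section Linearization.
Context {R : realType} {n m : nat}.
Local Notation jsp r := (jspace R n m r).
Local Notation fn := ('rV[R]_n -> R).
Local Notation par := (fun (k : 'I_n) (f : fn) => 'D_(ebase k) f).

Lemma dy_perm r s J J' : perm_eq J J' -> dy r s J = dy r s J' :> jsp r.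
Proof. by move=> JJ'; rewrite /dy (sortJ_perm JJ'). Qed.

Lemma sdy_perm r s J J' (F : jsp r -> R) : perm_eq J J' -> sdy s J F = sdy s J' F.
Proof.
move=> JJ'; apply: funext => z.
by rewrite /sdy (permutations_size_eq JJ') /pdy (dy_perm r s JJ').
Qed.

Lemma sm_sdy r s J (F : jsp r -> R) A : open A -> sm A F -> sm A (sdy s J F).
Proof. by move=> oA SF; apply: (sm_mul oA); [exact: sm_D|exact: sm_cst]. Qed.

Definition coef (L : jsp 3 -> R) (g : 'I_m -> fn) s J : fn := fun x => sdy s J L (jet_at 3 g x).

(** The momenta of the Lagrange function L along the section g, for the variation xi:
    these are the values that the contact part of the form [Theta] takes. *)
Definition lagmom (L : jsp 3 -> R) (g xi : 'I_m -> fn) (j : 'I_n) : fn := fun x =>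
  \sum_s momentum par (fun j => coef L g s [:: j]) (fun k j => coef L g s [:: k; j])
     (fun k l j => coef L g s [:: k; l; j]) (xi s) j x.

(** The symmetrized derivatives are the coefficients for which the variation is a sum
    over all tuples of indices. *)
Lemma delta_linearization (L : jsp 3 -> R) A U g xi x : open A -> sm A L -> open U -> U x ->
  A (jet_at 3 g x) -> (forall s, sm U (xi s)) ->
  delta L g xi x = \sum_s linearization par (coef L g s [::]) (fun j => coef L g s [:: j])
     (fun k j => coef L g s [:: k; j]) (fun k l j => coef L g s [:: k; l; j]) (xi s) x.
Proof.
move=> oA SL oU Ux Az Sxi; rewrite /delta D_jet; last exact: (sm_diff SL Az).
rewrite big1 ?add0r; last by move=> i _; rewrite xc_jmk mul0r.
apply: eq_bigr => s _.
pose T J := pdy s J L (jet_at 3 g x) * ddr J (xi s) x.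
transitivity (\sum_(K : @mindex n 3) T (mseq K)).
  by apply: eq_bigr => K _; rewrite /T yc_jmk_mseq mulrC.
have sT J J' : perm_eq J J' -> T J = T J'.
  by move=> JJ'; rewrite /T (ddr_perm oU Ux (Sxi s) JJ') /pdy (dy_perm 3 s JJ').
have T1 J : size (permutations J) = 1%N -> T J = coef L g s J x * ddr J (xi s) x.
  by move=> E; rewrite /T /coef /sdy E divr1.
have T2 J : T J / (size (permutations J))%:R = coef L g s J x * ddr J (xi s) x.
  by rewrite /T /coef /sdy mulrAC.
rewrite (sum_mindex3 sT) T1// /linearization.
have -> : \sum_i T [:: i] = \sum_i coef L g s [:: i] x * ddr [:: i] (xi s) x.
  by apply: eq_bigr => i _; rewrite T1.
have -> : \sum_i \sum_j T [:: i; j] / (size (permutations [:: i; j]))%:R =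
    \sum_i \sum_j coef L g s [:: i; j] x * ddr [:: i; j] (xi s) x.
  by apply: eq_bigr => i _; apply: eq_bigr => j _; rewrite T2.
have -> : \sum_i \sum_j \sum_k T [:: i; j; k] / (size (permutations [:: i; j; k]))%:R =
    \sum_i \sum_j \sum_k coef L g s [:: i; j; k] x * ddr [:: i; j; k] (xi s) x.
  by apply: eq_bigr => i _; apply: eq_bigr => j _; apply: eq_bigr => k _; rewrite T2.
by [].
Qed.

End Linearization.

(** * Transformation of momenta along sections *)

Lemma add4_eq0 (V : zmodType) (a b c d : V) :
  a = 0 -> b = 0 -> c = 0 -> d = 0 -> a + b + c + d = 0.
Proof. by move=> -> -> -> ->; rewrite !addr0. Qed.

Lemma sum_single (V : zmodType) (I : finType) (F : I -> V) i :
  (forall k, k != i -> F k = 0) -> \sum_k F k = F i.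
Proof. by move=> H; rewrite (bigD1 i)//= big1 ?addr0. Qed.

Section ChangeOfOperator.
Context {R : realType} {n : nat}.
Local Notation fn := ('rV[R]_n -> R).
Variables (U U' : set 'rV[R]_n) (phi phi' : 'rV[R]_n -> 'rV[R]_n).
Hypotheses (oU : open U) (oU' : open U') (Sphi : smv U phi) (Sphi' : smv U' phi').
Hypotheses (phiU : forall x, U x -> U' (phi x)) (phiK : forall x, U x -> phi' (phi x) = x).
Local Notation nab := (nabla phi phi').
Local Notation par := (fun (k : 'I_n) (f : fn) => 'D_(ebase k) f).

Let N K f x : U x -> sm U' f -> ddr K f (phi x) = iter_nabla phi phi' K (fun y => f (phi y)) x.
Proof. exact: (ddr_iter_nabla oU Sphi Sphi' phiU phiK). Qed.

Lemma momentum_comp c1 c2 c3 (h h' : fn) b x : U x ->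
  (forall j, sm U' (c1 j)) -> (forall k j, sm U' (c2 k j)) -> (forall k l j, sm U' (c3 k l j)) ->
  sm U' h -> (forall y, U y -> h (phi y) = h' y) ->
  momentum par c1 c2 c3 h b (phi x) =
  momentum nab (fun j y => c1 j (phi y)) (fun k j y => c2 k j (phi y))
    (fun k l j y => c3 k l j (phi y)) h' b x.
Proof.
move=> Ux S1 S2 S3 Sh hh'; rewrite /momentum.
have E1 p f : sm U' f -> 'D_(ebase p) f (phi x) = nab p (fun y => f (phi y)) x.
  exact: (@N [:: p]).
have E2 p q f : sm U' f -> 'D_(ebase p) ('D_(ebase q) f) (phi x) = nab p (nab q (fun y => f (phi y))) x.
  exact: (@N [:: p; q]).
have H1 p : 'D_(ebase p) h (phi x) = nab p h' x.
  by rewrite (E1 _ _ Sh); exact: (iter_nabla_eq_on phi phi' oU [:: p] Ux hh').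
have H2 p q : 'D_(ebase p) ('D_(ebase q) h) (phi x) = nab p (nab q h') x.
  by rewrite (E2 _ _ _ Sh); exact: (iter_nabla_eq_on phi phi' oU [:: p; q] Ux hh').
rewrite (hh' _ Ux); congr (_ * _ + _ + _).
- congr (_ - _ + _); first by apply: eq_bigr => p _; exact: E1.
  by apply: eq_bigr => p _; apply: eq_bigr => q _; exact: E2.
- apply: eq_bigr => k _; rewrite H1; congr (_ * _); congr (_ - _).
  by apply: eq_bigr => p _; exact: E1.
- by apply: eq_bigr => k _; apply: eq_bigr => l _; rewrite H2.
Qed.

Lemma linearization_comp c0 c1 c2 c3 (h h' : fn) x : U x -> sm U' h ->
  (forall y, U y -> h (phi y) = h' y) ->
  linearization par c0 c1 c2 c3 h (phi x) =
  linearization nab (fun y => c0 (phi y)) (fun j y => c1 j (phi y)) (fun k j y => c2 k j (phi y))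
    (fun k l j y => c3 k l j (phi y)) h' x.
Proof.
move=> Ux Sh hh'; rewrite /linearization (hh' _ Ux).
have H K : ddr K h (phi x) = iter_nabla phi phi' K h' x.
  by rewrite N//; exact: (iter_nabla_eq_on phi phi' oU K Ux hh').
congr (_ + _ + _ + _).
- by apply: eq_bigr => j _; congr (_ * _); exact: (H [:: j]).
- by apply: eq_bigr => k _; apply: eq_bigr => j _; congr (_ * _); exact: (H [:: k; j]).
- apply: eq_bigr => k _; apply: eq_bigr => l _; apply: eq_bigr => j _; congr (_ * _).
  exact: (H [:: k; l; j]).
Qed.

Lemma nabla_sum (I : Type) (r : seq I) (F : I -> fn) a x : U x -> (forall i, sm U (F i)) ->
  nab a (fun y => \sum_(i <- r) F i y) x = \sum_(i <- r) nab a (F i) x.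
Proof.
move=> Ux SF; rewrite /nabla exchange_big; apply: eq_bigr => p _ /=.
rewrite -mulr_sumr; congr (_ * _); apply: D_sum => i _.
exact: (sm_diff (SF i) Ux).
Qed.

Lemma momentum_sum (I : Type) (r : seq I) c1 c2 c3 (F : I -> fn) b x : U x ->
  (forall i, sm U (F i)) ->
  momentum nab c1 c2 c3 (fun y => \sum_(i <- r) F i y) b x =
  \sum_(i <- r) momentum nab c1 c2 c3 (F i) b x.
Proof.
move=> Ux SF; rewrite /momentum !big_split /=; congr (_ + _ + _).
- by rewrite mulr_sumr.
- rewrite exchange_big; apply: eq_bigr => k _ /=; rewrite -mulr_sumr; congr (_ * _).
  exact: nabla_sum.
- rewrite [RHS]exchange_big; apply: eq_bigr => k _ /=; rewrite [RHS]exchange_big.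
  apply: eq_bigr => l _ /=.
  rewrite -mulr_sumr; congr (_ * _).
  rewrite (nabla_eq_on phi phi' oU k Ux (fun y Uy => nabla_sum r l Uy SF)).
  by apply: (nabla_sum _ _ Ux) => i; exact: (sm_nabla oU Sphi Sphi' phiU l (SF i)).
Qed.

Lemma linearization0 c0 c1 c2 c3 x : linearization par c0 c1 c2 c3 (fun _ => 0) x = 0.
Proof.
have H K : ddr K (fun _ : 'rV[R]_n => 0) = (fun _ => 0).
  elim: K => [//|a K IH]; apply: funext => y.
  by rewrite /ddr /= -/(ddr K _) IH D_cst.
have Z K (c : R) : c * ddr K (fun _ : 'rV[R]_n => 0) x = 0 by rewrite H mulr0.
have e1 : \sum_j c1 j x * 'D_(ebase j) (fun _ : 'rV[R]_n => (0 : R)) x = 0.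
  by apply: big1 => j _; exact: (Z [:: j]).
have e2 : \sum_k \sum_j c2 k j x * 'D_(ebase k) ('D_(ebase j) (fun _ : 'rV[R]_n => (0 : R))) x = 0.
  by apply: big1 => k _; apply: big1 => j _; exact: (Z [:: k; j]).
have e3 : \sum_k \sum_l \sum_j
    c3 k l j x * 'D_(ebase k) ('D_(ebase l) ('D_(ebase j) (fun _ : 'rV[R]_n => (0 : R)))) x = 0.
  apply: big1 => k _; apply: big1 => l _; apply: big1 => j _; exact: (Z [:: k; l; j]).
exact: (add4_eq0 (mulr0 _) e1 e2 e3).
Qed.

End ChangeOfOperator.

Section Transformation.
Context {R : realType} {n m : nat}.
Local Notation jsp r := (jspace R n m r).
Local Notation fn := ('rV[R]_n -> R).
Variables (O O' : set 'rV[R]_(n + m)) (X X' : set 'rV[R]_n) (phi phi' : 'rV[R]_n -> 'rV[R]_n).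
Variable (psi : 'I_m -> 'rV[R]_(n + m) -> R).
Hypotheses (oO : open O) (oO' : open O') (oX : open X) (oX' : open X').
Hypotheses (Sphi : smv X phi) (Sphi' : smv X' phi').
Hypotheses (phiX : forall x, X x -> X' (phi x)) (phiK : forall x, X x -> phi' (phi x) = x).
Hypotheses (Spsi : forall t, sm O (psi t)) (OX : forall u, O u -> X (lsubmx u)).
Hypothesis (OO' : forall u, O u -> O' (row_mx (phi (lsubmx u)) (\row_t psi t u))).
Local Notation prol := (prol phi phi' psi).

Definition Prol r (z : jsp r) : jsp r :=
  jmk r (fun i => phi (lsubmx (jbase z)) 0 i) (fun t K => @prol K t (jproj (size K) z)).

Let oA r : open [set z : jsp r | O (jbase z)]. Proof. exact: open_jbase. Qed.

Lemma smv_Prol r : smv [set z : jsp r | O (jbase z)] (@Prol r).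
Proof.
apply: (@smv_jmk R n m r _ _ (fun i z => phi (lsubmx (jbase z)) 0 i)
  (fun t K z => @prol K t (jproj (size K) z)) (oA (r:=r))) => [i|t K _].
  apply: (@sm_comp R _ _ _ X _ (fun x => phi x 0 i) (oA (r:=r)) _ (smv_lsubmx_jbase (oA (r:=r))) (Sphi i)).
  by move=> z /= Oz; exact: OX.
apply: (@sm_comp R _ _ _ [set z | O (jbase z)] (@jproj R n m r (size K)) (@prol K t) (oA (r:=r)) _ _
  (sm_prol oO oX Sphi Sphi' phiX Spsi OX K t)); last exact: smv_jproj.
by move=> z /=; rewrite jbase_jproj.
Qed.

Lemma jbase_Prol r (z : jsp r) : O (jbase z) ->
  jbase (Prol z) = row_mx (phi (lsubmx (jbase z))) (\row_t psi t (jbase z)).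
Proof.
move=> Oz; rewrite /jbase; congr row_mx; apply/rowP => i; rewrite mxE.
  by rewrite xc_jmk /jbase.
by rewrite mxE yc_jmk//= jbase_jproj.
Qed.

Section Along.
Variables (U : set 'rV[R]_n) (oU : open U) (g : 'I_m -> fn) (Sg : forall s, sm U (g s)).
Hypothesis gO : forall x, U x -> O (graph g x).

(** The section g in the barred coordinates. *)
Definition gbar (t : 'I_m) : fn := fun x' => psi t (graph g (phi' x')).

Definition Ubar : set 'rV[R]_n := [set x' | X' x' /\ U (phi' x')].

Let UX x : U x -> X x.
Proof. by move=> /gO/OX; rewrite /graph row_mxKl. Qed.

Lemma open_Ubar : open Ubar.
Proof.
rewrite openE => x' [Xx' Ux']; apply: (@filterI _ _ (nbhs_filter x')).
  exact: (open_nbhs_nbhs (conj oX' Xx')).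
exact: (smv_cont Sphi' Xx' (open_nbhs_nbhs (conj oU Ux'))).
Qed.

Lemma phi_Ubar x : U x -> Ubar (phi x).
Proof. by move=> Ux; split; [exact/phiX/UX|rewrite phiK//; exact: UX]. Qed.

Let SphiU : smv U phi. Proof. by move=> i; apply: sm_sub (Sphi i); exact: UX. Qed.
Let Sphi'U : smv Ubar phi'. Proof. by move=> i; apply: sm_sub (Sphi' i) => x []. Qed.
Let phiKU x : U x -> phi' (phi x) = x. Proof. by move=> /UX; exact: phiK. Qed.

Lemma sm_pull_Ubar f : sm U f -> sm Ubar (fun x' => f (phi' x')).
Proof.
move=> Sf; exact: (@sm_comp R _ _ _ U _ f open_Ubar (fun x (h : Ubar x) => h.2) Sphi'U Sf).
Qed.

Lemma sm_gbar t : sm Ubar (gbar t).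
Proof.
apply: (@sm_pull_Ubar (fun y => psi t (graph g y))).
exact: (sm_comp oU gO (smv_graph oU Sg) (Spsi t)).
Qed.

Lemma gbarE t y : U y -> gbar t (phi y) = psi t (graph g y).
Proof. by move=> Uy; rewrite /gbar phiKU. Qed.

Lemma gbar_O' x' : Ubar x' -> phi (phi' x') = x' -> O' (graph gbar x').
Proof.
move=> [Xx' Ux'] E; have := OO' (gO Ux'); rewrite /graph row_mxKl E /gbar.
by congr (O' (row_mx _ _)).
Qed.

(** Both sides are iterated derivatives in the barred coordinates of the transformed section. *)
Lemma Prol_jet r x : U x -> Prol (jet_at r g x) = jet_at r gbar (phi x).
Proof.
move=> Ux; apply: jspaceP => [i|t K].
  by rewrite !xc_jmk jbase_jet /graph row_mxKl.
have sK := size_mseq K.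
rewrite yc_jmk_mseq yc_jmk_mseq (jproj_jet oU Sg sK Ux).
rewrite (prol_jet oO oX Sphi Sphi' phiX Spsi OX oU Sg gO _ _ Ux).
rewrite (ddr_iter_nabla oU SphiU Sphi'U phi_Ubar phiKU _ Ux (sm_gbar t)).
by apply: (iter_nabla_eq_on phi phi' oU _ Ux) => y Uy; rewrite gbarE.
Qed.

Lemma D_Prol_htot r p x : U x ->
  'D_(htot p (jet_at r.+1 g x)) (@Prol r) (jet_at r g x) =
  \sum_a jac phi a p x *: htot a (jet_at r.+1 gbar (phi x)).
Proof.
move=> Ux.
have Az : [set z : jsp r | O (jbase z)] (jet_at r g x) by rewrite /= jbase_jet; exact: gO.
have dP := smv_diff (@smv_Prol r) Az.
have dj := smv_diff (smv_jet oU Sg (r:=r)) Ux.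
have dphi := smv_diff SphiU Ux.
have djb := smv_diff (smv_jet open_Ubar sm_gbar (r:=r)) (phi_Ubar Ux).
rewrite -(D_jet_htot oU Sg _ _ Ux) -(D_comp _ dj dP).
rewrite (D_eq_on (ebase p) oU Ux (fun y Uy => Prol_jet r Uy)) (D_comp _ dphi djb).
have -> : 'D_(ebase p) phi x = \sum_a jac phi a p x *: ebase a.
  rewrite [LHS]row_sum_delta; apply: eq_bigr => a _; congr (_ *: _).
  by rewrite (D_row _ _ dphi).
rewrite (deriveE _ djb) linear_sum; apply: eq_bigr => a _ /=.
by rewrite linearZ /= -(deriveE _ djb) (D_jet_htot open_Ubar sm_gbar _ _ (phi_Ubar Ux)).
Qed.

Section Variation.
Variables (xi : 'I_m -> fn) (Sxi : forall s, sm U (xi s)).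
Local Notation B := (fibjac psi g).

Let SB t s : sm U (B t s). Proof. exact: (sm_fibjac Spsi oU Sg gO). Qed.

(** The image of the variation xi under the linearized transformation. *)
Definition xibar (t : 'I_m) : fn := fun x' => \sum_s B t s (phi' x') * xi s (phi' x').

Let Sxf t : sm U (fun y => \sum_s B t s y * xi s y).
Proof. by apply: (sm_sum _ oU) => s _; exact: (sm_mul oU (SB t s) (Sxi s)). Qed.

Lemma sm_xibar t : sm Ubar (xibar t).
Proof. exact: (@sm_pull_Ubar (fun y => \sum_s B t s y * xi s y)). Qed.

Lemma xibarE t y : U y -> xibar t (phi y) = \sum_s B t s y * xi s y.
Proof. by move=> Uy; rewrite /xibar phiKU. Qed.

Lemma D_Prol_vjet r x : U x ->
  'D_(vjet r xi x) (@Prol r) (jet_at r g x) = vjet r xibar (phi x).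
Proof.
move=> Ux.
have Az : [set z : jsp r | O (jbase z)] (jet_at r g x) by rewrite /= jbase_jet; exact: gO.
have dP := smv_diff (@smv_Prol r) Az.
apply: jspaceP => [i|t K].
  rewrite -(D_xc_along _ _ dP) xc_jmk.
  have -> : (fun z : jsp r => xc (Prol z) i) = fun z => phi (lsubmx (jbase z)) 0 i.
    by apply: funext => z; exact: xc_jmk.
  have dl : differentiable (fun z : jsp r => lsubmx (jbase z)) (jet_at r g x).
    exact: (smv_diff (@smv_lsubmx_jbase R n m r _ openT) (I : setT _)).
  have dphi := sm_diff (Sphi i) (OX Az).
  rewrite (@D_comp _ _ _ _ (fun z : jsp r => lsubmx (jbase z)) (fun x => phi x 0 i) _ _ dl dphi).
  by rewrite D_base_vertical ?derive0// => j; exact: xc_jmk.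
have sK := size_mseq K.
rewrite -(D_yc_along _ _ _ dP) yc_jmk_mseq.
have -> : (fun z : jsp r => yc (Prol z) t (mseq K)) =
    fun z => @prol (mseq K) t (jproj (size (mseq K)) z).
  by apply: funext => z; exact: yc_jmk_mseq.
have dp := smv_diff (@smv_jproj R n m r (size (mseq K)) setT openT) (I : setT (jet_at r g x)).
have Sp := sm_prol oO oX Sphi Sphi' phiX Spsi OX (mseq K) t.
have dq : differentiable (@prol (mseq K) t) (jproj (size (mseq K)) (jet_at r g x)).
  by apply: (sm_diff Sp); rewrite /= jbase_jproj.
rewrite (D_comp _ dp dq) D_jproj (jproj_jet oU Sg sK Ux) (jproj_vjet oU Sxi sK Ux).
rewrite -[LHS]/(delta (@prol (mseq K) t) g xi x).
rewrite (delta_prol oO oX Sphi Sphi' phiX Spsi OX oU Sg gO Sxi _ _ Ux).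
rewrite (ddr_iter_nabla oU SphiU Sphi'U phi_Ubar phiKU _ Ux (sm_xibar t)).
by apply: (iter_nabla_eq_on phi phi' oU _ Ux) => y Uy; rewrite xibarE.
Qed.

End Variation.

Section Invariance.
Variables (L L' : jsp 3 -> R).
Hypotheses (SL : sm [set z | O (jbase z)] L) (SL' : sm [set z | O' (jbase z)] L').
Hypothesis Llaw : forall z, O (jbase z) -> L z = jacdet phi (lsubmx (jbase z)) * L' (Prol z).
Hypothesis phi'K : forall x', X' x' -> phi (phi' x') = x'.
Local Notation par := (fun (k : 'I_n) (f : fn) => 'D_(ebase k) f).
Local Notation nab := (nabla phi phi').
Local Notation B := (fibjac psi g).

Let A := [set z : jsp 3 | O (jbase z)].
Let A' := [set z : jsp 3 | O' (jbase z)].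

Let Ag x : U x -> A (jet_at 3 g x).
Proof. by move=> Ux; rewrite /A /= jbase_jet; exact: gO. Qed.

Let Ag' x' : Ubar x' -> A' (jet_at 3 gbar x').
Proof. by move=> Ux; rewrite /A' /= jbase_jet; apply: gbar_O' => //; apply: phi'K; case: Ux. Qed.

Let AProl z : A z -> A' (Prol z).
Proof. by move=> Az; rewrite /A' /= jbase_Prol//; exact: OO'. Qed.

Lemma sm_coef s J : sm U (coef L g s J).
Proof.
exact: (@sm_comp R _ _ U A (jet_at 3 g) (sdy s J L) oU Ag (smv_jet oU Sg (r:=3))
  (sm_sdy s J (oA (r:=3)) SL)).
Qed.

Lemma sm_coef' s J : sm Ubar (coef L' gbar s J).
Proof.
exact: (@sm_comp R _ _ Ubar A' (jet_at 3 gbar) (sdy s J L') open_Ubar Ag'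
  (smv_jet open_Ubar sm_gbar (r:=3)) (sm_sdy s J (open_jbase (r := 3) oO') SL')).
Qed.

(** Differentiate the law relating L and L' along the variation: its Jacobian factor
    depends on the base point only and is not varied. *)
Lemma delta_law xi x : (forall s, sm U (xi s)) -> U x ->
  delta L g xi x = jacdet phi x * delta L' gbar (xibar xi) (phi x).
Proof.
move=> Sxi Ux; have Az := Ag Ux.
have dl : differentiable (fun z : jsp 3 => lsubmx (jbase z)) (jet_at 3 g x).
  exact: (smv_diff (@smv_lsubmx_jbase R n m 3 _ openT) (I : setT _)).
have dJ : differentiable (jacdet phi) (lsubmx (jbase (jet_at 3 g x))).
  exact: (sm_diff (sm_jacdet oX Sphi) (OX Az)).
have dP := smv_diff (@smv_Prol 3) Az.
have dL' : differentiable L' (Prol (jet_at 3 g x)) by exact: (sm_diff SL' (AProl Az)).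
have d1 : differentiable (fun z : jsp 3 => jacdet phi (lsubmx (jbase z))) (jet_at 3 g x).
  exact: (differentiable_comp dl dJ).
have d2 : differentiable (fun z : jsp 3 => L' (Prol z)) (jet_at 3 g x).
  exact: (differentiable_comp dP dL').
rewrite /delta (D_eq_on _ (oA (r:=3)) Az Llaw) (D_mul _ d1 d2).
rewrite (D_comp _ dl dJ) D_base_vertical; last by move=> i; exact: xc_jmk.
rewrite derive0 mul0r add0r jbase_jet /graph row_mxKl; congr (_ * _).
by rewrite (D_comp _ dP dL') (D_Prol_vjet Sxi _ Ux) (Prol_jet _ Ux).
Qed.

(** By [delta_law] the linearizations of L and L' along the section correspond, which
    is the hypothesis under which momenta are known to be invariant. *)
Lemma lagmom_invariant xi j x : (forall s, sm setT (xi s)) -> U x ->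
  (forall i k : 'I_n, i = k) \/
    ((forall z s k l i, A z -> sdy s [:: k; l; i] L z = 0) /\
     (forall z s k l i, A' z -> sdy s [:: k; l; i] L' z = 0)) ->
  lagmom L g xi j x =
  jacdet phi x * \sum_b jaci phi phi' j b x * lagmom L' gbar (xibar xi) b (phi x).
Proof.
move=> SxiT Ux cases.
have Sxi s : sm U (xi s) by apply: sm_sub (SxiT s).
have SB t s : sm U (B t s) by exact: (sm_fibjac Spsi oU Sg gO).
pose a s J := coef L g s J.
pose b t J := fun y => coef L' gbar t J (phi y).
have Sb t J : sm U (b t J).
  exact: (@sm_comp R _ _ U Ubar phi (coef L' gbar t J) oU phi_Ubar SphiU (sm_coef' t J)).
(* [delta_law] for a variation with a single nonzero component *)
have lin_eq s h : sm U h -> forall y, U y ->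
    linearization par (a s [::]) (fun j => a s [:: j]) (fun k j => a s [:: k; j])
      (fun k l j => a s [:: k; l; j]) h y =
    jacdet phi y * \sum_t linearization nab (b t [::]) (fun j => b t [:: j])
      (fun k j => b t [:: k; j]) (fun k l j => b t [:: k; l; j]) (fun w => B t s w * h w) y.
  move=> Sh y Uy; pose xi0 s' := if s' == s then h else fun _ => 0.
  have S0 s' : sm U (xi0 s') by rewrite /xi0; case: eqP => _ //; exact: sm_cst.
  have xi0s : xi0 s = h by rewrite /xi0 eqxx.
  have xi0n s' : s' != s -> xi0 s' = fun _ => 0 by rewrite /xi0 => /negPf ->.
  have EL := delta_linearization (oA (r:=3)) SL oU Uy (Ag Uy) S0.
  have EL' := delta_linearization (open_jbase (r := 3) oO') SL' open_Ubar (phi_Ubar Uy)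
    (Ag' (phi_Ubar Uy)) (sm_xibar S0).
  have ES : \sum_s' linearization par (a s' [::]) (fun j => a s' [:: j]) (fun k j => a s' [:: k; j])
      (fun k l j => a s' [:: k; l; j]) (xi0 s') y =
    linearization par (a s [::]) (fun j => a s [:: j]) (fun k j => a s [:: k; j])
      (fun k l j => a s [:: k; l; j]) h y.
    apply: etrans; first apply: (@sum_single R _ _ s).
      by move=> s' s's; rewrite (xi0n _ s's); exact: linearization0.
    by rewrite xi0s.
  refine (etrans (esym ES) (etrans (esym EL) (etrans (delta_law S0 Uy)
    (congr1 (fun w => jacdet phi y * w) (etrans EL' (eq_bigr _ _)))))) => t _.
  apply: (linearization_comp oU SphiU Sphi'U phi_Ubar phiKU _ _ _ _ Uy (sm_xibar S0 t)) => w Uw.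
  rewrite (xibarE _ _ Uw); apply: etrans; first apply: (@sum_single R _ _ s).
    by move=> s' s's; rewrite (xi0n _ s's) mulr0.
  by rewrite xi0s.
have symA2 s k i : a s [:: k; i] = a s [:: i; k].
  by apply: funext => y; rewrite /a /coef (sdy_perm s L (J' := [:: i; k]))// (perm_catC [:: k]).
have perm3l (k l i : 'I_n) : perm_eq [:: k; l; i] [:: l; k; i].
  by rewrite -[[:: k; l; i]]/([:: k] ++ [:: l] ++ [:: i]) -[X in perm_eq _ X]/([:: l] ++ [:: k] ++ [:: i]) perm_catCA.
have perm3r (k l i : 'I_n) : perm_eq [:: k; l; i] [:: k; i; l].
  by rewrite perm_cons (perm_catC [:: l]).
have symA3l s k l i : a s [:: k; l; i] = a s [:: l; k; i].
  by apply: funext => y; rewrite /a /coef (sdy_perm s L (perm3l k l i)).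
have symA3r s k l i : a s [:: k; l; i] = a s [:: k; i; l].
  by apply: funext => y; rewrite /a /coef (sdy_perm s L (perm3r k l i)).
have symB2 s k i : b s [:: k; i] = b s [:: i; k].
  by apply: funext => y; rewrite /b /coef (sdy_perm s L' (J' := [:: i; k]))// (perm_catC [:: k]).
have symB3l s k l i : b s [:: k; l; i] = b s [:: l; k; i].
  by apply: funext => y; rewrite /b /coef (sdy_perm s L' (perm3l k l i)).
have symB3r s k l i : b s [:: k; l; i] = b s [:: k; i; l].
  by apply: funext => y; rewrite /b /coef (sdy_perm s L' (perm3r k l i)).
have key s h : sm setT h ->
    momentum par (fun j => a s [:: j]) (fun k j => a s [:: k; j]) (fun k l j => a s [:: k; l; j]) h j x =
    jacdet phi x * \sum_c jaci phi phi' j c x * \sum_t momentum nab (fun j => b t [:: j])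
      (fun k j => b t [:: k; j]) (fun k l j => b t [:: k; l; j]) (fun w => B t s w * h w) c x.
  move=> Sh; case: cases => [one|[z0 z0']].
    exact: (@momentum_inv_dim1 R n m U Ubar phi phi' oU SphiU Sphi'U phi_Ubar phiKU
      (fun s => a s [::]) (fun s j => a s [:: j]) (fun s k j => a s [:: k; j]) (fun s k l j => a s [:: k; l; j])
      (fun s => b s [::]) (fun s j => b s [:: j]) (fun s k j => b s [:: k; j]) (fun s k l j => b s [:: k; l; j])
      B (fun s _ => sm_coef s _) (fun s _ _ => sm_coef s _) (fun s _ _ _ => sm_coef s _)
      (fun s _ => Sb s _) (fun s _ _ => Sb s _) (fun s _ _ _ => Sb s _) SB
      symA2 symA3l symA3r symB2 symB3l symB3r lin_eq s h j x one Sh Ux).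
  apply: (@momentum_inv_order2 R n m U Ubar phi phi' oU SphiU Sphi'U phi_Ubar phiKU
      (fun s => a s [::]) (fun s j => a s [:: j]) (fun s k j => a s [:: k; j]) (fun s k l j => a s [:: k; l; j])
      (fun s => b s [::]) (fun s j => b s [:: j]) (fun s k j => b s [:: k; j]) (fun s k l j => b s [:: k; l; j])
      B (fun s _ => sm_coef s _) (fun s _ _ => sm_coef s _) (fun s _ _ _ => sm_coef s _)
      (fun s _ => Sb s _) (fun s _ _ => Sb s _) (fun s _ _ _ => Sb s _) SB
      symA2 symA3l symA3r symB2 symB3l symB3r lin_eq s h j x _ _ Sh Ux).
    by move=> s' k l i y Uy; apply: z0; exact: Ag.
  by move=> s' k l i y Uy; apply: z0'; apply: Ag'; exact: phi_Ubar.
rewrite /lagmom; apply: (etrans (eq_bigr _ (fun s _ => key s (xi s) (SxiT s)))).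
rewrite -mulr_sumr; congr (_ * _).
rewrite exchange_big; apply: eq_bigr => c _; rewrite -mulr_sumr; congr (_ * _).
rewrite exchange_big; apply: eq_bigr => t _ /=.
rewrite (momentum_comp oU SphiU Sphi'U phi_Ubar phiKU c Ux (fun j => sm_coef' t [:: j])
  (fun k j => sm_coef' t [:: k; j]) (fun k l j => sm_coef' t [:: k; l; j]) (sm_xibar Sxi t)
  (fun y Uy => xibarE xi t Uy)).
apply/esym; apply: (momentum_sum oU SphiU Sphi'U phi_Ubar _ _ _ _ _ Ux) => s.
exact: (sm_mul oU (SB t s) (Sxi s)).
Qed.

End Invariance.

End Along.

End Transformation.

(** * Jets of polynomial sections; basic forms *)

Section Taylor.
Context {R : realType} {n m : nat}.
Local Notation fn := ('rV[R]_n -> R).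
Implicit Types (f : fn) (J K : seq 'I_n).

Lemma ddr_scale J c f : sm setT f -> ddr J (fun y => c * f y) = fun y => c * ddr J f y.
Proof.
move=> Sf; elim: J => [//|a J IH]; apply: funext => y.
rewrite -[LHS]/('D_(ebase a) (ddr J (fun y => c * f y)) y) IH.
have dc : differentiable (fun _ : 'rV[R]_n => c) y by exact: differentiable_cst.
by rewrite (D_mul _ dc (sm_diff (sm_ddr J Sf) (I : setT y))) D_cst mul0r add0r.
Qed.

Lemma ddr_sum J (T : Type) (r : seq T) (F : T -> fn) : (forall i, sm setT (F i)) ->
  ddr J (fun y => \sum_(i <- r) F i y) = fun y => \sum_(i <- r) ddr J (F i) y.
Proof.
move=> SF; elim: J => [//|a J IH]; apply: funext => y.
rewrite -[LHS]/('D_(ebase a) (ddr J (fun y => \sum_(i <- r) F i y)) y) IH.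
exact: (@D_sum R n T r xpredT (fun i => ddr J (F i)) (ebase a) y
  (fun i _ => sm_diff (sm_ddr J (SF i)) (I : setT y))).
Qed.

Variable x0 : 'rV[R]_n.

(** Monomials centred at x0, with exponents given by multiplicities. *)
Definition mono K : fn := fun x => \prod_(k <- K) (x 0 k - x0 0 k).

Lemma sm_mono K A : open A -> sm A (mono K).
Proof.
move=> oA; apply: (sm_prod _ oA) => k _; apply: (sm_add oA); first exact: sm_coord.
exact: sm_cst.
Qed.

Lemma mono_rem j K x : j \in K -> mono K x = (x 0 j - x0 0 j) * mono (rem j K) x.
Proof. by move=> jK; rewrite /mono (perm_big _ (perm_to_rem jK)) big_cons. Qed.

Lemma D_mono j K : 'D_(ebase j) (mono K) = fun x => (count_mem j K)%:R * mono (rem j K) x.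
Proof.
elim: K => [|k K IH]; apply: funext => x.
  rewrite /= mul0r (_ : mono [::] = fun=> 1) ?D_cst//.
  by apply: funext => y; rewrite /mono big_nil.
have dm : differentiable (mono K) x by exact: (sm_diff (sm_mono K openT)).
have dk : differentiable (fun y : 'rV[R]_n => y 0 k - x0 0 k) x.
  apply: (sm_diff (A := setT)) => //; apply: (sm_add openT); first exact: sm_coord.
  exact: sm_cst.
have -> : mono (k :: K) = fun y => (y 0 k - x0 0 k) * mono K y.
  by apply: funext => y; rewrite /mono big_cons.
have IHx : 'D_(ebase j) (mono K) x = (count_mem j K)%:R * mono (rem j K) x.
  exact: (congr1 (fun f : fn => f x) IH).
rewrite (D_mul _ dk dm) IHx.
have -> : 'D_(ebase j) (fun y : 'rV[R]_n => y 0 k - x0 0 k) x = (k == j)%:R.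
  have dc : differentiable (fun _ : 'rV[R]_n => - x0 0 k) x by exact: differentiable_cst.
  by rewrite (D_add _ (diff_coord k x) dc) D_coord D_cst addr0 /ebase mxE eqxx.
rewrite /=; case: eqVneq => [->|kj] /=.
  have [jK|jK] := boolP (j \in K).
    by rewrite (mono_rem _ jK) natrD; ring.
  by rewrite (count_memPn jK) mul0r mulr0 addr0 addn0.
rewrite mul0r add0r add0n {2}/mono big_cons -/(mono _ _); ring.
Qed.

(** At the centre, differentiating a monomial along an index kills it unless index and
    monomial agree up to order; this makes monomials dual to derivatives. *)
Lemma ddr_mono J K : if perm_eq J K then ddr J (mono K) x0 != 0 else ddr J (mono K) x0 == 0.
Proof.
elim/last_ind: J K => [|J j IH] K.
  case: K => [|k K]; first by rewrite perm_refl /ddr /= /mono big_nil oner_eq0.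
  rewrite ifF; last by apply/negP => /perm_size.
  by rewrite /ddr /= /mono big_cons subrr mul0r.
have E : ddr (rcons J j) (mono K) x0 = (count_mem j K)%:R * ddr J (mono (rem j K)) x0.
  rewrite /ddr map_rcons iter_derive_rcons D_mono -/(ddr J _).
  by rewrite (ddr_scale _ _ (sm_mono _ openT)).
rewrite E; have [jK|jK] := boolP (j \in K); last first.
  rewrite (count_memPn jK) mul0r eqxx ifF//; apply/negP => /perm_mem/(_ j).
  by rewrite mem_rcons mem_head (negPf jK).
have -> : perm_eq (rcons J j) K = perm_eq J (rem j K).
  by rewrite perm_sym (permPl (perm_to_rem jK)) perm_sym perm_rcons perm_cons.
have c0 : (count_mem j K)%:R != 0 :> R by rewrite pnatr_eq0 -lt0n -has_count has_pred1.
have := IH (rem j K); case: ifP => _; first by move=> h; rewrite mulf_neq0.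
by move=> /eqP->; rewrite mulr0.
Qed.

(** The Taylor polynomial; the coefficient of a monomial is divided by its own derivative
    at the centre instead of by factorials. *)
Lemma taylor r (c : 'I_m -> seq 'I_n -> R) : exists g : 'I_m -> fn,
  (forall s, sm setT (g s)) /\
  forall s (K : @mindex n r), ddr (mseq K) (g s) x0 = c s (mseq K).
Proof.
pose d (K : @mindex n r) := ddr (mseq K) (mono (mseq K)) x0.
exists (fun s x => \sum_(K : @mindex n r) (c s (mseq K) / d K) * mono (mseq K) x).
have Sm (K : @mindex n r) (a : R) : sm setT (fun x => a * mono (mseq K) x).
  exact: (sm_mul openT (sm_cst setT a) (sm_mono (mseq K) openT)).
split=> [s|s K].
  by refine (sm_sum _ openT _) => K _; exact: Sm.
have E := ddr_sum (mseq K) (index_enum _)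
  (fun K' : @mindex n r => Sm K' (c s (mseq K') / d K')).
apply: (etrans (congr1 (fun f : fn => f x0) E)).
have H (K' : @mindex n r) : ddr (mseq K) (fun x => (c s (mseq K') / d K') * mono (mseq K') x) x0 =
   (c s (mseq K') / d K') * ddr (mseq K) (mono (mseq K')) x0.
  by rewrite (ddr_scale _ _ (sm_mono _ openT)).
apply: (etrans (eq_bigr _ (fun (K' : @mindex n r) _ => H K'))).
apply: etrans; first apply: (@sum_single R _ _ K).
  move=> K' K'K; have := ddr_mono (mseq K) (mseq K'); rewrite ifF; first by move=> /eqP->; rewrite mulr0.
  by apply/negP; rewrite -perm_sortJ !sort_mseq => /eqP/mseq_inj KK'; rewrite KK' eqxx in K'K.
by rewrite divfK//; have := ddr_mono (mseq K) (mseq K); rewrite perm_refl.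
Qed.

End Taylor.

Section TaylorJets.
Context {R : realType} {n m : nat}.
Local Notation jsp r := (jspace R n m r).
Local Notation fn := ('rV[R]_n -> R).

Lemma taylor_jet r (z : jsp r) : exists g : 'I_m -> fn, (forall s, sm setT (g s)) /\
  jet_at r g (lsubmx (jbase z)) = z.
Proof.
have [g [Sg H]] := taylor (lsubmx (jbase z)) r (fun s K => yc z s K).
exists g; split => //; apply: jspaceP => [i|s K].
  by rewrite xc_jmk /jbase row_mxKl mxE.
by rewrite yc_jmk_mseq H.
Qed.

Lemma taylor_vjet r (w : jsp r) x : (forall i, xc w i = 0) ->
  exists g : 'I_m -> fn, (forall s, sm setT (g s)) /\ vjet r g x = w.
Proof.
move=> w0; have [g [Sg H]] := taylor x r (fun s K => yc w s K).
exists g; split => //; apply: jspaceP => [i|s K]; first by rewrite xc_jmk w0.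
by rewrite yc_jmk_mseq H.
Qed.

End TaylorJets.

Section Forms.
Context {R : realType} {n m : nat}.
Local Notation jsp r := (jspace R n m r).
Local Notation fn := ('rV[R]_n -> R).

Lemma first_ordE (p q : 'I_n) : first_ord p = first_ord q.
Proof. exact: val_inj. Qed.

(** The cofactor omits the first column, so any vector c may be placed there. *)
Lemma omega1_cofactor r p (u : 'I_n.-1 -> jsp r) (c : 'I_n -> R) :
  omega1 p u = cofactor (\matrix_(i, k) if unlift (first_ord p) k is Some k' then xc (u k') i else c i)
    p (first_ord p).
Proof.
rewrite /omega1 /omega0 (expand_det_col _ (first_ord p)) (@sum_single _ _ _ p).
  rewrite mxE unlift_none xc_dx eqxx mul1r /cofactor; congr (_ * \det _).
  by apply/matrixP => i k; rewrite !mxE liftK.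
by move=> i ip; rewrite mxE unlift_none xc_dx (negPf ip) mul0r.
Qed.

(** The matrix of omega1 is a permutation matrix with sign (-1)^j, or has a zero row. *)
Lemma omega1_basis r j j' (u : 'I_n.-1 -> jsp r) :
  (forall k i, xc (u k) i = (i == lift j k)%:R) -> omega1 j' u = (j' == j)%:R * (-1) ^+ j.
Proof.
move=> uE; rewrite (omega1_cofactor j' u (fun _ => 0)) /cofactor /= addn0.
have [->|jj] := eqVneq j' j; last first.
  rewrite mul0r; have [i Ei] : exists i, j = lift j' i.
    by case: (unliftP j' j) => [i E|E]; [exists i|rewrite E eqxx in jj].
  rewrite (expand_det_row _ i) big1 ?mulr0// => k _.
  by rewrite !mxE liftK uE -Ei (negPf (neq_lift _ _)) mul0r.
rewrite mul1r (_ : row' _ _ = 1%:M) ?det1 ?mulr1//.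
apply/matrixP => i k; rewrite !mxE.
by rewrite liftK uE (inj_eq lift_inj).
Qed.

Lemma omega1_vertical r j' (u : 'I_n.-1 -> jsp r) k :
  (forall i, xc (u k) i = 0) -> omega1 j' u = 0.
Proof.
move=> u0; rewrite /omega1 /omega0 (expand_det_col _ (lift (first_ord j') k)) big1// => i _.
by rewrite mxE liftK u0 mul0r.
Qed.

Section Linear.
Variables (M Mi : 'M[R]_n).
Hypothesis MK : M *m Mi = 1%:M.

Lemma omega0_law r (v v' : 'I_n -> jsp r) :
  (forall k a, xc (v' k) a = \sum_p M a p * xc (v k) p) ->
  omega0 v' = \det M * omega0 v.
Proof.
move=> H; rewrite /omega0 -det_mulmx; congr (\det _); apply/matrixP => a k.
by rewrite !mxE H; apply: eq_bigr => p _; rewrite mxE.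
Qed.

(** Replacing the vector inserted in first position by the b-th column of Mi, the whole
    matrix of the left-hand side is a product with left factor M. *)
Lemma omega1_law r b (u u' : 'I_n.-1 -> jsp r) :
  (forall k a, xc (u' k) a = \sum_p M a p * xc (u k) p) ->
  omega1 b u' = \det M * \sum_p Mi p b * omega1 p u.
Proof.
move=> H; pose i0 := first_ord b.
pose N := \matrix_(i, k) if unlift i0 k is Some k' then xc (u k') i else Mi i b.
have -> : omega1 b u' = \det (M *m N).
  rewrite /omega1 /omega0; congr (\det _); apply/matrixP => i k; rewrite !mxE.
  rewrite -/i0; case E : (unlift i0 k) => [k'|].
    by rewrite H; apply: eq_bigr => p _; rewrite !mxE E.
  rewrite xc_dx; have /matrixP/(_ i b) := MK; rewrite !mxE => <-.
  by apply: eq_bigr => p _; rewrite !mxE E.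
rewrite det_mulmx; congr (_ * _); rewrite (expand_det_col _ i0); apply: eq_bigr => p _.
rewrite (omega1_cofactor p u (fun i => Mi i b)) (first_ordE p b) -/i0.
by rewrite mxE unlift_none.
Qed.

End Linear.

(** Contact forms vanish on horizontal lifts. *)
Lemma contact_form_along U (g xi : 'I_m -> fn) x (w : 'I_n -> R) s J : open U -> U x ->
  (forall s, sm U (g s)) -> (forall s, sm U (xi s)) -> (size J < 5)%N ->
  contact_form s J (jet_at 5 g x) (\sum_p w p *: htot p (jet_at 6 g x) + vjet 5 xi x) = ddr J (xi s) x.
Proof.
move=> oU Ux Sg Sxi J5; rewrite /contact_form ycD yc_sum (yc_vjet oU Sxi s Ux (ltnW J5)).
rewrite addrAC -[RHS]add0r; congr (_ + _).
apply/eqP; rewrite subr_eq0; apply/eqP; apply: eq_bigr => p _.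
rewrite ycZ yc_jmk ?(ltnW J5)// mulrC xcD xc_sum (@sum_single _ _ _ p).
  rewrite xcZ !xc_jmk eqxx mulr1 addr0; congr (_ * _).
  rewrite !(yc_jet oU Sg) ?size_rcons ?size_sort// ?(leqW J5)//.
  apply: (ddr_perm oU Ux (Sg s)); rewrite -!cats1 perm_cat2r perm_sort.
  by [].
by move=> q qp; rewrite xcZ xc_jmk eq_sym (negPf qp) mulr0.
Qed.

End Forms.

(** * The Lepage form in terms of momenta *)

Section ThetaAlong.
Context {R : realType} {n m : nat}.
Local Notation jsp r := (jspace R n m r).
Local Notation fn := ('rV[R]_n -> R).

(** Contact forms read off the derivatives of the variations ([contact_form_along]) and
    total derivatives become partial ones ([fd_jet]), so what remains is exactly the
    definition of the momenta. *)
Lemma Theta_along (L : jsp 3 -> R) A U (g : 'I_m -> fn) (xi : 'I_n -> 'I_m -> fn) x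
    (v : 'I_n -> jsp 5) : open A -> sm A L -> open U -> U x ->
  (forall s, sm U (g s)) -> (forall y, U y -> A (jet_at 3 g y)) -> (forall i s, sm U (xi i s)) ->
  (forall i, v i = \sum_p xc (v i) p *: htot p (jet_at 6 g x) + vjet 5 (xi i) x) ->
  Theta L (jet_at 5 g x) v = L (jet_at 3 g x) * omega0 v
    + \sum_i \sum_j lagmom L g (xi i) j x * ((-1) ^+ i * omega1 j (fun i' => v (lift i i'))).
Proof.
move=> oA SL oU Ux Sg AU Sxi vE.
have C0 s J i : (size J < 5)%N -> contact_form s J (jet_at 5 g x) (v i) = ddr J (xi i s) x.
  by move=> J5; rewrite vE; exact: (contact_form_along _ _ oU Ux Sg (Sxi i) J5).
pose W (i j : 'I_n) : R := (-1) ^+ i * omega1 j (fun i' => v (lift i i')).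
have WE s J j : (size J < 5)%N -> wedge1 (contact_form s J (jet_at 5 g x)) (omega1 j) v =
    \sum_i ddr J (xi i s) x * W i j.
  by move=> J5; apply: eq_bigr => i _; rewrite (C0 s J i J5) /W; ring.
have Sc s J : sm A (sdy s J L) by exact: sm_sdy.
have P0 F : pull F (jet_at 5 g x) = F (jet_at 3 g x) by rewrite /pull /= (jproj_jet oU Sg).
have F1 p s J y : U y -> fd p (sdy s J L) (jet_at 4 g y) = 'D_(ebase p) (coef L g s J) y.
  move=> Uy; exact: (fd_jet oU Sg p Uy (sm_diff (Sc s J) (AU _ Uy))).
have P1 p s J : pull (fd p (sdy s J L)) (jet_at 5 g x) = 'D_(ebase p) (coef L g s J) x.
  by rewrite /pull /= (jproj_jet oU Sg)// F1.
have P2 p q s J : fd p (fd q (sdy s J L)) (jet_at 5 g x) = 'D_(ebase p) ('D_(ebase q) (coef L g s J)) x.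
  have Sf := sm_fd q oA (Sc s J).
  rewrite (fd_jet oU Sg p Ux); first exact: (D_eq_on _ oU Ux (fun y Uy => F1 q s J y Uy)).
  apply: (sm_diff Sf); rewrite /= (jproj_jet oU Sg)//; exact: AU.
pose c1 s j := coef L g s [:: j] x - \sum_p 'D_(ebase p) (coef L g s [:: p; j]) x
  + \sum_p \sum_q 'D_(ebase p) ('D_(ebase q) (coef L g s [:: p; q; j])) x.
pose c2 s k j := coef L g s [:: k; j] x - \sum_p 'D_(ebase p) (coef L g s [:: k; p; j]) x.
have T1 : \sum_(s < m) \sum_(j < n) (pull (sdy s [:: j] L) (jet_at 5 g x)
       - \sum_(p < n) pull (fd p (sdy s [:: p; j] L)) (jet_at 5 g x)
       + \sum_(p < n) \sum_(q < n) fd p (fd q (sdy s [:: p; q; j] L)) (jet_at 5 g x))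
      * wedge1 (contact_form s [::] (jet_at 5 g x)) (omega1 j) v =
    \sum_i \sum_j \sum_s c1 s j * xi i s x * W i j.
  rewrite [LHS]exchange_big [RHS]exchange_big; apply: eq_bigr => j _ /=; rewrite [RHS]exchange_big.
  apply: eq_bigr => s _; rewrite WE// mulr_sumr; apply: eq_bigr => i _ /=; rewrite mulrA.
  congr (_ * _ * _); rewrite P0 /c1; congr (_ - _ + _); first by apply: eq_bigr => p _.
  by apply: eq_bigr => p _; apply: eq_bigr => q _.
have T2 : \sum_(s < m) \sum_(k < n) \sum_(j < n) (pull (sdy s [:: k; j] L) (jet_at 5 g x)
       - \sum_(p < n) pull (fd p (sdy s [:: k; p; j] L)) (jet_at 5 g x))
      * wedge1 (contact_form s [:: k] (jet_at 5 g x)) (omega1 j) v =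
    \sum_i \sum_j \sum_s (\sum_k c2 s k j * 'D_(ebase k) (xi i s) x) * W i j.
  transitivity (\sum_(s < m) \sum_(j < n) \sum_(i < n) (\sum_k c2 s k j * 'D_(ebase k) (xi i s) x) * W i j).
    apply: eq_bigr => s _; rewrite [LHS]exchange_big; apply: eq_bigr => j _ /=.
    transitivity (\sum_(k < n) \sum_(i < n) c2 s k j * 'D_(ebase k) (xi i s) x * W i j).
      apply: eq_bigr => k _; rewrite WE// mulr_sumr; apply: eq_bigr => i _ /=; rewrite mulrA.
      by congr (_ * _ * _); rewrite P0 /c2; congr (_ - _); apply: eq_bigr => p _.
    by rewrite [LHS]exchange_big; apply: eq_bigr => i _ /=; rewrite mulr_suml.
  rewrite [LHS]exchange_big [RHS]exchange_big; apply: eq_bigr => j _ /=.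
  by rewrite [LHS]exchange_big.
have T3 : \sum_(s < m) \sum_(k < n) \sum_(l < n) \sum_(j < n) pull (sdy s [:: k; l; j] L) (jet_at 5 g x)
      * wedge1 (contact_form s [:: k; l] (jet_at 5 g x)) (omega1 j) v =
    \sum_i \sum_j \sum_s (\sum_k \sum_l coef L g s [:: k; l; j] x *
       'D_(ebase k) ('D_(ebase l) (xi i s)) x) * W i j.
  transitivity (\sum_(s < m) \sum_(j < n) \sum_(i < n) (\sum_k \sum_l coef L g s [:: k; l; j] x *
       'D_(ebase k) ('D_(ebase l) (xi i s)) x) * W i j).
    apply: eq_bigr => s _.
    transitivity (\sum_(k < n) \sum_(j < n) \sum_(l < n) \sum_(i < n) coef L g s [:: k; l; j] x *
       'D_(ebase k) ('D_(ebase l) (xi i s)) x * W i j).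
      apply: eq_bigr => k _; rewrite [LHS]exchange_big; apply: eq_bigr => j _ /=; apply: eq_bigr => l _.
      by rewrite WE// mulr_sumr; apply: eq_bigr => i _ /=; rewrite mulrA P0.
    rewrite [LHS]exchange_big; apply: eq_bigr => j _ /=.
    transitivity (\sum_(k < n) \sum_(i < n) \sum_(l < n) coef L g s [:: k; l; j] x *
       'D_(ebase k) ('D_(ebase l) (xi i s)) x * W i j).
      by apply: eq_bigr => k _; rewrite [LHS]exchange_big.
    rewrite [LHS]exchange_big; apply: eq_bigr => i _ /=; rewrite mulr_suml.
    by apply: eq_bigr => k _; rewrite mulr_suml.
  rewrite [LHS]exchange_big [RHS]exchange_big; apply: eq_bigr => j _ /=.
  by rewrite [LHS]exchange_big.
rewrite /Theta T1 T2 T3 P0 -!addrA; congr (_ + _).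
rewrite -!big_split; apply: eq_bigr => i _ /=; rewrite -!big_split; apply: eq_bigr => j _ /=.
rewrite -!big_split -/(W i j) /lagmom mulr_suml; apply: eq_bigr => s _ /=.
by rewrite /momentum !mulrDl addrA.
Qed.

(** Subtracting horizontal lifts leaves a vertical vector, which is the jet of a
    polynomial variation. *)
Lemma lift_decomposition r (z : jsp r.+1) (v : jsp r) : exists xi : 'I_m -> fn,
  (forall s, sm setT (xi s)) /\
  v = \sum_p xc v p *: htot p z + vjet r xi (lsubmx (jbase z)).
Proof.
have [|xi [Sxi E]] := @taylor_vjet R n m r (v - \sum_p xc v p *: htot p z) (lsubmx (jbase z)).
  move=> i; rewrite xcD xcN xc_sum (@sum_single _ _ _ i) ?xcZ ?xc_jmk ?eqxx ?mulr1 ?subrr//.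
  by move=> p pi; rewrite xcZ xc_jmk eq_sym (negPf pi) mulr0.
by exists xi; split => //; rewrite E addrC subrK.
Qed.

End ThetaAlong.

Section ThetaPullback.
Context {R : realType} {n m : nat}.
Local Notation jsp r := (jspace R n m r).
Local Notation fn := ('rV[R]_n -> R).
Variables (O O' : set 'rV[R]_(n + m)) (X X' : set 'rV[R]_n) (phi phi' : 'rV[R]_n -> 'rV[R]_n).
Variable (psi : 'I_m -> 'rV[R]_(n + m) -> R).
Hypotheses (oO : open O) (oO' : open O') (oX : open X) (oX' : open X').
Hypotheses (Sphi : smv X phi) (Sphi' : smv X' phi').
Hypotheses (phiX : forall x, X x -> X' (phi x)) (phiK : forall x, X x -> phi' (phi x) = x).
Hypotheses (Spsi : forall t, sm O (psi t)) (OX : forall u, O u -> X (lsubmx u)).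
Hypothesis (OO' : forall u, O u -> O' (row_mx (phi (lsubmx u)) (\row_t psi t u))).
Hypothesis phi'K : forall x', X' x' -> phi (phi' x') = x'.
Variables (L L' : jsp 3 -> R).
Hypotheses (SL : sm [set z | O (jbase z)] L) (SL' : sm [set z | O' (jbase z)] L').
Hypothesis Llaw : forall z, O (jbase z) ->
  L z = jacdet phi (lsubmx (jbase z)) * L' (Prol phi phi' psi z).

Section Along.
Variables (U : set 'rV[R]_n) (oU : open U) (g : 'I_m -> fn) (Sg : forall s, sm U (g s)).
Hypothesis gO : forall x, U x -> O (graph g x).
Local Notation gb := (gbar phi' psi g).

Let UX x : U x -> X x.
Proof. by move=> /gO/OX; rewrite /graph row_mxKl. Qed.

(** The tangent map of the prolonged transformation sends horizontal lifts to
    combinations of horizontal lifts and jets of variations to jets of their images,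
    so [Theta_along] applies in the barred coordinates too. *)
Lemma pullback_Theta_along (xi : 'I_n -> 'I_m -> fn) x (v : 'I_n -> jsp 5) : U x ->
  (forall i s, sm setT (xi i s)) ->
  (forall i, v i = \sum_p xc (v i) p *: htot p (jet_at 6 g x) + vjet 5 (xi i) x) ->
  pullback (@Prol R n m phi phi' psi 5) (Theta L') (jet_at 5 g x) v =
  L (jet_at 3 g x) * omega0 v + \sum_i \sum_j (jacdet phi x * \sum_b jaci phi phi' j b x
      * lagmom L' gb (xibar phi' psi g (xi i)) b (phi x))
    * ((-1) ^+ i * omega1 j (fun i' => v (lift i i'))).
Proof.
move=> Ux SxiT vE; have Xx := UX Ux.
have Sxi i s : sm U (xi i s) by apply: sm_sub (SxiT i s).
pose v' i : jsp 5 := 'D_(v i) (@Prol R n m phi phi' psi 5) (jet_at 5 g x).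
have Az : [set z : jsp 5 | O (jbase z)] (jet_at 5 g x) by rewrite /= jbase_jet; exact: gO.
have dP := smv_diff (smv_Prol oO oX Sphi Sphi' phiX Spsi OX (r := 5)) Az.
have oUb := open_Ubar oX' Sphi' oU.
have Uxb := phi_Ubar phiX phiK OX gO Ux.
have Sgb := sm_gbar oX' Sphi' Spsi oU Sg gO.
have Sxb i := sm_xibar oX' Sphi' Spsi oU Sg gO (Sxi i).
have v'E0 i : v' i = \sum_a (\sum_p jac phi a p x * xc (v i) p) *: htot a (jet_at 6 gb (phi x))
    + vjet 5 (xibar phi' psi g (xi i)) (phi x).
  rewrite /v' {1}vE (deriveE _ dP) linearD linear_sum /=; congr (_ + _); last first.
    rewrite -(deriveE _ dP).
    exact: (D_Prol_vjet oO oX oX' Sphi Sphi' phiX phiK Spsi OX oU Sg gO (Sxi i) _ Ux).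
  transitivity (\sum_p \sum_a (jac phi a p x * xc (v i) p) *: htot a (jet_at 6 gb (phi x))).
    apply: eq_bigr => p _; rewrite linearZ /= -(deriveE _ dP).
    rewrite (D_Prol_htot oO oX oX' Sphi Sphi' phiX phiK Spsi OX oU Sg gO _ _ Ux) scaler_sumr.
    by apply: eq_bigr => a _; rewrite scalerA mulrC.
  by rewrite exchange_big; apply: eq_bigr => a _ /=; rewrite scaler_suml.
have xv' i a : xc (v' i) a = \sum_p jac phi a p x * xc (v i) p.
  rewrite v'E0 xcD xc_jmk addr0 xc_sum (@sum_single _ _ _ a); first by rewrite xcZ xc_jmk eqxx mulr1.
  by move=> b ba; rewrite xcZ xc_jmk eq_sym (negPf ba) mulr0.
have v'E i : v' i = \sum_a xc (v' i) a *: htot a (jet_at 6 gb (phi x))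
    + vjet 5 (xibar phi' psi g (xi i)) (phi x).
  by rewrite {1}v'E0; congr (_ + _); apply: eq_bigr => a _; rewrite xv'.
have AUb y : Ubar X' phi' U y -> [set z : jsp 3 | O' (jbase z)] (jet_at 3 gb y).
  move=> Uy; rewrite /= jbase_jet; apply: (gbar_O' OO' gO Uy); apply: phi'K; by case: Uy.
have := @Theta_along R n m L' _ _ gb (fun i => xibar phi' psi g (xi i)) (phi x) v'
  (open_jbase oO') SL' oUb Uxb Sgb AUb Sxb v'E.
rewrite -(Prol_jet oO oX oX' Sphi Sphi' phiX phiK Spsi OX oU Sg gO _ Ux).
rewrite -(Prol_jet oO oX oX' Sphi Sphi' phiX phiK Spsi OX oU Sg gO _ Ux) => TE.
rewrite /pullback; apply: (etrans TE).
pose Jm : 'M[R]_n := \matrix_(a, p) jac phi a p x.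
pose Ji : 'M[R]_n := \matrix_(p, a) jaci phi phi' p a x.
have SphiU : smv U phi by move=> i; apply: sm_sub (Sphi i); exact: UX.
have JK : Jm *m Ji = 1%:M.
  apply/matrixP => a b; rewrite !mxE.
  rewrite -(jacKi oX Sphi Sphi' phiX phiK a b Xx); apply: eq_bigr => p _.
  by rewrite !mxE.
have xvJ i a : xc (v' i) a = \sum_p Jm a p * xc (v i) p.
  by rewrite xv'; apply: eq_bigr => p _; rewrite mxE.
rewrite (omega0_law (v := v) (M := Jm) xvJ).
have -> : L (jet_at 3 g x) = \det Jm * L' (Prol phi phi' psi (jet_at 3 g x)).
  by rewrite Llaw jbase_jet; [rewrite /graph row_mxKl|exact: gO].
congr (_ + _); first by rewrite mulrCA mulrA.
apply: eq_bigr => i _.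
transitivity (\sum_b lagmom L' gb (xibar phi' psi g (xi i)) b (phi x) *
   ((-1) ^+ i * (\det Jm * \sum_p Ji p b * omega1 p (fun i' => v (lift i i'))))).
  apply: eq_bigr => b _; congr (_ * (_ * _)).
  exact: (omega1_law JK b (fun k => xvJ (lift i k))).
transitivity (\sum_b \sum_p \det Jm * (Ji p b * lagmom L' gb (xibar phi' psi g (xi i)) b (phi x)) *
   ((-1) ^+ i * omega1 p (fun i' => v (lift i i')))).
  apply: eq_bigr => b _; rewrite !mulr_sumr; apply: eq_bigr => p _ /=; ring.
rewrite exchange_big; apply: eq_bigr => p _ /=; rewrite -mulr_suml -mulr_sumr.
by congr (_ * _ * _); apply: eq_bigr => b _; rewrite mxE.
Qed.

(** Evaluate on the jet of xi in position j and on horizontal lifts in all others: the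
    only form omega1 that does not vanish on the latter is the j-th one, and the sign
    of its value cancels that of the wedge product. *)
Lemma momenta_of_Theta xi j x : U x -> (forall s, sm setT (xi s)) ->
  pullback (@Prol R n m phi phi' psi 5) (Theta L') (jet_at 5 g x) = Theta L (jet_at 5 g x) ->
  lagmom L g xi j x = jacdet phi x * \sum_b jaci phi phi' j b x
      * lagmom L' gb (xibar phi' psi g xi) b (phi x).
Proof.
move=> Ux Sxi H.
pose v (i : 'I_n) : jsp 5 := if i == j then vjet 5 xi x else htot i (jet_at 6 g x).
pose xis (i : 'I_n) : 'I_m -> fn := if i == j then xi else fun _ _ => 0.
have Sxis i s : sm setT (xis i s) by rewrite /xis; case: eqP => _ //; exact: sm_cst.
have xcv i p : xc (v i) p = ((i != j) && (p == i))%:R.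
  by rewrite /v; case: eqP => _ /=; rewrite xc_jmk.
have vE i : v i = \sum_p xc (v i) p *: htot p (jet_at 6 g x) + vjet 5 (xis i) x.
  have [ij|ij] := eqVneq i j.
    rewrite big1 ?add0r /v /xis ?ij ?eqxx// => p _.
    by rewrite xc_jmk scale0r.
  rewrite (@sum_single _ _ _ i) => [|p pi]; rewrite xcv ij /=.
    by rewrite eqxx scale1r /v /xis (negPf ij) vjet0 addr0.
  by rewrite (negPf pi) scale0r.
have := congr1 (fun F => F v) H.
rewrite (pullback_Theta_along Ux Sxis vE).
have AU y : U y -> [set z : jsp 3 | O (jbase z)] (jet_at 3 g y).
  by move=> Uy; rewrite /= jbase_jet; exact: gO.
rewrite (Theta_along (open_jbase oO) SL oU Ux Sg AU (fun i s => sm_sub (fun _ _ => I) (Sxis i s)) vE).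
move/addrI => E; apply/esym; move: E.
pose W (i j' : 'I_n) : R := (-1) ^+ i * omega1 j' (fun i' => v (lift i i')).
have WE i j' : W i j' = ((i == j) && (j' == j))%:R.
  rewrite /W; have [->|ij] := eqVneq i j.
    rewrite (@omega1_basis R n m 5 j) => [|k p].
      by rewrite mulrCA -exprD addnn -mul2n exprM sqrrN !expr1n mulr1.
    by rewrite xcv eq_sym neq_lift.
  have [k Ek] : exists k, j = lift i k.
    by case: (unliftP i j) => [k E|E]; [exists k|rewrite E eqxx in ij].
  by rewrite (@omega1_vertical R n m 5 j' _ k) ?mulr0// => p; rewrite -Ek xcv eqxx.
have collapse (F : 'I_n -> 'I_n -> R) : \sum_i \sum_j' F i j' * W i j' = F j j.
  rewrite (@sum_single _ _ _ j) => [|i ij].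
    rewrite (@sum_single _ _ _ j) => [|i ij]; first by rewrite WE eqxx mulr1.
    by rewrite WE (negPf ij) andbF mulr0.
  by apply: big1 => j' _; rewrite WE (negPf ij) mulr0.
rewrite !(collapse (fun i j' => _)) /xis eqxx => ->; by [].
Qed.

End Along.

(** Every point of the fifth jet space is the jet of a section g, and every tangent vector
    there is a horizontal lift plus the jet of a variation; lifts need one more order,
    hence a representative of a sixth-order jet. *)
Lemma Theta_invariant : (forall i k : 'I_n, i = k) \/
    ((forall z s k l i, O (jbase z) -> sdy s [:: k; l; i] L z = 0) /\
     (forall z s k l i, O' (jbase z) -> sdy s [:: k; l; i] L' z = 0)) ->
  forall z : jsp 5, O (jbase z) ->
  pullback (@Prol R n m phi phi' psi 5) (Theta L') z = Theta L z.
Proof.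
move=> cases z Oz; apply: funext => v.
have [z6 z6E] : exists z6 : jsp 6, jproj 5 z6 = z.
  exists (jproj 6 z); rewrite -[RHS]jproj_id; apply: jspaceP => [i|s K].
    by rewrite !xc_jproj.
  by have sK := size_mseq K; rewrite !yc_jproj// (leq_trans sK).
have [g [SgT gE]] := taylor_jet z6.
set x := lsubmx (jbase z6) in gE.
pose U := [set y | O (graph g y)].
have Sgr : smv setT (graph g) by exact: (smv_graph openT SgT).
have oU : open U by apply: (open_comp _ oO) => y _; exact: (smv_cont Sgr (I : setT y)).
have Sg s : sm U (g s) by apply: sm_sub (SgT s).
have zE : jet_at 5 g x = z by rewrite -z6E -gE (jproj_jet openT SgT).
have Ux : U x by move: Oz; rewrite -zE jbase_jet.
have [xi Hxi] : exists xi : 'I_n -> 'I_m -> fn, forall i, (forall s, sm setT (xi i s)) /\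
    v i = \sum_p xc (v i) p *: htot p z6 + vjet 5 (xi i) x.
  exists (fun i => sval (cid (lift_decomposition z6 (v i)))) => i.
  exact: (svalP (cid (lift_decomposition z6 (v i)))).
have Sxi i s : sm setT (xi i s) by have [] := Hxi i.
have vE i : v i = \sum_p xc (v i) p *: htot p (jet_at 6 g x) + vjet 5 (xi i) x.
  by have [_] := Hxi i; rewrite gE.
have gO y : U y -> O (graph g y) by [].
rewrite -zE (pullback_Theta_along oU Sg gO Ux Sxi vE).
rewrite (@Theta_along R n m L [set z | O (jbase z)] U g xi x v); first last.
- exact: vE.
- by move=> i s; apply: sm_sub (Sxi i s).
- by move=> y Uy; rewrite /= jbase_jet.
- exact: Sg.
- exact: Ux.
- exact: oU.
- exact: SL.
- exact: open_jbase.
congr (_ + _); apply: eq_bigr => i _; apply: eq_bigr => j _; congr (_ * _).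
apply/esym.
exact: (lagmom_invariant oO oO' oX oX' Sphi Sphi' phiX phiK Spsi OX OO' oU Sg gO SL SL' Llaw phi'K
  j (Sxi i) Ux cases).
Qed.

End ThetaPullback.

(** * Horizontal forms *)

Section HorizontalForms.
Context {R : realType} {n m r : nat}.
Local Notation jsp := (jspace R n m r).
Implicit Types (a b : covec R n m r n) (v : 'I_n -> jsp).

Lemma multilinear_sum a v i (I : Type) (l : seq I) (c : I -> R) (u : I -> jsp) w :
  multilinear a -> a [eta v with i |-> \sum_(k <- l) c k *: u k + w] =
  \sum_(k <- l) c k * a [eta v with i |-> u k] + a [eta v with i |-> w].
Proof.
move=> aM; elim: l => [|k l IH]; first by rewrite !big_nil !add0r.
by rewrite !big_cons -addrA aM IH addrA.
Qed.

Lemma eta_id v i : ([eta v with i |-> v i] : 'I_n -> jsp) = v.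
Proof. by apply: funext => j /=; case: eqP => [->|]. Qed.

Lemma vertical_split (u : jsp) :
  u = \sum_i xc u i *: dx r i + (u - \sum_i xc u i *: dx r i).
Proof. by rewrite addrC subrK. Qed.

Lemma xc_vertical_part (u : jsp) i : xc (u - \sum_k xc u k *: dx r k) i = 0.
Proof.
rewrite xcD xcN xc_sum (@sum_single _ _ _ i) ?xcZ ?xc_dx ?eqxx ?mulr1 ?subrr//.
by move=> k ki; rewrite xcZ xc_dx eq_sym (negPf ki) mulr0.
Qed.

(** Replace the arguments one at a time by their expansions in the dx r i; the
    remainders are vertical and do not contribute. *)
Lemma multilinear_ext a b : multilinear a -> multilinear b ->
  (forall v i, (forall k, xc (v i) k = 0) -> a v = 0) ->
  (forall v i, (forall k, xc (v i) k = 0) -> b v = 0) ->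
  (forall f : 'I_n -> 'I_n, a (fun j => dx r (f j)) = b (fun j => dx r (f j))) ->
  forall v, a v = b v.
Proof.
move=> aM bM a0 b0 ab.
suff H k : (k <= n)%N -> forall v, (forall j : 'I_n, (k <= j)%N -> exists i, v j = dx r i) -> a v = b v.
  by move=> v; apply: (H n) => // j; rewrite leqNgt ltn_ord.
elim: k => [_|k IH kn] v Hv.
  have Hv' j := Hv j (leq0n j).
  have -> : v = fun j => dx r (sval (cid (Hv' j))).
    by apply: funext => j; exact: (svalP (cid (Hv' j))).
  exact: ab.
pose j := Ordinal kn.
rewrite -(eta_id v j) (vertical_split (v j)) !multilinear_sum//.
rewrite (a0 _ j) 1?(b0 _ j) ?addr0; [|by move=> i /=; rewrite eqxx xc_vertical_part..].
apply: eq_bigr => i _; congr (_ * _); apply: IH; first exact: ltnW.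
move=> j' kj' /=; case: eqVneq => [_|j'j]; first by exists i.
by apply: Hv; rewrite ltn_neqAle kj' andbT eq_sym.
Qed.

Lemma alternating_swap a v i j : multilinear a -> alternating a -> i != j ->
  a (fun k => v (tperm i j k)) = - a v.
Proof.
move=> aM aA ij.
pose w (x y : jsp) : 'I_n -> jsp := [eta [eta v with i |-> x] with j |-> y].
have wi x y : w x y i = x by rewrite /w /= (negPf ij) eqxx.
have wj x y : w x y j = y by rewrite /w /= eqxx.
have wC x y : w x y = [eta [eta v with j |-> y] with i |-> x] :> ('I_n -> jsp).
  apply: funext => k; rewrite /w /=; case: (eqVneq k j) => [->|//].
  by rewrite eq_sym (negPf ij).
have A0 x : a (w x x) = 0 by apply: (aA _ i j ij); rewrite wi wj.
have D1 x x' y : a (w (x + x') y) = a (w x y) + a (w x' y).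
  by rewrite !wC -[x]scale1r aM mul1r scale1r.
have D2 x y y' : a (w x (y + y')) = a (w x y) + a (w x y').
  by rewrite /w -[y]scale1r aM mul1r scale1r.
have := A0 (v i + v j); rewrite D1 !D2 !A0.
have -> : w (v i) (v j) = v by rewrite /w eta_id; apply: funext => k /=; case: eqP => [->|].
have -> : w (v j) (v i) = fun k => v (tperm i j k).
  apply: funext => k; rewrite /w /=; case: tpermP => [->|->|/eqP/negPf -> /eqP/negPf ->//].
    by rewrite (negPf ij) eqxx.
  by rewrite eqxx.
by move=> H; lra.
Qed.

Lemma omega0_rows v : omega0 v = \det (\matrix_(i, j) xc (v i) j).
Proof.
by rewrite /omega0 -det_tr; congr (\det _); apply/matrixP => i j; rewrite !mxE.
Qed.

Lemma omega0_multilinear : multilinear (@omega0 R n m r).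
Proof.
move=> v i t u w; rewrite !omega0_rows -[X in _ = _ + X]mul1r.
apply: (@determinant_multilinear _ _ _ _ _ i t 1).
- apply/rowP => k; rewrite !mxE /= eqxx xcD xcZ mul1r //.
- by apply/matrixP => k l; rewrite !mxE /= eq_sym (negPf (neq_lift _ _)).
- by apply/matrixP => k l; rewrite !mxE /= eq_sym (negPf (neq_lift _ _)).
Qed.

Lemma omega0_alternating : alternating (@omega0 R n m r).
Proof.
move=> v i j ij vij; rewrite omega0_rows; apply: (determinant_alternate ij) => k.
by rewrite !mxE vij.
Qed.

Lemma omega0_dx : omega0 (fun i => dx r i : jsp) = 1.
Proof.
rewrite /omega0 (_ : (\matrix_(i, j) _) = 1%:M) ?det1//.
by apply/matrixP => i j; rewrite !mxE xc_dx.
Qed.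

(** Both sides are alternating and vanish on vertical arguments, so it suffices to
    compare them on permutations of the coordinate vectors. *)
Lemma horizontal_form a v : multilinear a -> alternating a ->
  (forall v i, (forall k, xc (v i) k = 0) -> a v = 0) ->
  a v = a (fun i => dx r i) * omega0 v.
Proof.
move=> aM aA a0; pose b : covec R n m r n := fun v => a (fun i => dx r i) * omega0 v.
have bM : multilinear b.
  by move=> w i t u u'; rewrite /b omega0_multilinear; ring.
apply: (multilinear_ext aM bM a0) => [w i wi|f].
  rewrite /b /omega0 (expand_det_col _ i) big1 ?mulr0// => k _.
  by rewrite mxE wi mul0r.
have [/injectiveP fi|/injectivePn [i [j ij fij]]] := boolP (injectiveb f); last first.
  rewrite (aA _ i j ij) ?fij// /b (omega0_alternating (i := i) (j := j)) ?mulr0//.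
  by rewrite fij.
pose s := perm fi.
have -> : (fun j => dx r (f j) : jsp) = fun j => dx r (s j).
  by apply: funext => j; rewrite permE.
clearbody s; have [l [_ ->]] : exists l : seq ('I_n * 'I_n), all dpair l /\ s = (\prod_(t <- l) tperm t.1 t.2)%g.
  by have [l -> dl] := prod_tpermP s; exists l.
elim: l => [|[i j] l IH].
  rewrite big_nil /b (_ : (fun j => _) = fun j => dx r j) ?omega0_dx ?mulr1//.
  by apply: funext => j; rewrite perm1.
rewrite big_cons /=; have [->|ij] := eqVneq i j; first by rewrite tperm1 mul1g.
set p := (\prod_(t <- l) tperm t.1 t.2)%g in IH *.
have -> : (fun k => dx r ((tperm i j * p)%g k) : jsp) = fun k => (fun k => dx r (p k)) (tperm i j k).
  by apply: funext => k; rewrite permM.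
rewrite (alternating_swap (fun k => dx r (p k)) aM aA ij) IH /b.
by rewrite (alternating_swap (fun k => dx r (p k)) omega0_multilinear omega0_alternating ij) mulrN.
Qed.

End HorizontalForms.

(** * Fibred charts *)

Section Charts.
Context {R : realType}.

Section OneManifold.
Variables (N : nat) (M : topologicalType) (A : manifold R N M).
Implicit Types (c : chart R N M) (S : set M).

Lemma within_open_comp (T T' : topologicalType) (D : set T) (f : T -> T') (S : set T') :
  open D -> {within D, continuous f} -> open S -> open (D `&` f @^-1` S).
Proof.
move=> oD cf oS; rewrite openE => x [Dx Sx].
have cx : {for x, continuous f}.
  by move: cf; rewrite (continuous_open_subspace f oD) => cf; exact/cf/mem_set.
apply: (@filterI _ _ (nbhs_filter x)); first exact: (open_nbhs_nbhs (conj oD Dx)).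
exact: (cx _ (open_nbhs_nbhs (conj oS Sx))).
Qed.

(** The image is the preimage under the continuous inverse. *)
Lemma open_image c S : chart_valid c -> S `<=` cdom c -> open S -> open (cmap c @` S).
Proof.
move=> [oD oR cm ci K] SD oS.
rewrite (_ : cmap c @` S = crange c `&` cinv c @^-1` S); first exact: within_open_comp.
apply/seteqP; split=> [u [y Sy <-]|u [[y Dy <-]] /=].
  by split; [exists y => //; exact: SD|rewrite /= K//; exact: SD].
by rewrite K// => Sy; exists y.
Qed.

Lemma trans_cmap c c' y : chart_valid c -> cdom c y -> trans c c' (cmap c y) = cmap c' y.
Proof. by move=> [_ _ _ _ K] Dy; rewrite /trans /= K. Qed.

Lemma smv_trans c c' : atlas A c -> atlas A c' ->
  smv (cmap c @` (cdom c `&` cdom c')) (trans c c').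
Proof.
move=> ac ac'; apply/smooth_onvP; last exact: (atlas_compatible ac ac').1.
apply: open_image; first exact: (atlas_valid ac).
  by move=> y [].
apply: openI; first by case: (atlas_valid ac).
by case: (atlas_valid ac').
Qed.

End OneManifold.

Section FiberedCharts.
Variables (n m : nat) (X Y : topologicalType).
Variables (MX : manifold R n X) (MY : manifold R (n + m) Y) (pi : Y -> X).
Local Notation fch := (fchart MX MY pi).
Local Notation jsp r := (jspace R n m r).
Local Notation fn := ('rV[R]_n -> R).
Implicit Types (c : fch).

Lemma tot_valid c : chart_valid (ftot c). Proof. exact: atlas_valid (ftot_atlas c). Qed.
Lemma base_valid c : chart_valid (fbase c). Proof. exact: atlas_valid (fbase_atlas c). Qed.

Definition tot_overlap c c' : set 'rV[R]_(n + m) := cmap (ftot c) @` (fdom c `&` fdom c').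
Definition base_overlap c c' : set 'rV[R]_n :=
  cmap (fbase c) @` (cdom (fbase c) `&` cdom (fbase c')).
(** The fibre components of the change of total coordinates; its base components are
    those of [xtrans] by [ytransE]. *)
Definition fibre_trans c c' (t : 'I_m) (u : 'rV[R]_(n + m)) : R :=
  ytrans c c' u 0 (rshift n t).

Lemma open_fdom c : open (fdom c). Proof. by case: (tot_valid c). Qed.
Lemma open_bdom c : open (cdom (fbase c)). Proof. by case: (base_valid c). Qed.

Lemma pi_dom c y : fdom c y -> cdom (fbase c) (pi y).
Proof. by move=> Dy; rewrite fbase_dom; exists y. Qed.

Lemma open_tot_overlap c c' : open (tot_overlap c c').
Proof.
apply: (open_image (tot_valid c)); first by move=> y [].
by apply: openI; exact: open_fdom.
Qed.

Lemma open_base_overlap c c' : open (base_overlap c c').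
Proof.
apply: (open_image (base_valid c)); first by move=> y [].
by apply: openI; exact: open_bdom.
Qed.

Lemma smv_xtrans c c' : smv (base_overlap c c') (xtrans c c').
Proof. exact: (smv_trans (fbase_atlas c) (fbase_atlas c')). Qed.

Lemma smv_ytrans c c' : smv (tot_overlap c c') (ytrans c c').
Proof. exact: (smv_trans (ftot_atlas c) (ftot_atlas c')). Qed.

Lemma sm_fibre_trans c c' t : sm (tot_overlap c c') (fibre_trans c c' t).
Proof. exact: smv_ytrans. Qed.

Lemma base_overlap_xtrans c c' x : base_overlap c c' x -> base_overlap c' c (xtrans c c' x).
Proof.
move=> [p [Dp Dp'] <-]; rewrite /xtrans (trans_cmap _ (base_valid c))//.
by exists p.
Qed.

Lemma xtransK c c' x : base_overlap c c' x -> xtrans c' c (xtrans c c' x) = x.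
Proof.
move=> [p [Dp Dp'] <-]; rewrite /xtrans (trans_cmap _ (base_valid c))//.
by rewrite (trans_cmap _ (base_valid c')).
Qed.

Lemma tot_overlap_base c c' u : tot_overlap c c' u -> base_overlap c c' (lsubmx u).
Proof.
move=> [y [Dy Dy'] <-]; exists (pi y); first by split; exact: pi_dom.
by rewrite fchart_fibered.
Qed.

Lemma ytransE c c' u : tot_overlap c c' u ->
  row_mx (xtrans c c' (lsubmx u)) (\row_t fibre_trans c c' t u) = ytrans c c' u.
Proof.
move=> [y [Dy Dy'] <-]; rewrite -[RHS]hsubmxK; congr row_mx.
  rewrite fchart_fibered// /xtrans /ytrans (trans_cmap _ (base_valid c)); last exact: pi_dom.
  by rewrite (trans_cmap _ (tot_valid c))// fchart_fibered.
by apply/rowP => t; rewrite !mxE.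
Qed.

Lemma tot_overlap_ytrans c c' u : tot_overlap c c' u -> tot_overlap c' c (ytrans c c' u).
Proof.
move=> [y [Dy Dy'] <-]; rewrite /ytrans (trans_cmap _ (tot_valid c))//.
by exists y.
Qed.

Lemma tot_overlap_row c c' u : tot_overlap c c' u ->
  tot_overlap c' c (row_mx (xtrans c c' (lsubmx u)) (\row_t fibre_trans c c' t u)).
Proof. by move=> Ou; rewrite ytransE//; exact: tot_overlap_ytrans. Qed.

Section Sections.
Variables (U : set X) (g : X -> Y).
Hypotheses (oU : open U) (gS : smooth_map MX MY U g) (gK : forall x, U x -> pi (g x) = x).

(** The base coordinates at which the section g meets the domain of the chart c. *)
Definition section_dom c : set 'rV[R]_n :=
  cmap (fbase c) @` (U `&` cdom (fbase c) `&` g @^-1` fdom c).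
Definition components c (s : 'I_m) : fn :=
  fun u => cmap (ftot c) (g (cinv (fbase c) u)) 0 (rshift n s).

Lemma open_section_dom c : open (section_dom c).
Proof.
apply: (open_image (base_valid c)); first by move=> x [[]].
rewrite (_ : _ `&` _ = cdom (fbase c) `&` (U `&` g @^-1` fdom c)).
  apply: openI; first exact: open_bdom.
  apply: within_open_comp oU gS.1 (open_fdom c).
by rewrite setIA [U `&` _]setIC.
Qed.

Lemma sm_components c s : sm (section_dom c) (components c s).
Proof.
have := gS.2 (fbase c) (ftot c) (fbase_atlas c) (ftot_atlas c).
by move/(smooth_onvP _ (@open_section_dom c)); apply.
Qed.

Lemma graph_components c x : U x -> fdom c (g x) ->
  graph (components c) (cmap (fbase c) x) = cmap (ftot c) (g x).
Proof.
move=> Ux Dx; have Dp : cdom (fbase c) x by rewrite -(gK Ux); exact: pi_dom.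
have K : cinv (fbase c) (cmap (fbase c) x) = x by case: (base_valid c) => _ _ _ _; apply.
rewrite /graph /components -[RHS]hsubmxK; congr row_mx.
  by rewrite fchart_fibered// gK.
by apply/rowP => t; rewrite !mxE K.
Qed.

(** In another chart the components of g are those obtained from the chart c by the
    fibred transformation, at least near x, which determines all derivatives. *)
Lemma jet_components_trans r c c' x : U x -> fdom c (g x) -> fdom c' (g x) ->
  jet_at r (components c') (cmap (fbase c') x) =
  Prol (xtrans c c') (xtrans c' c) (fibre_trans c c')
    (jet_at r (components c) (cmap (fbase c) x)).
Proof.
move=> Ux Dx Dx'.
pose V := cmap (fbase c) @` (U `&` cdom (fbase c) `&` g @^-1` (fdom c `&` fdom c')).
have bd (d : fch) y : U y -> fdom d (g y) -> cdom (fbase d) y.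
  by move=> Uy Dy; rewrite -(gK Uy); exact: pi_dom.
have oV : open V.
  apply: (open_image (base_valid c)); first by move=> y [[]].
  rewrite (_ : _ `&` _ = cdom (fbase c) `&` (U `&` g @^-1` (fdom c `&` fdom c'))).
    apply: openI; first exact: open_bdom.
    by apply: within_open_comp oU gS.1 _; apply: openI; exact: open_fdom.
  by rewrite setIA [U `&` _]setIC.
have Vx : V (cmap (fbase c) x) by exists x => //; split=> //; split=> //; exact: bd Dx.
have SV s : sm V (components c s).
  by apply: sm_sub (@sm_components c s) => y [p [[Up Dp] [Dg _]] <-]; exists p.
have gO y : V y -> tot_overlap c c' (graph (components c) y).
  by move=> [p [[Up Dp] [Dg Dg']] <-]; rewrite graph_components//; exists (g p).
rewrite (Prol_jet (@open_tot_overlap c c') (@open_base_overlap c c') (@open_base_overlap c' c)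
  (@smv_xtrans c c') (@smv_xtrans c' c) (@base_overlap_xtrans c c') (@xtransK c c')
  (@sm_fibre_trans c c') (@tot_overlap_base c c') oV SV gO _ Vx).
have -> : xtrans c c' (cmap (fbase c) x) = cmap (fbase c') x.
  by rewrite /xtrans (trans_cmap _ (base_valid c))//; exact: bd Dx.
have oV' := open_Ubar (@open_base_overlap c' c) (@smv_xtrans c' c) oV.
have Vx' : Ubar (base_overlap c' c) (xtrans c' c) V (cmap (fbase c') x).
  split; first by exists x => //; split; [exact: bd Dx'|exact: bd Dx].
  by rewrite /xtrans (trans_cmap _ (base_valid c')) //; exact: bd Dx'.
apply: jspaceP => [i|t K]; first by rewrite !xc_jmk.
rewrite !yc_jmk_mseq; apply: (ddr_eq_on _ oV' Vx') => _ [[p [Dp' Dp] <-]].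
rewrite /xtrans (trans_cmap _ (base_valid c'))// => - [p' [[Up' Dp''] [Dg Dg']] E].
have E' : p' = p.
  by case: (base_valid c) => _ _ _ _ K'; rewrite -(K' _ Dp) -E K'.
rewrite -E' in Dp Dp' *.
rewrite /gbar /xtrans (trans_cmap _ (base_valid c'))// graph_components//.
rewrite /fibre_trans /ytrans (trans_cmap _ (tot_valid c))// /components.
by case: (base_valid c') => _ _ _ _ ->.
Qed.

End Sections.

End FiberedCharts.

End Charts.

(** * Jets in charts *)

Section JetCharts.
Context {R : realType} {n m : nat} {X Y : topologicalType}.
Variables (MX : manifold R n X) (MY : manifold R (n + m) Y) (pi : Y -> X).
Local Notation fch := (fchart MX MY pi).
Local Notation jsp r := (jspace R n m r).
Local Notation fn := ('rV[R]_n -> R).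
Local Notation Jt r := (Defs.jet MX MY pi r).
Local Notation jov r := (@joverlap R n m X Y MX MY pi r).
Local Notation jran r := (@jrange R n m X Y MX MY pi r).
Implicit Types (c : fch).

Lemma jrepP r (q : Jt r) : local_section MX MY pi (jrep q).1 (jrep q).2 /\
  jclass q = [set p | [/\ p.1 = (jrep q).1, local_section MX MY pi p.1 p.2 &
                          same_jet MX MY pi r (jrep q).1 (jrep q).2 p.2]].
Proof. exact: (svalP (cid (jet_rep q))). Qed.

Lemma jmapE r c (q : Jt r) :
  jmap c q = jet_at r (components (jrep q).2 c) (cmap (fbase c) (jrep q).1).
Proof. by []. Qed.

Lemma jbase_jmap r c (q : Jt r) : fdom c (jtarget q) ->
  jbase (jmap c q) = cmap (ftot c) (jtarget q).
Proof.
move=> Dq; have [[U [oU Ux gS gK]] _] := jrepP q.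
by rewrite jmapE jbase_jet (graph_components gK Ux Dq).
Qed.

Lemma jmap_trans r c c' (q : Jt r) : jpre (fdom c `&` fdom c') q ->
  jmap c' q = Prol (xtrans c c') (xtrans c' c) (fibre_trans c c') (jmap c q).
Proof.
move=> [Dq Dq']; have [[U [oU Ux gS gK]] _] := jrepP q.
by rewrite !jmapE (jet_components_trans oU gS gK r Ux Dq Dq').
Qed.

Lemma smv_graphT (g : 'I_m -> fn) : (forall s, sm setT (g s)) -> smv setT (graph g).
Proof. by move=> Sg; exact: (smv_graph openT Sg). Qed.

(** Components that are smooth everywhere define a section wherever its graph stays in
    the range of the chart. *)
Lemma local_sectionT c (g : 'I_m -> fn) y : fdom c y -> (forall s, sm setT (g s)) ->
  graph g (cmap (fbase c) (pi y)) = cmap (ftot c) y ->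
  let U := cdom (fbase c) `&`
    (fun x => graph g (cmap (fbase c) x)) @^-1` crange (ftot c) in
  let h := fun x => cinv (ftot c) (graph g (cmap (fbase c) x)) in
  [/\ open U, U (pi y), smooth_map MX MY U h & forall x, U x -> pi (h x) = x].
Proof.
move=> Dy Sg gy U h.
have [oT oRT cmT ciT KT] := tot_valid c; have [oB oRB cmB ciB KB] := base_valid c.
have cg : continuous (graph g) by move=> u; exact: (smv_cont (smv_graphT Sg) (I : setT u)).
have cw : {within cdom (fbase c), continuous (fun x => graph g (cmap (fbase c) x))}.
  by move=> x; apply: continuous_comp; [exact: cmB|exact: cg].
have oU : open U by exact: within_open_comp.
have DU x : U x -> fdom c (h x).
  by move=> [_ [y1 Dy1 E]]; rewrite /h -E KT.
have mU x : U x -> cmap (ftot c) (h x) = graph g (cmap (fbase c) x).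
  by move=> [_ [y1 Dy1 E]]; rewrite /h -E KT.
have hU x : U x -> pi (h x) = x.
  move=> Ux; have := fchart_fibered (DU x Ux); rewrite mU// row_mxKl => E.
  by rewrite -[RHS](KB x Ux.1) E KB//; exact: pi_dom (DU x Ux).
split=> //; first by split; [exact: pi_dom|rewrite /= gy; exists y].
have ch x : U x -> {for x, continuous h}.
  move=> Ux; have cx : {for x, continuous (fun x => graph g (cmap (fbase c) x))}.
    by move: cw; rewrite (continuous_open_subspace _ oB) => cw; apply/cw/mem_set; case: Ux.
  apply: (@continuous_comp _ _ _ (fun x => graph g (cmap (fbase c) x)) (cinv (ftot c)) x cx).
  by move: ciT; rewrite (continuous_open_subspace _ oRT) => ciT; apply/ciT/mem_set; case: Ux.
split.
  by rewrite (continuous_open_subspace _ oU) => x /set_mem; exact: ch.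
move=> c1 c2 a1 a2; set S := U `&` cdom c1 `&` h @^-1` cdom c2.
have v1 := atlas_valid a1.
have oS : open S.
  rewrite /S (_ : _ `&` _ = cdom c1 `&` (U `&` h @^-1` cdom c2)); last by rewrite setIA [U `&` _]setIC.
  apply: openI; first by case: v1.
  apply: within_open_comp => //; last by case: (atlas_valid a2).
  by rewrite (continuous_open_subspace _ oU) => x /set_mem; exact: ch.
have oI : open (cmap c1 @` S) by apply: (open_image v1) oS => x [[]].
apply/(smooth_onvP _ oI) => i.
have S1 : smv (cmap c1 @` S) (trans c1 (fbase c)).
  move=> j; apply: sm_sub (smv_trans a1 (fbase_atlas c) j) => _ [x [[Ux D1] D2] <-].
  by exists x => //; split => //; case: Ux.
have S2 : smv (cmap c1 @` S) (fun u => graph g (trans c1 (fbase c) u)).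
  by move=> j; exact: (sm_comp oI (fun _ _ => I) S1 (smv_graphT Sg j)).
apply: (sm_ext oI _ (sm_comp oI _ S2 (smv_trans (ftot_atlas c) a2 i))) => //.
move=> _ [x [[Ux D1] D2] <-]; exists (h x); first by split => //; exact: DU.
by rewrite mU// (trans_cmap _ v1).
Qed.

(** The section is built from the Taylor polynomial of z.  The representative chosen for
    its jet may be another section, but it has the same derivatives at the same point. *)
Lemma jet_exists r c y (z : jsp r) : fdom c y -> jbase z = cmap (ftot c) y ->
  exists q : Jt r, jtarget q = y /\ jmap c q = z.
Proof.
move=> Dy Ez; have [g [Sg Eg]] := taylor_jet z.
have gy : graph g (cmap (fbase c) (pi y)) = cmap (ftot c) y.
  by rewrite -fchart_fibered// -Ez -{2}Eg jbase_jet.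
have [] := local_sectionT Dy Sg gy.
set U := _ `&` _; set h := fun x => _ => oU Uy hS hK.
have Lh : local_section MX MY pi (pi y) h by exists U.
have hyy : h (pi y) = y by rewrite /h gy; case: (tot_valid c) => _ _ _ _ ->.
pose cl := [set p | [/\ p.1 = pi y, local_section MX MY pi p.1 p.2 & same_jet MX MY pi r (pi y) h p.2]].
pose q : Jt r := @Defs.Jet _ _ _ _ _ MX MY pi r cl (ex_intro _ (pi y, h) (conj Lh erefl)).
have [Lq Cq] := jrepP q.
have : jclass q (jrep q) by rewrite Cq; split.
rewrite [jclass q]/= => -[E1 _ [E2 E3]].
have tq : jtarget q = y by rewrite /jtarget E1 -E2 hyy.
exists q; split=> //.
rewrite jmapE E1; have EE : jet_at r (components h c) (cmap (fbase c) (pi y)) = z.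
  rewrite -[RHS]Eg Ez fchart_fibered//; apply: jspaceP => [i|s K]; first by rewrite !xc_jmk.
  rewrite !yc_jmk_mseq; have oS := @open_section_dom _ _ _ _ _ _ _ _ U h oU hS c.
  apply: (ddr_eq_on _ oS) => [|_ [x [[Ux Dx] Dh] <-]].
    by exists (pi y) => //; split=> //=; [split=> //; exact: pi_dom|rewrite hyy].
  have := graph_components hK Ux Dh.
  have -> : cmap (ftot c) (h x) = graph g (cmap (fbase c) x).
    by case: Ux => _ [y1 Dy1 E]; rewrite /h -E; case: (tot_valid c) => _ _ _ _ ->.
  by rewrite /graph => /eq_row_mx[_ /rowP/(_ s)]; rewrite !mxE.
rewrite -EE; apply: jspaceP => [i|s K]; first by rewrite !xc_jmk.
rewrite !yc_jmk_mseq; apply/esym; apply: (E3 c); last exact: size_mseq.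
by rewrite hyy.
Qed.

Lemma joverlapE r c c' : jov r c c' = [set z : jsp r | tot_overlap c c' (jbase z)].
Proof.
apply/seteqP; split=> [_ [q [Dq Dq'] <-]|z [y [Dy Dy'] E]] /=.
  by rewrite jbase_jmap//; exists (jtarget q).
have [q [tq mq]] := jet_exists Dy (esym E).
by exists q => //; rewrite /jpre /= tq.
Qed.

Lemma jrange_overlap r c : jran r c = jov r c c.
Proof. by rewrite /jrange /joverlap setIid. Qed.

(** The value picked in the definition of [jtrans] is unique, as any jet with coordinates z
    in the chart c has these coordinates in the chart of arrival. *)
Lemma jtransE r c c' (z : jsp r) : jov r c c' z ->
  jtrans c c' z = Prol (xtrans c c') (xtrans c' c) (fibre_trans c c') z.
Proof.
move=> [q Dq Eq]; rewrite /jtrans; case: xgetP => [w _ [q' [Dq' E1 <-]]|/(_ (jmap c' q)) []].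
  by rewrite (jmap_trans Dq') E1.
by exists q.
Qed.

Lemma jtrans_overlap r c c' (z : jsp r) : jov r c c' z -> jov r c' c (jtrans c c' z).
Proof.
move=> Oz; rewrite jtransE//; case: Oz => q Dq <-; rewrite -(jmap_trans Dq).
by exists q => //; case: Dq.
Qed.

Lemma joverlap_range r c c' (z : jsp r) : jov r c c' z -> jran r c z.
Proof. by move=> [q [Dq _] <-]; exists q. Qed.

End JetCharts.

(** * Lagrangians in charts *)

Section Lagrangians.
Context {R : realType} {n m : nat} {X Y : topologicalType}.
Variables (MX : manifold R n X) (MY : manifold R (n + m) Y) (pi : Y -> X).
Variables (W : set Y) (lam : lagrangian MX MY pi W 3).
Local Notation fch := (fchart MX MY pi).
Local Notation jsp r := (jspace R n m r).
Local Notation jov r := (@joverlap R n m X Y MX MY pi r).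
Local Notation jran r := (@jrange R n m X Y MX MY pi r).
Local Notation jtr r := (@jtrans R n m X Y MX MY pi r).
Local Notation fn := ('rV[R]_n -> R).
Implicit Types (c : fch).

Lemma open_joverlap r c c' : open (jov r c c').
Proof. by rewrite joverlapE; exact: (open_jbase (@open_tot_overlap _ _ _ _ _ _ _ _ c c')). Qed.

Lemma sm_lagL c : fdom c `<=` W -> sm (jran 3 c) (lagL lam c).
Proof.
move=> cW; apply/smooth_onP; first by rewrite jrange_overlap; exact: open_joverlap.
exact: (@jform_smooth R n m X Y MX MY pi W 3 n lam c cW (fun i => dx 3 i)).
Qed.

(** The prolongation of the chart change, total in z, which [jtrans] equals on overlaps. *)
Definition chart_prol r c c' : jsp r -> jsp r :=
  @Prol R n m (xtrans c c') (xtrans c' c) (fibre_trans c c') r.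

Lemma smv_chart_prol r c c' : smv (jov r c c') (@chart_prol r c c').
Proof.
rewrite joverlapE; exact: (@smv_Prol R n m _ _ _ _ _ _ (@open_tot_overlap _ _ _ _ _ _ _ _ c c')
  (@open_base_overlap _ _ _ _ _ _ _ _ c c') (@smv_xtrans _ _ _ _ _ _ _ _ c c')
  (@smv_xtrans _ _ _ _ _ _ _ _ c' c) (@base_overlap_xtrans _ _ _ _ _ _ _ _ c c')
  (@sm_fibre_trans _ _ _ _ _ _ _ _ c c') (@tot_overlap_base _ _ _ _ _ _ _ _ c c') r).
Qed.

(** Overlaps are open, so that the derivatives agree as well. *)
Lemma pullback_jtrans r k c c' (a : jsp r -> covec R n m r k) z : jov r c c' z ->
  pullback (jtr r c c') a z = pullback (@chart_prol r c c') a z.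
Proof.
move=> Oz; rewrite /pullback /= jtransE//; apply: funext => v; congr (a _ _).
apply: funext => i; apply: (D_eq_on (v i) (@open_joverlap r c c') Oz) => y Oy.
exact: jtransE.
Qed.

(** A horizontal n-form is L times the volume form, and pulling back the volume form
    yields the Jacobian determinant. *)
Lemma lagL_law c c' z : fdom c `<=` W -> fdom c' `<=` W -> jov 3 c c' z ->
  lagL lam c z = jacdet (xtrans c c') (lsubmx (jbase z)) * lagL lam c' (chart_prol c c' z).
Proof.
move=> cW cW' Oz; have Oz' := jtrans_overlap Oz; have Rz' := joverlap_range Oz'.
rewrite {1}/lagL -(@jform_compatible R n m X Y MX MY pi W 3 n lam c c' cW cW' z Oz) (pullback_jtrans _ Oz) /pullback.
rewrite (_ : chart_prol c c' z = jtr 3 c c' z); last by rewrite (jtransE Oz).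
rewrite (horizontal_form _ (jform_multilinear lam cW' Rz')
  (jform_alternating lam cW' Rz') (lag_horizontal lam cW' Rz')) mulrC; congr (_ * _).
rewrite /omega0 /jacdet; congr (\det _); apply/matrixP => a p; rewrite !mxE.
have dP := smv_diff (@smv_chart_prol 3 c c') Oz.
have dl : differentiable (fun z : jsp 3 => lsubmx (jbase z)) z.
  exact: (smv_diff (@smv_lsubmx_jbase R n m 3 _ openT) (I : setT _)).
have Xz : base_overlap c c' (lsubmx (jbase z)).
  by apply: tot_overlap_base; move: Oz; rewrite joverlapE.
have dphi := sm_diff (@smv_xtrans _ _ _ _ _ _ _ _ c c' a) Xz.
rewrite -(D_xc_along _ _ dP).
have -> : (fun z : jsp 3 => xc (chart_prol c c' z) a) = fun z => xtrans c c' (lsubmx (jbase z)) 0 a.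
  by apply: funext => y; exact: xc_jmk.
rewrite (@D_comp _ _ _ _ (fun z : jsp 3 => lsubmx (jbase z)) (fun x => xtrans c c' x 0 a) _ _ dl dphi).
have -> : 'D_(dx 3 p) (fun z : jsp 3 => lsubmx (jbase z)) z = ebase p; last by [].
by rewrite D_lsubmx_jbase; apply/rowP => i; rewrite !mxE xc_dx.
Qed.

Definition third_free_in c := forall z tau l1 l2 k,
  jran 3 c z -> sdy tau [:: l1; l2; k] (lagL lam c) z = 0.

Lemma Theta_trans c c' z : fdom c `<=` W -> fdom c' `<=` W ->
  (forall i k : 'I_n, i = k) \/ (third_free_in c /\ third_free_in c') -> jov 5 c c' z ->
  pullback (jtr 5 c c') (Theta (lagL lam c')) z = Theta (lagL lam c) z.
Proof.
move=> cW cW' cases Oz; rewrite (pullback_jtrans _ Oz).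
have cz d d' (z' : jsp 3) : tot_overlap d d' (jbase z') -> jran 3 d z'.
  by move=> Oz'; apply: (@joverlap_range _ _ _ _ _ _ _ _ _ d d'); rewrite joverlapE.
apply: (@Theta_invariant R n m _ _ _ _ _ _ _ (@open_tot_overlap _ _ _ _ _ _ _ _ c c')
  (@open_tot_overlap _ _ _ _ _ _ _ _ c' c)
  (@open_base_overlap _ _ _ _ _ _ _ _ c c') (@open_base_overlap _ _ _ _ _ _ _ _ c' c)
  (@smv_xtrans _ _ _ _ _ _ _ _ c c')
  (@smv_xtrans _ _ _ _ _ _ _ _ c' c) (@base_overlap_xtrans _ _ _ _ _ _ _ _ c c')
  (@xtransK _ _ _ _ _ _ _ _ c c')
  (@sm_fibre_trans _ _ _ _ _ _ _ _ c c') (@tot_overlap_base _ _ _ _ _ _ _ _ c c')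
  (@tot_overlap_row _ _ _ _ _ _ _ _ c c') (@xtransK _ _ _ _ _ _ _ _ c' c)).
- exact: (sm_sub (cz c c') (sm_lagL cW)).
- exact: (sm_sub (cz c' c) (sm_lagL cW')).
- by move=> y Oy; apply: lagL_law => //; rewrite joverlapE.
- case: cases => [one|[f f']]; [by left|right; split=> y s k l i Oy].
    exact: f (cz _ _ _ Oy).
  exact: f' (cz _ _ _ Oy).
- by move: Oz; rewrite joverlapE.
Qed.

(** When all base indices coincide, the two terms of the obstruction are equal. *)
Lemma obstruction_third_free c c' z k s sigma : (forall i k : 'I_n, i = k) \/ third_free_in c ->
  jov 3 c c' z -> obstruction c c' (lagL lam c) k s sigma z = 0.
Proof.
move=> cases Oz; do 4 (apply: big1 => ? _).
case: cases => [one|fc]; first by rewrite (one s k) subrr !mul0r.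
by rewrite !fc ?mul0r ?subrr ?mul0r//; exact: joverlap_range Oz.
Qed.

Lemma fd_obstruction_third_free c c' z k s sigma : (forall i k : 'I_n, i = k) \/ third_free_in c ->
  jov 4 c c' z -> fd k (obstruction c c' (lagL lam c) k s sigma) z = 0.
Proof.
move=> cases Oz.
have Oz3 : jov 3 c c' (jproj 3 z) by move: Oz; rewrite !joverlapE /= jbase_jproj.
have E := fun y => @obstruction_third_free c c' y k s sigma cases.
have dE : differentiable (obstruction c c' (lagL lam c) k s sigma) (jproj 3 z).
  apply: (diff_eq_on (@open_joverlap 3 c c') Oz3 (fun y Oy => esym (E y Oy))).
  exact: differentiable_cst.
rewrite (fdE _ dE) (D_eq_on _ (@open_joverlap 3 c c') Oz3 E); exact: derive_cst.
Qed.

End Lagrangians.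

(** * Shears *)

Section Recoordinatization.
Context {R : realType} {N : nat} {M : topologicalType} (A : manifold R N M).
Variables (f f' : 'rV[R]_N -> 'rV[R]_N).
Hypotheses (Sf : smv setT f) (Sf' : smv setT f') (fK : cancel f f') (f'K : cancel f' f).
Implicit Types c : chart R N M.

Definition recoord c : chart R N M := Chart (cdom c) (f \o cmap c) (cinv c \o f').

Lemma crange_recoord c : crange (recoord c) = f' @^-1` crange c.
Proof.
apply/seteqP; split=> [_ [y Dy <-]|u [y Dy E]] /=; first by rewrite fK; exists y.
by exists y => //=; rewrite E f'K.
Qed.

Let contf : continuous f. Proof. by move=> u; exact: (smv_cont Sf (I : setT u)). Qed.
Let contf' : continuous f'. Proof. by move=> u; exact: (smv_cont Sf' (I : setT u)). Qed.

Lemma chart_valid_recoord c : chart_valid c -> chart_valid (recoord c).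
Proof.
move=> [oD oR cm ci K].
have oR' : open (crange (recoord c)).
  by rewrite crange_recoord; apply: open_comp => // u _; exact: contf'.
split=> //=.
- move=> y; apply: (@continuous_comp (subspace (cdom c)) _ _ (cmap c) f y (cm y)).
  exact: contf.
- rewrite (continuous_open_subspace _ oR') => u /set_mem; rewrite crange_recoord /= => Ru.
  have cu : {for f' u, continuous (cinv c)}.
    by move: ci; rewrite (continuous_open_subspace _ oR) => ci; exact/ci/mem_set.
  exact: (@continuous_comp _ _ _ f' (cinv c) u (contf' (x := u)) cu).
- by move=> y Dy; rewrite fK K.
Qed.

(** Maximality of the atlas turns compatibility with all of its charts into membership. *)
Lemma recoord_atlas c : atlas A c -> atlas A (recoord c).
Proof.
move=> ac; have vc := atlas_valid ac.
apply: (atlas_maximal (chart_valid_recoord vc)) => c' ac'.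
have vc' := atlas_valid ac'.
have oS : open (cdom c `&` cdom c') by apply: openI; [case: vc|case: vc'].
have oI : open (cmap c @` (cdom c `&` cdom c')) by apply: (open_image vc) oS => x [].
have oI1 : open (cmap (recoord c) @` (cdom c `&` cdom c')).
  by apply: (open_image (chart_valid_recoord vc)) oS => x [].
have oI2 : open (cmap c' @` (cdom c' `&` cdom c)).
  by rewrite setIC in oS; apply: (open_image vc') oS => x [].
have oI3 : open (cmap c' @` (cdom c `&` cdom c')) by rewrite setIC.
split.
  apply/(smooth_onvP _ oI1) => i.
  apply: (sm_comp oI1 _ (fun j => sm_sub (fun _ _ => I) (Sf' j)) (smv_trans ac ac' i)) => _ [y Dy <-].
  by rewrite /= fK; exists y.
apply/(smooth_onvP _ oI3) => i.
apply: (@sm_comp R _ _ _ setT (trans c' c) (fun u => f u 0 i) oI3 (fun _ _ => I) _ (Sf i)).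
by have := smv_trans ac' ac; rewrite setIC.
Qed.

End Recoordinatization.

Section Shear.
Context {R : realType} {n m : nat}.
Variables (a : 'I_n -> R) (e x0 : 'rV[R]_n) (d : nat).
Hypothesis ae : \sum_i a i * e 0 i = 0.

(** The displacement along e depends on the linear form only, which does not vary along e;
    so the inverse is the shear with opposite sign. *)
Definition shear (eps : R) (x : 'rV[R]_n) : 'rV[R]_n := x + (eps * dpow a x0 d x) *: e.

Lemma linf_shear eps x : linf a x0 (shear eps x) = linf a x0 x.
Proof.
transitivity (\sum_i (a i * (x 0 i - x0 0 i) + eps * dpow a x0 d x * (a i * e 0 i))).
  by apply: eq_bigr => i _; rewrite !mxE; ring.
by rewrite big_split /= -mulr_sumr ae mulr0 addr0.
Qed.

Lemma dpow_shear eps d' x : dpow a x0 d' (shear eps x) = dpow a x0 d' x.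
Proof. by elim: d' => //= d' ->; rewrite linf_shear. Qed.

Lemma shear_shear eps eps' x : shear eps (shear eps' x) = shear (eps + eps') x.
Proof. by rewrite /shear dpow_shear -addrA -scalerDl -mulrDl [eps' + _]addrC. Qed.

Lemma shear0 x : shear 0 x = x. Proof. by rewrite /shear mul0r scale0r addr0. Qed.

Lemma shearK eps : cancel (shear eps) (shear (- eps)).
Proof. by move=> x; rewrite shear_shear addNr shear0. Qed.

Lemma shearE eps x p : shear eps x 0 p = x 0 p + eps * dpow a x0 d x * e 0 p.
Proof. by rewrite !mxE. Qed.

Lemma smv_shear eps A : open A -> smv A (shear eps).
Proof.
move=> oA p; apply: (sm_ext oA (fun x _ => esym (shearE eps x p))).
apply: (sm_add oA (sm_coord A p)).
exact: (sm_mul oA (sm_mul oA (sm_cst A eps) (sm_dpow a x0 d oA)) (sm_cst A (e 0 p))).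
Qed.

Definition fshear (eps : R) (u : 'rV[R]_(n + m)) : 'rV[R]_(n + m) :=
  row_mx (shear eps (lsubmx u)) (rsubmx u).

Lemma fshearK eps : cancel (fshear eps) (fshear (- eps)).
Proof. by move=> u; rewrite /fshear row_mxKl row_mxKr shearK hsubmxK. Qed.

Lemma smv_fshear eps A : open A -> smv A (fshear eps).
Proof.
move=> oA c; rewrite -(splitK c); case: (fintype.split c) => [i|s] /=.
  apply: (sm_ext oA (f := fun u => shear eps (lsubmx u) 0 i)) => [u _|].
    by rewrite /fshear row_mxEl.
  apply: (@sm_comp R _ _ _ setT (@lsubmx R 1 n m) (fun x => shear eps x 0 i) oA (fun _ _ => I) _ (smv_shear eps openT i)).
  move=> j; apply: (sm_ext oA _ (sm_coord A (lshift m j))) => u _.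
  by rewrite mxE.
apply: (sm_ext oA _ (sm_coord A (rshift n s))) => u _.
by rewrite /fshear row_mxEr mxE.
Qed.

Lemma D_shear eps v x p : 'D_v (fun y => shear eps y 0 p) x =
  v 0 p + eps * 'D_v (dpow a x0 d) x * e 0 p.
Proof.
have dd : differentiable (dpow a x0 d) x by exact: (sm_diff (sm_dpow a x0 d openT)).
have de : differentiable (fun _ : 'rV[R]_n => eps) x by exact: differentiable_cst.
have dp : differentiable (fun _ : 'rV[R]_n => e 0 p) x by exact: differentiable_cst.
have d1 : differentiable (fun y => eps * dpow a x0 d y) x by exact: diff_mul.
rewrite (_ : (fun y => shear eps y 0 p) = fun y => y 0 p + eps * dpow a x0 d y * e 0 p); last first.
  by apply: funext => y; rewrite shearE.
rewrite (D_add _ (diff_coord p x) (diff_mul d1 dp)) D_coord (D_mul _ d1 dp) (D_mul _ de dd) !D_cst.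
by rewrite mul0r add0r mulr0 addr0.
Qed.

End Shear.

Section ShearDerivatives.
Context {R : realType} {n m : nat}.
Variables (a : 'I_n -> R) (e x0 : 'rV[R]_n).

Lemma D2_shear d eps l1 l2 x p :
  iter_derive [:: ebase l1; ebase l2] (fun x => shear a e x0 d.+2 eps x 0 p) x =
  a l1 * a l2 * (eps * dpow a x0 d x * e 0 p).
Proof.
have E : 'D_(ebase l2) (fun x => shear a e x0 d.+2 eps x 0 p) =
    fun y => (p == l2)%:R + (eps * a l2 * e 0 p) * dpow a x0 d.+1 y.
  by apply: funext => y; rewrite D_shear D_dpow D_linf_base mxE eqxx /=; ring.
have dd : differentiable (dpow a x0 d.+1) x by exact: (sm_diff (sm_dpow a x0 d.+1 openT)).
have dc (b : R) : differentiable (fun _ : 'rV[R]_n => b) x by exact: differentiable_cst.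
rewrite /iter_derive /= E (D_add _ (dc _) (diff_mul (dc _) dd)) (D_mul _ (dc _) dd) !D_cst.
by rewrite D_dpow D_linf_base; ring.
Qed.

(** This is where the base must have dimension at least two. *)
Lemma exists_kernel (i k : 'I_n) : i != k ->
  exists (w : 'rV[R]_n) s, w 0 s != 0 /\ \sum_i a i * w 0 i = 0.
Proof.
move=> ik; have key (b c : R) : \sum_j a j * (b *: ebase i + c *: ebase k) 0 j = b * a i + c * a k.
  transitivity (\sum_j (a j * b * (j == i)%:R + a j * c * (j == k)%:R)).
    by apply: eq_bigr => j _; rewrite !mxE !eqxx; ring.
  rewrite big_split /= (@sum_single _ _ _ i) ?(@sum_single _ _ _ k) ?eqxx; first by rewrite !mulr1 ![a _ * _]mulrC.
    by move=> j /negPf ->; rewrite mulr0.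
  by move=> j /negPf ->; rewrite mulr0.
have [ak0|ak0] := eqVneq (a k) 0.
  exists (0 *: ebase i + 1 *: ebase k), k; rewrite key ak0 !mxE !eqxx [k == i]eq_sym (negPf ik) /=.
  by rewrite !mul0r mulr0 !add0r mul1r oner_neq0.
exists (a k *: ebase i + (- a i) *: ebase k), i; rewrite key !mxE !eqxx (negPf ik) /=.
split; first by rewrite mulr1 mulr0 addr0.
by rewrite mulNr mulrC subrr.
Qed.

End ShearDerivatives.

Section ShearedChart.
Context {R : realType} {n m : nat} {X Y : topologicalType}.
Variables (MX : manifold R n X) (MY : manifold R (n + m) Y) (pi : Y -> X).
Local Notation fch := (fchart MX MY pi).
Local Notation jsp r := (jspace R n m r).
Local Notation jov r := (@joverlap R n m X Y MX MY pi r).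
Local Notation jran r := (@jrange R n m X Y MX MY pi r).
Local Notation jtr r := (@jtrans R n m X Y MX MY pi r).
Local Notation fn := ('rV[R]_n -> R).
Variables (c : fch) (a : 'I_n -> R) (e x0 : 'rV[R]_n) (d : nat).
Hypothesis ae : \sum_i a i * e 0 i = 0.
Local Notation sh := (shear a e x0 d).
Local Notation fsh := (@fshear R n m a e x0 d).

Lemma shearNK eps : cancel (sh (- eps)) (sh eps).
Proof. by have := shearK x0 d ae (- eps); rewrite opprK. Qed.

Lemma fshearNK eps : cancel (fsh (- eps)) (fsh eps).
Proof. by have := @fshearK R n m a e x0 d ae (- eps); rewrite opprK. Qed.

Lemma sheared_fibered y : fdom c y ->
  lsubmx (fsh 1 (cmap (ftot c) y)) = sh 1 (cmap (fbase c) (pi y)).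
Proof. by move=> Dy; rewrite /fshear row_mxKl fchart_fibered. Qed.

(** Both the base chart and the total chart are sheared, so that the new chart is again fibred. *)
Definition sheared : fch :=
  @FChart R n m X Y MX MY pi (recoord (fsh 1) (fsh (-1)) (ftot c)) (recoord (sh 1) (sh (-1)) (fbase c))
   (recoord_atlas (@smv_fshear R n m a e x0 d 1 setT openT) (@smv_fshear R n m a e x0 d (-1) setT openT)
      (@fshearK R n m a e x0 d ae 1) (fshearNK 1) (ftot_atlas c))
   (recoord_atlas (@smv_shear R n a e x0 d 1 setT openT) (@smv_shear R n a e x0 d (-1) setT openT)
      (@shearK R n a e x0 d ae 1) (shearNK 1) (fbase_atlas c))
   (fbase_dom c) sheared_fibered.

Lemma fdom_sheared : fdom sheared = fdom c. Proof. by []. Qed.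

Lemma xtrans_sheared x : base_overlap c sheared x -> xtrans c sheared x = sh 1 x.
Proof. by move=> [p [Dp _] <-]; rewrite /xtrans (trans_cmap _ (base_valid c)). Qed.

Lemma xtrans_unsheared x : base_overlap sheared c x -> xtrans sheared c x = sh (-1) x.
Proof.
move=> [p [Dp _] <-]; rewrite /xtrans (trans_cmap _ (base_valid sheared))//=.
by rewrite (@shearK R n a e x0 d ae 1).
Qed.

Lemma ytrans_sheared u : tot_overlap c sheared u -> ytrans c sheared u = fsh 1 u.
Proof. by move=> [p [Dp _] <-]; rewrite /ytrans (trans_cmap _ (tot_valid c)). Qed.

Lemma ytrans_unsheared u : tot_overlap sheared c u -> ytrans sheared c u = fsh (-1) u.
Proof.
move=> [p [Dp _] <-]; rewrite /ytrans (trans_cmap _ (tot_valid sheared))//=.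
by rewrite (@fshearK R n m a e x0 d ae 1).
Qed.

Lemma sheared_overlap r z : jran r c z -> jov r c sheared z.
Proof. by rewrite /jrange /joverlap fdom_sheared setIid. Qed.

Lemma dy_sheared tau sigma u : tot_overlap c sheared u ->
  dy_dybar c sheared tau sigma u = (tau == sigma)%:R.
Proof.
move=> Ou; rewrite /dy_dybar.
have oO := @open_tot_overlap _ _ _ _ _ _ _ _ sheared c.
rewrite (@D_eq_on _ _ _ _ _ (fun w => w 0 (rshift n tau)) _ _ oO (tot_overlap_ytrans Ou)).
  by rewrite D_coord mxE eqxx (inj_eq (@rshift_inj _ _)).
by move=> w Ow; rewrite ytrans_unsheared// /fshear row_mxEr mxE.
Qed.

End ShearedChart.

(** * Third-order derivatives vanish: from the obstruction *)

Section ThirdFreeFromObstruction.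
Context {R : realType} {n m : nat} {X Y : topologicalType}.
Variables (MX : manifold R n X) (MY : manifold R (n + m) Y) (pi : Y -> X).
Variables (W : set Y) (lam : lagrangian MX MY pi W 3).
Local Notation fch := (fchart MX MY pi).
Local Notation jsp r := (jspace R n m r).
Local Notation jov r := (@joverlap R n m X Y MX MY pi r).
Local Notation jran r := (@jrange R n m X Y MX MY pi r).
Local Notation fn := ('rV[R]_n -> R).
Implicit Types (c : fch).

(** The coefficient C_k, for the linear form with coefficients a. *)
Definition cubic c (a : 'I_n -> R) sigma k (y : jsp 3) : R :=
  \sum_l1 \sum_l2 sdy sigma [:: l1; l2; k] (lagL lam c) y * (a l1 * a l2).

(** The second derivatives of the cubic shear are linf times a l1 * a l2 times e; in
    the inverse Jacobian the correction to the identity is proportional to a, which e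
    annihilates. *)
Lemma obstruction_sheared c a (e x0 : 'rV[R]_n) (ae : \sum_i a i * e 0 i = 0) k s sigma y : jran 3 c y ->
  obstruction c (sheared c x0 3 ae) (lagL lam c) k s sigma y =
  linf a x0 (lsubmx (jbase y)) * (cubic c a sigma k y * e 0 s - cubic c a sigma s y * e 0 k).
Proof.
move=> Ry; set c' := sheared c x0 3 ae; set x := lsubmx (jbase y).
have Oy : tot_overlap c c' (jbase y) by have := sheared_overlap x0 3 ae Ry; rewrite joverlapE.
have Xy : base_overlap c c' x by exact: tot_overlap_base.
have oX := @open_base_overlap _ _ _ _ _ _ _ _ c c'.
have oX' := @open_base_overlap _ _ _ _ _ _ _ _ c' c.
have E2 p l1 l2 : d2xbar_dx c c' p l1 l2 (jbase y) = a l1 * a l2 * (linf a x0 x * e 0 p).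
  rewrite /d2xbar_dx (sm_iter_eq_on _ oX Xy (g := fun x => shear a e x0 3 1 x 0 p)) => [|w Xw].
    by rewrite D2_shear /= mul1r invr1 mulr1 mul1r.
  by rewrite xtrans_sheared.
have Ei s' p : dx_dxbar c c' s' p (jbase y) = (s' == p)%:R - dpow a x0 2 x * a p * e 0 s'.
  rewrite /dx_dxbar (@D_eq_on _ _ _ _ _ (fun w => shear a e x0 3 (-1) w 0 s') _ _ oX' (base_overlap_xtrans Xy)) => [|w Xw].
    rewrite xtrans_sheared// D_shear D_dpow D_linf_base dpow_shear// mxE eqxx /=.
    by rewrite mulN1r mulNr [a p * _]mulrC.
  by rewrite xtrans_unsheared.
(* contraction with e reduces the inverse Jacobian to the identity *)
have contr s' : \sum_p ((s' == p)%:R - dpow a x0 2 x * a p * e 0 s') * e 0 p = e 0 s'.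
  transitivity (\sum_p (e 0 p * (p == s')%:R - dpow a x0 2 x * e 0 s' * (a p * e 0 p))).
    by apply: eq_bigr => p _; rewrite eq_sym; ring.
  rewrite sumrB -mulr_sumr ae mulr0 subr0 (@sum_single _ _ _ s') ?eqxx ?mulr1//.
  by move=> p /negPf ->; rewrite mulr0.
rewrite /obstruction; apply: etrans; first apply: (@sum_single R _ _ sigma).
  move=> tau /negPf ts; apply: big1 => p _; apply: big1 => l1 _; apply: big1 => l2 _.
  by rewrite (dy_sheared tau sigma Oy) ts mulr0.
move: (linf a x0 x) E2 => q E2; move: (dpow a x0 2 x) Ei contr => q2 Ei contr.
rewrite exchange_big /cubic !mulr_suml -sumrB mulr_sumr; apply: eq_bigr => l1 _ /=.
rewrite exchange_big !mulr_suml -sumrB mulr_sumr; apply: eq_bigr => l2 _ /=.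
set A := sdy sigma [:: l1; l2; k] _ y; set B := sdy sigma [:: l1; l2; s] _ y.
transitivity (\sum_p q * (a l1 * a l2) *
   (A * (((s == p)%:R - q2 * a p * e 0 s) * e 0 p) -
    B * (((k == p)%:R - q2 * a p * e 0 k) * e 0 p))).
  by apply: eq_bigr => p _; rewrite E2 !Ei (dy_sheared sigma sigma Oy) eqxx mulr1; ring.
by rewrite -mulr_sumr sumrB -!mulr_sumr !contr; ring.
Qed.

Lemma sm_cubic c a sigma k : fdom c `<=` W -> sm (jran 3 c) (cubic c a sigma k).
Proof.
move=> cW; have oR : open (jran 3 c) by rewrite jrange_overlap; exact: open_joverlap.
apply: (sm_sum _ oR) => l1 _; apply: (sm_sum _ oR) => l2 _.
exact: (sm_mul oR (sm_sdy sigma [:: l1; l2; k] oR (@sm_lagL _ _ _ _ _ _ _ _ _ lam c cW)) (sm_cst _ (a l1 * a l2))).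
Qed.

(** Polarization of the cubic form. *)
Lemma third_free_of_cubic c : (forall a sigma y, jran 3 c y -> \sum_k a k * cubic c a sigma k y = 0) ->
  third_free_in lam c.
Proof.
move=> H z tau l1 l2 k Rz.
apply: (polarize3 (C := fun l1 l2 k => sdy tau [:: l1; l2; k] (lagL lam c) z)).
- by move=> i j q; apply: (congr1 (fun F : jsp 3 -> R => F z)); apply: sdy_perm; rewrite -[[:: i; j; q]]/([:: i] ++ [:: j] ++ [:: q]) perm_catCA.
- by move=> i j q; apply: (congr1 (fun F : jsp 3 -> R => F z)); apply: sdy_perm; rewrite perm_cons (perm_catC [:: j]).
move=> a; rewrite -[RHS](H a tau z Rz).
transitivity (\sum_i \sum_k0 \sum_j sdy tau [:: i; j; k0] (lagL lam c) z * a i * a j * a k0).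
  by apply: eq_bigr => i _; rewrite exchange_big.
rewrite exchange_big; apply: eq_bigr => q _ /=; rewrite /cubic mulr_sumr; apply: eq_bigr => i _.
by rewrite mulr_sumr; apply: eq_bigr => j _; ring.
Qed.

(** At the base point of the shear the factor linf vanishes, so its derivative a_k is all
    that contributes to the total derivatives; summing over k, the term with e_k drops
    out. *)
Lemma third_free_of_obstruction c (i k : 'I_n) : fdom c `<=` W -> i != k ->
  (forall c' : fch, fdom c' `<=` W -> forall z, jov 4 c c' z -> forall s sigma,
     \sum_k fd k (obstruction c c' (lagL lam c) k s sigma) z = 0) ->
  third_free_in lam c.
Proof.
move=> cW ik H; apply: third_free_of_cubic => a sigma y Ry.
have [e [s [es ae]]] := exists_kernel a ik.
set x0 := lsubmx (jbase y); pose c' := sheared c x0 3 ae.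
(* any fourth-order point over y; its top-order coordinates are zero *)
pose z : jsp 4 := jproj 4 y.
have zy : jproj 3 z = y by rewrite jproj_jproj// jproj_id.
have Oz : jov 4 c c' z.
  apply: sheared_overlap; move: Ry; rewrite !jrange_overlap !joverlapE /= /z jbase_jproj.
  by [].
have := H c' cW z Oz s sigma.
have oR : open (jran 3 c) by rewrite jrange_overlap; exact: open_joverlap.
pose G q (w : jsp 3) := cubic c a sigma q w * e 0 s - cubic c a sigma s w * e 0 q.
pose F (w : jsp 3) := linf a x0 (lsubmx (jbase w)).
have SG q : sm (jran 3 c) (G q).
  apply: (sm_add oR); first exact: (sm_mul oR (sm_cubic a sigma q cW) (sm_cst _ _)).
  exact: (sm_opp oR (sm_mul oR (sm_cubic a sigma s cW) (sm_cst _ _))).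
have dG q : differentiable (G q) y by exact: (sm_diff (SG q) Ry).
have dl : differentiable (fun w : jsp 3 => lsubmx (jbase w)) y.
  exact: (smv_diff (@smv_lsubmx_jbase R n m 3 _ openT) (I : setT _)).
have dlin x : differentiable (linf a x0) x by exact: (sm_diff (sm_linf a x0 openT)).
have dF : differentiable F y by exact: (differentiable_comp dl (dlin _)).
have E q : fd q (obstruction c c' (lagL lam c) q s sigma) z = a q * G q y.
  have eqF w : jran 3 c w -> F w * G q w = obstruction c c' (lagL lam c) q s sigma w.
    by move=> Rw; rewrite obstruction_sheared.
  have dO : differentiable (obstruction c c' (lagL lam c) q s sigma) (jproj 3 z).
    by rewrite zy; apply: (diff_eq_on oR Ry eqF); exact: diff_mul.
  rewrite (fdE _ dO) zy -(D_eq_on _ oR Ry eqF) (D_mul _ dF (dG q)).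
  rewrite [X in _ + X * _](linf_base a x0) ?mul0r ?addr0.
  rewrite (@D_comp _ _ _ _ (fun w : jsp 3 => lsubmx (jbase w)) (linf a x0) _ _ dl (dlin _)).
  rewrite D_lsubmx_jbase D_linf (@sum_single _ _ _ q).
    by rewrite mxE xc_jmk eqxx mulr1.
  by move=> p /negPf pq; rewrite mxE xc_jmk pq mulr0.
rewrite (eq_bigr _ (fun q _ => E q)) => Z.
apply: (mulIf es); rewrite mul0r -[RHS]Z mulr_suml.
have -> : \sum_q a q * G q y = \sum_q (a q * cubic c a sigma q y * e 0 s) - cubic c a sigma s y * \sum_q a q * e 0 q.
  by rewrite mulr_sumr -sumrB; apply: eq_bigr => q _; rewrite /G; ring.
by rewrite ae mulr0 subr0.
Qed.

End ThirdFreeFromObstruction.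

(** * Third-order derivatives vanish: from the invariance of the form *)

(** With b = 0 the equations give C' = C, and with t = 0 they give Q - Q' = - e C,
    whose symmetry means that e and C are proportional; so a annihilates C with e. *)
Lemma symmetric_defect {R : realType} {n : nat} (Q Q' : 'I_n -> 'I_n -> R) (C C' a : 'I_n -> R)
    (e : 'rV[R]_n) s : \sum_i a i * e 0 i = 0 -> e 0 s != 0 ->
  (forall p q, Q p q = Q q p) -> (forall p q, Q' p q = Q' q p) ->
  (forall (b : 'I_n -> R) t j, \sum_k Q k j * b k + t * C j =
     \sum_k Q' k j * b k + (t - \sum_i b i * e 0 i) * C' j) ->
  \sum_j a j * C j = 0.
Proof.
move=> ae es Qs Qs' EQ.
have CE j : C' j = C j.
  have Z (F : 'I_n -> R) : \sum_k F k * 0 = 0 by apply: big1 => p _; rewrite mulr0.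
  have := EQ (fun _ => 0) 1 j; rewrite !Z !add0r mul1r => ->.
  by rewrite big1 ?subr0 ?mul1r// => p _; rewrite mul0r.
have Qd q j : Q q j = Q' q j - e 0 q * C j.
  have Z (F : 'I_n -> R) : \sum_k F k * (k == q)%:R = F q.
    rewrite (@sum_single _ _ _ q) ?eqxx ?mulr1// => p /negPf ->.
    by rewrite mulr0.
  have := EQ (fun p => (p == q)%:R) 0 j; rewrite !Z mul0r addr0 CE => ->.
  rewrite (eq_bigr (fun i => e 0 i * (i == q)%:R)) ?Z ?sub0r ?mulNr// => p _.
  by rewrite mulrC.
have Ce q j : e 0 q * C j = e 0 j * C q.
  by have := Qs q j; rewrite !Qd (Qs' q j) => /addrI/oppr_inj.
apply: (mulfI es); rewrite mulr0 mulr_sumr.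
transitivity (\sum_j (a j * e 0 j) * C s).
  by apply: eq_bigr => j _; rewrite mulrCA Ce mulrA.
by rewrite -mulr_suml ae mul0r.
Qed.

Section TestVariations.
Context {R : realType} {n m : nat}.
Local Notation jsp r := (jspace R n m r).
Local Notation fn := ('rV[R]_n -> R).
Variables (a : 'I_n -> R) (x0 : 'rV[R]_n).

(** Variations whose first derivatives at x0 are b and whose second derivatives are
    t times the square of the form a. *)
Definition quad_test (b : 'I_n -> R) (t : R) : fn := fun x => linf b x0 x + t * dpow a x0 2 x.

Let dl b x : differentiable (linf b x0) x. Proof. exact: (sm_diff (sm_linf b x0 openT)). Qed.
Let dd d x : differentiable (dpow a x0 d) x. Proof. exact: (sm_diff (sm_dpow a x0 d openT)). Qed.
Let dc (b : R) x : differentiable (fun _ : 'rV[R]_n => b) x. Proof. exact: differentiable_cst. Qed.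

Lemma sm_quad_test b t : sm setT (quad_test b t).
Proof.
exact: (sm_add openT (sm_linf b x0 openT) (sm_mul openT (sm_cst _ t) (sm_dpow a x0 2 openT))).
Qed.

Lemma quad_test_base b t : quad_test b t x0 = 0.
Proof. by rewrite /quad_test linf_base dpow_base mulr0 addr0. Qed.

Lemma D_quad_test b t l : 'D_(ebase l) (quad_test b t) = fun x => b l + t * a l * dpow a x0 1 x.
Proof.
apply: funext => x; rewrite (D_add _ (dl _ _) (diff_mul (dc t x) (dd 2 x))).
by rewrite (D_mul _ (dc t x) (dd 2 x)) D_cst D_dpow !D_linf_base mul0r add0r mulrA.
Qed.

Lemma D_quad_test_base b t l : 'D_(ebase l) (quad_test b t) x0 = b l.
Proof. by have /= -> := congr1 (fun f => f x0) (D_quad_test b t l); rewrite linf_base mulr0 mul0r mulr0 addr0. Qed.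

Lemma D2_quad_test_base b t k l : 'D_(ebase k) ('D_(ebase l) (quad_test b t)) x0 = t * (a k * a l).
Proof.
rewrite D_quad_test (D_add _ (dc _ _) (diff_mul (dc (t * a l) x0) (dd 1 x0))).
rewrite (D_mul _ (dc _ x0) (dd 1 x0)) !D_cst D_dpow D_linf_base /=; ring.
Qed.

(** The shear changes the quadratic part only, by the value of the linear part on e. *)
Lemma quad_test_shear (e : 'rV[R]_n) b t x : \sum_i a i * e 0 i = 0 ->
  quad_test b t (shear a e x0 2 (-1) x) = quad_test b (t - \sum_i b i * e 0 i) x.
Proof.
move=> ae; rewrite /quad_test dpow_shear// mulrBl addrA addrAC; congr (_ + _).
rewrite /linf mulr_suml -sumrB; apply: eq_bigr => i _; rewrite shearE; ring.
Qed.

(** The variation vanishes at x0, so that only its first and second derivatives contribute. *)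
Lemma lagmom_test (L : jsp 3 -> R) g xi V sigma b t j : open V -> V x0 ->
  (forall s y, V y -> xi s y = if s == sigma then quad_test b t y else 0) ->
  lagmom L g xi j x0 =
  \sum_k (coef L g sigma [:: k; j] x0 - \sum_p 'D_(ebase p) (coef L g sigma [:: k; p; j]) x0) * b k
  + t * \sum_k \sum_l coef L g sigma [:: k; l; j] x0 * (a k * a l).
Proof.
move=> oV Vx H; rewrite /lagmom.
have J0 s : xi s x0 = if s == sigma then quad_test b t x0 else 0 by exact: H.
have Js s K : ddr K (xi s) x0 = ddr K (fun y => if s == sigma then quad_test b t y else 0) x0.
  exact: (ddr_eq_on K oV Vx (H s)).
apply: etrans; first apply: (@sum_single R _ _ sigma).
  move=> s /negPf ss.
  have Z K : ddr K (xi s) x0 = 0.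
    rewrite Js ss; elim: K x0 => // k K IH y.
    rewrite /ddr /= -/(ddr K _) (_ : ddr K (fun=> 0) = fun=> 0) ?D_cst//.
    by apply: funext.
  rewrite /momentum; have -> : xi s x0 = 0 by exact: (Z [::]).
  rewrite mulr0 add0r big1 ?add0r; last first.
    by move=> k _; rewrite (_ : 'D_(ebase k) (xi s) x0 = 0) ?mulr0//; exact: (Z [:: k]).
  apply: big1 => k _; apply: big1 => l _.
  by rewrite (_ : 'D_(ebase k) _ x0 = 0) ?mulr0//; exact: (Z [:: k; l]).
have T K : ddr K (xi sigma) x0 = ddr K (quad_test b t) x0 by rewrite Js eqxx.
rewrite /momentum; have -> : xi sigma x0 = 0 by exact: (etrans (T [::]) (quad_test_base b t)).
rewrite mulr0 add0r; congr (_ + _).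
  apply: eq_bigr => k _; congr (_ * _); exact: (etrans (T [:: k]) (D_quad_test_base b t k)).
rewrite mulr_sumr; apply: eq_bigr => k _; rewrite mulr_sumr; apply: eq_bigr => l _.
rewrite mulrCA; congr (_ * _); exact: (etrans (T [:: k; l]) (D2_quad_test_base b t k l)).
Qed.

End TestVariations.

Section ThirdFreeFromTheta.
Context {R : realType} {n m : nat} {X Y : topologicalType}.
Variables (MX : manifold R n X) (MY : manifold R (n + m) Y) (pi : Y -> X).
Variables (W : set Y) (lam : lagrangian MX MY pi W 3).
Local Notation fch := (fchart MX MY pi).
Local Notation jsp r := (jspace R n m r).
Local Notation jov r := (@joverlap R n m X Y MX MY pi r).
Local Notation jran r := (@jrange R n m X Y MX MY pi r).
Local Notation jtr r := (@jtrans R n m X Y MX MY pi r).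
Local Notation fn := ('rV[R]_n -> R).
Implicit Types (c : fch).

Lemma momenta_trans c c' (g : 'I_m -> fn) xi x j : fdom c `<=` W -> fdom c' `<=` W ->
  (forall s, sm setT (g s)) -> tot_overlap c c' (graph g x) -> (forall s, sm setT (xi s)) ->
  pullback (jtr 5 c c') (Theta (lagL lam c')) (jet_at 5 g x) = Theta (lagL lam c) (jet_at 5 g x) ->
  lagmom (lagL lam c) g xi j x = jacdet (xtrans c c') x *
    \sum_b jaci (xtrans c c') (xtrans c' c) j b x
      * lagmom (lagL lam c') (gbar (xtrans c' c) (fibre_trans c c') g)
          (xibar (xtrans c' c) (fibre_trans c c') g xi) b (xtrans c c' x).
Proof.
move=> cW cW' Sg Ox Sxi; rewrite pullback_jtrans; last by rewrite joverlapE /= jbase_jet.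
have cz d d' (z' : jsp 3) : tot_overlap d d' (jbase z') -> jran 3 d z'.
  by move=> Oz'; apply: (@joverlap_range _ _ _ _ _ _ _ _ _ d d'); rewrite joverlapE.
have oO := @open_tot_overlap _ _ _ _ _ _ _ _ c c'.
pose U := [set x | tot_overlap c c' (graph g x)].
have oU : open U.
  by apply: open_comp => // u _; exact: (smv_cont (smv_graphT Sg) (I : setT u)).
apply: (@momenta_of_Theta R n m _ _ _ _ _ _ _ oO
  (@open_tot_overlap _ _ _ _ _ _ _ _ c' c)
  (@open_base_overlap _ _ _ _ _ _ _ _ c c') (@open_base_overlap _ _ _ _ _ _ _ _ c' c)
  (@smv_xtrans _ _ _ _ _ _ _ _ c c')
  (@smv_xtrans _ _ _ _ _ _ _ _ c' c) (@base_overlap_xtrans _ _ _ _ _ _ _ _ c c')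
  (@xtransK _ _ _ _ _ _ _ _ c c')
  (@sm_fibre_trans _ _ _ _ _ _ _ _ c c') (@tot_overlap_base _ _ _ _ _ _ _ _ c c')
  (@tot_overlap_row _ _ _ _ _ _ _ _ c c') (@xtransK _ _ _ _ _ _ _ _ c' c)
  (lagL lam c) (lagL lam c') _ _ _ U oU g _ _ xi j x Ox Sxi).
- exact: (sm_sub (cz c c') (@sm_lagL _ _ _ _ _ _ _ _ _ lam c cW)).
- exact: (sm_sub (cz c' c) (@sm_lagL _ _ _ _ _ _ _ _ _ lam c' cW')).
- by move=> y Oy; apply: lagL_law => //; rewrite joverlapE.
- by move=> s; exact: sm_sub (Sg s).
- by [].
Qed.

(** Because the quadratic shear has the identity as its Jacobian at x0, invariance of
    momenta is an equality of the coefficients seen by [quad_test] in both charts, up to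
    the second derivatives of the shear; this is the situation of [symmetric_defect]. *)
Lemma third_free_of_Theta c (i k : 'I_n) : fdom c `<=` W -> i != k ->
  (forall c', fdom c' `<=` W -> forall z, jov 5 c c' z ->
     pullback (jtr 5 c c') (Theta (lagL lam c')) z = Theta (lagL lam c) z) ->
  third_free_in lam c.
Proof.
move=> cW ik H; apply: third_free_of_cubic => a sigma y Ry.
have [e [s [es ae]]] := exists_kernel a ik.
set x0 := lsubmx (jbase y); pose c' := sheared c x0 2 ae.
have [g [Sg Eg]] := taylor_jet (jproj 5 y : jsp 5).
rewrite jbase_jproj -/x0 in Eg.
have Eg3 : jet_at 3 g x0 = y.
  by rewrite -(jproj_jet openT Sg (r := 5) (t := 3) isT (I : setT x0)) Eg jproj_jproj// jproj_id.
have Oy : tot_overlap c c' (graph g x0).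
  by rewrite -(jbase_jet g 3) Eg3; have := sheared_overlap x0 2 ae Ry; rewrite joverlapE.
have Xy : base_overlap c c' x0 by have := tot_overlap_base Oy; rewrite /graph row_mxKl.
have Oz : jov 5 c c' (jet_at 5 g x0) by rewrite joverlapE /= jbase_jet.
have oX := @open_base_overlap _ _ _ _ _ _ _ _ c c'.
have oX' := @open_base_overlap _ _ _ _ _ _ _ _ c' c.
have fx0 : xtrans c c' x0 = x0.
  by rewrite xtrans_sheared// /shear dpow_base mulr0 scale0r addr0.
have Dsh eps p b : 'D_(ebase b) (fun x => shear a e x0 2 eps x 0 p) x0 = (p == b)%:R.
  by rewrite D_shear D_dpow dpow_base !mulr0 mul0r addr0 mxE eqxx.
have det1 : jacdet (xtrans c c') x0 = 1.
  rewrite /jacdet -[RHS](det1 R n); congr (\det _); apply/matrixP => p b; rewrite !mxE -(Dsh 1).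
  by apply: (D_eq_on _ oX Xy) => w Xw; rewrite xtrans_sheared.
have jacE p b : jaci (xtrans c c') (xtrans c' c) p b x0 = (p == b)%:R.
  rewrite /jaci fx0 -(Dsh (-1)); have X'y := base_overlap_xtrans Xy; rewrite fx0 in X'y.
  by apply: (D_eq_on _ oX' X'y) => w Xw; rewrite xtrans_unsheared.
pose gb := gbar (xtrans c' c) (fibre_trans c c') g.
pose xi b t (s' : 'I_m) : fn := if s' == sigma then quad_test a x0 b t else fun _ => 0.
have Sxi b t s' : sm setT (xi b t s').
  by rewrite /xi; case: eqP => _; [exact: sm_quad_test|exact: sm_cst].
pose xb b t := xibar (xtrans c' c) (fibre_trans c c') g (xi b t).
have E b t j : lagmom (lagL lam c) g (xi b t) j x0 = lagmom (lagL lam c') gb (xb b t) j x0.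
  have cW' : fdom c' `<=` W by [].
  rewrite (momenta_trans j cW cW' Sg Oy (Sxi b t) (H c' cW' _ Oz)) det1 mul1r fx0.
  rewrite (@sum_single _ _ _ j) ?jacE ?eqxx ?mul1r// => p pj.
  by rewrite jacE eq_sym (negPf pj) mul0r.
(* a neighbourhood of x0 on which the transformed variation is explicit *)
pose V := [set x | base_overlap c' c x /\ tot_overlap c c' (graph g (xtrans c' c x))].
have oV : open V.
  rewrite openE => x [Xx Ox]; apply: (@filterI _ _ (nbhs_filter x)).
    exact: (open_nbhs_nbhs (conj oX' Xx)).
  have oG : open [set x | tot_overlap c c' (graph g x)].
    apply: open_comp; last exact: open_tot_overlap.
    by move=> u _; exact: (smv_cont (smv_graphT Sg) (I : setT u)).
  exact: (smv_cont (@smv_xtrans _ _ _ _ _ _ _ _ c' c) Xx (open_nbhs_nbhs (conj oG Ox))).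
have Vx : V x0.
  have X'y := base_overlap_xtrans Xy; rewrite fx0 in X'y; split=> //.
  by have := xtransK Xy; rewrite fx0 => ->.
have xbE b t s' x : V x -> xb b t s' x =
    if s' == sigma then quad_test a x0 b (t - \sum_i b i * e 0 i) x else 0.
  move=> [Xx Ox]; have F s2 : fibjac (fibre_trans c c') g s' s2 (xtrans c' c x) = (s' == s2)%:R.
    rewrite /fibjac (@D_eq_on _ _ _ _ _ (fun w => w 0 (rshift n s')) _ _ (@open_tot_overlap _ _ _ _ _ _ _ _ c c') Ox).
      by rewrite D_coord mxE eqxx (inj_eq (@rshift_inj _ _)).
    by move=> w Ow; rewrite /fibre_trans ytrans_sheared// /fshear row_mxEr mxE.
  rewrite /xb /xibar (@sum_single _ _ _ s') => [|s2 s2s]; rewrite F.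
    by rewrite eqxx mul1r /xi xtrans_unsheared//; case: eqP => // _; rewrite quad_test_shear.
  by rewrite eq_sym (negPf s2s) mul0r.
pose C (L : jsp 3 -> R) g j := \sum_k \sum_l coef L g sigma [:: k; l; j] x0 * (a k * a l).
pose Q (L : jsp 3 -> R) g k j := coef L g sigma [:: k; j] x0
  - \sum_p 'D_(ebase p) (coef L g sigma [:: k; p; j]) x0.
have EQ b t j : \sum_k Q (lagL lam c) g k j * b k + t * C (lagL lam c) g j =
    \sum_k Q (lagL lam c') gb k j * b k + (t - \sum_i b i * e 0 i) * C (lagL lam c') gb j.
  have xiE s' w : setT w -> xi b t s' w = if s' == sigma then quad_test a x0 b t w else 0.
    by move=> _; rewrite /xi; case: eqP.
  have e1 := @lagmom_test R n m a x0 (lagL lam c) g (xi b t) setT sigma b t j openT I xiE.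
  have e2 := @lagmom_test R n m a x0 (lagL lam c') gb (xb b t) V sigma b _ j oV Vx (xbE b t).
  exact: (etrans (esym e1) (etrans (E b t j) e2)).
have Qs (L : jsp 3 -> R) h p q : Q L h p q = Q L h q p.
  have P2 : coef L h sigma [:: p; q] = coef L h sigma [:: q; p].
    by apply: funext => w; rewrite /coef (sdy_perm sigma L (J' := [:: q; p]))// (perm_catC [:: p]).
  have P3 w : coef L h sigma [:: p; w; q] = coef L h sigma [:: q; w; p].
    apply: funext => u; rewrite /coef (sdy_perm sigma L (J' := [:: q; w; p]))//.
    by rewrite -[[:: p; w; q]]/([:: p; w] ++ [:: q]) perm_catC /= perm_cons (perm_catC [:: p]).
  exact: (f_equal2 (fun (F : fn) r => F x0 - r) P2
    (eq_bigr _ (fun w _ => congr1 (fun F : fn => 'D_(ebase w) F x0) (P3 w)))).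
have CC j : cubic lam c a sigma j y = C (lagL lam c) g j.
  by rewrite /C /cubic /coef Eg3.
rewrite (eq_bigr _ (fun j _ => congr1 (fun w => a j * w) (CC j))).
exact: (symmetric_defect ae es (Qs (lagL lam c) g) (Qs (lagL lam c') gb) EQ).
Qed.

End ThirdFreeFromTheta.

(** * The equivalence *)

Theorem lemma7 (R : realType) (n m : nat) (X Y : topologicalType)
    (MX : manifold R n X) (MY : manifold R (n + m) Y) (pi : Y -> X)
    (hpi : fibered_manifold MX MY pi)
    (W : set Y) (hW : open W)
    (lam : lagrangian MX MY pi W 3) :
  (forall c c' : fchart MX MY pi, fdom c `<=` W -> fdom c' `<=` W ->
     forall z : jspace R n m 5, joverlap c c' z ->
     pullback (jtrans c c') (Theta (lagL lam c')) z = Theta (lagL lam c) z)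
  <->
  (forall c c' : fchart MX MY pi, fdom c `<=` W -> fdom c' `<=` W ->
     forall z : jspace R n m 4, joverlap c c' z ->
     forall (s : 'I_n) (sigma : 'I_m),
     \sum_(k < n) fd k (obstruction c c' (lagL lam c) k s sigma) z = 0).
Proof.
have [one|/existsNP[i /existsNP[k /eqP ik]]] := pselect (forall i k : 'I_n, i = k).
  split=> _ c c' cW cW' z Oz; last by apply: Theta_trans => //; left.
  by move=> s sigma; apply: big1 => k _; apply: fd_obstruction_third_free => //; left.
split=> H c c' cW cW' z Oz.
  move=> s sigma; apply: big1 => q _; apply: fd_obstruction_third_free => //; right.
  by apply: (third_free_of_Theta cW ik) => d dW w Ow; exact: H.
apply: Theta_trans => //; right.
by split; [apply: (third_free_of_obstruction cW ik)|apply: (third_free_of_obstruction cW' ik)] => d dW w Ow; exact: H.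
Qed.
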